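(* Let $N\ge 1$, let $V$ be a fixed $N\times N$ unitary matrix, and let $(U_t)_{t\ge 0}$ be the unitary Brownian motion on $\mathcal U_N(\mathbb C)$ started at $U_0=V$. Define, for $\lambda=(\lambda_1,\dots,\lambda_N)\in\mathbb C^N$ and $t\ge 0$, $$\varphi(\lambda;t)=\mathbb E\Big[\exp\sum_{j=1}^N\lambda_j|U_t^{j1}|^2\Big].$$ Then $\varphi$, the Laplace transform of the random vector $(|U_t^{j1}|^2)_{j=1,\dots,N}$, satisfies the partial differential equation $$\partial_t\varphi=\frac{\sum_{j=1}^N\lambda_j}{N}\,\varphi+\Big\langle\frac{\lambda^2}{N}-\lambda,\nabla_\lambda\varphi\Big\rangle-\frac1N\big\langle\lambda,H(\varphi)\lambda\big\rangle,$$ where $\lambda^2$ is the vector with coordinates $(\lambda^2)_j=\lambda_j^2$, $(\nabla_\lambda\varphi)_j=\partial_{\lambda_j}\varphi$ and $[H(\varphi)]_{jk}=\partial_{\lambda_j}\partial_{\lambda_k}\varphi$.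
   Context: $\mathcal U_N(\mathbb C)$ is the group of $N\times N$ complex unitary matrices. Hermitian Brownian motion $(H_t)_{t\ge0}$: the continuous centered Gaussian process in the real vector space of $N\times N$ Hermitian matrices, with $H_0=0$, such that $\mathbb E[\langle A,H_s\rangle\langle B,H_t\rangle]=\min(s,t)\langle A,B\rangle$ for all Hermitian $A,B$, where $\langle A,B\rangle=N\,\mathrm{Tr}(AB)$. Equivalently, its entries above the diagonal are $\frac1{\sqrt{2N}}(B_t^{kl}+iC_t^{kl})$ and its diagonal entries are $\frac1{\sqrt N}D_t^k$, with $B^{kl},C^{kl},D^k$ independent standard real Brownian motions. The unitary Brownian motion started at a unitary matrix $V$ is the solution of the It\^o stochastic differential equation $dU_t=i(dH_t)U_t-\frac12U_t\,dt$, $U_0=V$; it takes values in $\mathcal U_N(\mathbb C)$. $U_t^{jk}$ denotes the $(j,k)$ entry of $U_t$. In the claim, for vectors the bracket is the bilinear pairing $\langle x,y\rangle=\sum_jx_jy_j$. *)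

(* Defs.v *)
From HB Require Import structures.
From mathcomp Require Import all_boot all_order all_algebra.
From mathcomp Require Import complex.
From mathcomp Require Import all_classical all_reals all_analysis.

Set Implicit Arguments.
Unset Strict Implicit.
Unset Printing Implicit Defensive.

Import Order.TTheory GRing.Theory Num.Theory.
Import numFieldNormedType.Exports.

Local Open Scope classical_set_scope.
Local Open Scope ring_scope.
Local Open Scope complex_scope.
Local Open Scope sesquilinear_scope.

Section complex_tools.
Variable R : realType.

Definition cexp (z : R[i]) : R[i] :=
  (expR (complex.Re z) * cos (complex.Im z)) +i*
  (expR (complex.Re z) * sin (complex.Im z)).

Definition cintegrable d (X : measurableType d) (mu : {measure set X -> \bar R})
    (D : set X) (f : X -> R[i]) : Prop :=
  mu.-integrable D (fun x => (complex.Re (f x))%:E) /\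
  mu.-integrable D (fun x => (complex.Im (f x))%:E).

Definition cintegral d (X : measurableType d) (mu : {measure set X -> \bar R})
    (D : set X) (f : X -> R[i]) : R[i] :=
  (\int[mu]_(x in D) complex.Re (f x)) +i*
  (\int[mu]_(x in D) complex.Im (f x)).

(* Squared Frobenius norm, as a real number. *)
Definition sqnorm m n (A : 'M[R[i]]_(m, n)) : R :=
  \sum_i \sum_j (complex.Re (A i j) ^+ 2 + complex.Im (A i j) ^+ 2).

End complex_tools.

(* Times range over the half-line [0, +oo) of R; the values of F and of the
   processes at negative times are irrelevant. *)
Section processes.
Variables (R : realType) (d : measure_display) (T : measurableType d).
Variables (P : probability T R) (N : nat).

Local Notation cmx := 'M[R[i]]_N.
Local Notation process := (R -> T -> cmx).

Record filtration (F : R -> set (set T)) : Prop := {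
  filtration_sigma : forall t, 0 <= t -> sigma_algebra setT (F t);
  filtration_sub : forall t, 0 <= t -> F t `<=` measurable;
  filtration_mono : forall s t, 0 <= s -> s <= t -> F s `<=` F t }.

(* The events {Re X_ij \in B} and {Im X_ij \in B}, B Borel, which generate
   the sigma-algebra of the random matrix X. *)
Definition coord_events (X : T -> cmx) : set (set T) :=
  [set A | exists i j (B : set R), measurable B /\
     (A = (fun w => complex.Re (X w i j)) @^-1` B \/
      A = (fun w => complex.Im (X w i j)) @^-1` B)].

Definition measurable_wrt (G : set (set T)) (X : T -> cmx) : Prop :=
  coord_events X `<=` G.

Definition adapted (F : R -> set (set T)) (X : process) : Prop :=
  forall t, 0 <= t -> measurable_wrt (F t) (X t).

Definition independent_of (G : set (set T)) (X : T -> cmx) : Prop :=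
  forall A B, G A -> <<s coord_events X >> B ->
    P (A `&` B) = (P A * P B)%E.

Definition continuous_paths (X : process) : Prop :=
  forall w i j,
    {within `[0, +oo[, continuous (fun t => complex.Re (X t w i j))} /\
    {within `[0, +oo[, continuous (fun t => complex.Im (X t w i j))}.

(* <A, B> = N Tr(AB), which is real when A and B are Hermitian. *)
Definition herm_pairing (A B : cmx) : R := N%:R * complex.Re (\tr (A *m B)).

(* The second argument of normal_prob is the standard deviation; normal_prob
   is not the Dirac mass when it vanishes, so that case is separate. *)
Definition centered_gaussian (X : T -> R) : Prop :=
  measurable_fun setT X /\
  exists s : R, 0 <= s /\ forall B : set R, measurable B ->
    P (X @^-1` B) = if s == 0 then \d_(0 : R) B else normal_prob 0 s B.

Record hermitian_brownian_motion (H : process) : Prop := {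
  hbm_herm : forall t w, 0 <= t -> H t w \is hermsymmx;
  hbm_0 : forall w, H 0 w = 0;
  hbm_cont : continuous_paths H;
  hbm_gauss : forall n (A : 'I_n -> cmx) (t : 'I_n -> R),
    (forall k, A k \is hermsymmx) -> (forall k, 0 <= t k) ->
    centered_gaussian (fun w => \sum_k herm_pairing (A k) (H (t k) w));
  hbm_cov : forall (A B : cmx) (s t : R),
    A \is hermsymmx -> B \is hermsymmx -> 0 <= s -> 0 <= t ->
    'E_P[(fun w => herm_pairing A (H s w) * herm_pairing B (H t w))%R]%E
      = (Num.min s t * herm_pairing A B)%:E }.

Record brownian_filtration (F : R -> set (set T)) (H : process) : Prop := {
  bf_filtration : filtration F;
  bf_adapted : adapted F H;
  bf_indep : forall s t, 0 <= s -> s <= t ->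
    independent_of (F s) (fun w => H t w - H s w) }.

(* The step process equal to xi k on [tau k, tau k.+1), k < m. *)
Definition step (m : nat) (tau : nat -> R) (xi : nat -> T -> cmx) : process :=
  fun s w => \sum_(k < m) (if tau k <= s < tau k.+1 then xi k w else 0).

Definition step_integral (H : process) (m : nat) (tau : nat -> R)
    (xi : nat -> T -> cmx) : T -> cmx :=
  fun w => \sum_(k < m) (H (tau k.+1) w - H (tau k) w) *m xi k w.

(* Bounded adapted step processes on [0, t]. *)
Record simple_on (F : R -> set (set T)) (t : R) (m : nat) (tau : nat -> R)
    (xi : nat -> T -> cmx) : Prop := {
  simple_start : tau 0%N = 0;
  simple_end : tau m = t;
  simple_mono : forall k, (k < m)%N -> tau k <= tau k.+1;
  simple_meas : forall k, (k < m)%N -> measurable_wrt (F (tau k)) (xi k);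
  simple_bounded : exists K : R, forall k w,
    (k < m)%N -> sqnorm (xi k w) <= K }.

(* M is (a version of) the Ito integral of dH_s X_s over [0, t]: X is a limit
   of simple processes in L^2(Omega x [0, t]), and M is the limit in L^2(Omega)
   of their integrals. By the Ito isometry, M does not depend, up to null sets,
   on the approximating sequence. *)
Definition ito_integral (F : R -> set (set T)) (H : process) (t : R)
    (X : process) (M : T -> cmx) : Prop :=
  measurable_wrt measurable M /\
  exists (m : nat -> nat) (tau : nat -> nat -> R)
         (xi : nat -> nat -> T -> cmx),
    [/\ forall n, simple_on F t (m n) (tau n) (xi n),
        (fun n => \int[P]_w \int[lebesgue_measure]_(s in `[0%R, t])
           (sqnorm (X s w - step (m n) (tau n) (xi n) s w)%R)%:E)%E @ \oo --> 0%E
      & (fun n => \int[P]_w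
           (sqnorm (M w - step_integral H (m n) (tau n) (xi n) w)%R)%:E)%E
           @ \oo --> 0%E].

(* dU_t = i (dH_t) U_t - 1/2 U_t dt, U_0 = V, in integral form. That U is
   unitary is a consequence of the equation and is not required here. *)
Record unitary_brownian_motion (F : R -> set (set T)) (H : process) (V : cmx)
    (U : process) : Prop := {
  ubm_adapted : adapted F U;
  ubm_cont : continuous_paths U;
  ubm_0 : forall w, U 0 w = V;
  ubm_sde : forall t, 0 <= t -> exists M : T -> cmx,
    ito_integral F H t U M /\
    {ae P, forall w, U t w = V + 'i%C *: M w -
       2^-1 *: \matrix_(i, j)
         cintegral lebesgue_measure `[0, t] (fun s => U s w i j)} }.

End processes.

Section laplace.
Variables (R : realType) (d : measure_display) (T : measurableType d).
Variables (P : probability T R) (N : nat).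

(* exp (sum_j lambda_j |U_t^{jc}|^2), where c indexes a column *)
Definition exp_column (U : R -> T -> 'M[R[i]]_N) (c : 'I_N) (t : R)
    (lambda : 'rV[R[i]]_N) (w : T) : R[i] :=
  cexp (\sum_j lambda 0 j * `|U t w j c| ^+ 2).

(* The codomain R[i]^o is R[i] as a normed module over itself. *)
Definition laplace (U : R -> T -> 'M[R[i]]_N) (c : 'I_N) (t : R)
    (lambda : 'rV[R[i]]_N) : R[i]^o :=
  cintegral P setT (exp_column U c t lambda).

End laplace.

Section differential_operators.
Variables (R : realType) (N : nat).
Implicit Types (f : 'rV[R[i]]_N -> R[i]^o) (x y : 'rV[R[i]]_N).

Definition bilin x y : R[i] := \sum_j x 0 j * y 0 j.

Definition sqv x : 'rV[R[i]]_N := \row_j x 0 j ^+ 2.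

(* Complex partial derivatives: the field of scalars is R[i]. *)
Definition partial (j : 'I_N) f : 'rV[R[i]]_N -> R[i]^o :=
  fun x => 'D_('e_j) f x.

Definition partial_ex (j : 'I_N) f x : Prop := derivable f x 'e_j.

Definition grad f x : 'rV[R[i]]_N := \row_j partial j f x.

Definition hess f x : 'M[R[i]]_N := \matrix_(j, k) partial j (partial k f) x.

(* u has derivative l at t >= 0 as a function on [0, +oo); at t = 0 the
   derivative is one-sided. *)
Definition is_time_derivative (u : R -> R[i]^o) (t : R) (l : R[i]^o) : Prop :=
  (fun h : R => (h^-1)%:C *: (u (t + h) - u t)) @
    within [set h : R | 0 <= t + h] 0^' --> l.

End differential_operators.

(* Main.v *)
Require Import Defs.
From HB Require Import structures.
From mathcomp Require Import all_boot all_order all_algebra.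
From mathcomp Require Import complex.
From mathcomp Require Import all_classical all_reals all_analysis.
From mathcomp Require Import measurable_realfun.
From mathcomp Require Import ring lra.

(* Let x_t be a column of U_t. The Ito isometry turns the equation into the expansion
     x_t = x_s + i (H_t - H_s) x_s + i p - (t - s) / 2 x_s + q,
   with E |p|^2 = O((t - s)^2), p orthogonal to the bounded F_s-measurable variables, and
   E |q|^2 = O((t - s)^3). With the second moments of H_t - H_s, this gives
     E f(x_t) - E f(x_s) - (t - s) E (L f)(x_s) = O((t - s)^(3/2))
   for a second order operator L, without any Ito formula.

   For f = 1 / (a + |x|^2), a >= 1, one has L f = 0, so that E f(x_t) is constant; bounded test
   functions are used because no moment of x_t beyond the second is known at this stage. Since
   (z - 1)^2 / ((1 + z) (2 + z)) is an affine combination of 1, 1 / (1 + z) and 1 / (2 + z),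
   it follows that |x_t| = 1 almost surely.

   For f = exp (sum_j lambda_j X_j), with X_j = |x_j|^2 <= 1, the expansion shows that the time
   derivative of E f(x_t) is E (L f)(x_t). Here L f is f times a quadratic polynomial in the X_j,
   and the expectations of X_j f and X_j X_k f are the lambda-derivatives of E f. *)

Set Implicit Arguments.
Unset Strict Implicit.
Unset Printing Implicit Defensive.

Import Order.TTheory GRing.Theory Num.Theory.
Import numFieldNormedType.Exports.

Local Open Scope classical_set_scope.
Local Open Scope ring_scope.
Local Open Scope complex_scope.

(** The stochastic integral is given separately for each horizon, with its own approximating step
    processes. The remainder has two parts because p alone is too large: paired with a bounded
    variable it could contribute at order t - s, and only orthogonality removes it, whereas q is
    negligible by its size. An error of order (t - s)^(3/2) is enough, since its sum over a
    partition of mesh h is O(h^(1/2)).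

    L annihilates functions of |x|^2 for two reasons: as dH is Hermitian, i dH x is tangent to the
    sphere through x, and the Ito correction, (t - s) |x|^2 / N for each of the N coordinates,
    balances the drift - (t - s) |x|^2. Cubic Taylor terms are controlled by fourth moments of the
    Gaussian increments.

    The norm is 1 only almost surely, while Taylor bounds are wanted at every sample point; hence a
    normalised version of the column. Left difference quotients are expanded from t + h instead of
    t, so the continuity in time of E (L f)(x_t) is also established. *)

Local Notation Re := complex.Re.
Local Notation Im := complex.Im.
Local Notation "x ^*" := (@conjc _ x) : ring_scope.

(** * Complex-valued random variables *)

Section modulus.
Variable R : realType.
Implicit Types (x y z : R[i]) (a b : R).

Lemma cReD x y : Re (x + y) = Re x + Re y. Proof. by case: x y => [? ?] [? ?]. Qed.
Lemma cImD x y : Im (x + y) = Im x + Im y. Proof. by case: x y => [? ?] [? ?]. Qed.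
Lemma cReN x : Re (- x) = - Re x. Proof. by case: x. Qed.
Lemma cImN x : Im (- x) = - Im x. Proof. by case: x. Qed.
Lemma cReM x y : Re (x * y) = Re x * Re y - Im x * Im y.
Proof. by case: x y => [? ?] [? ?]. Qed.
Lemma cImM x y : Im (x * y) = Re x * Im y + Im x * Re y.
Proof. by case: x y => [? ?] [? ?]. Qed.
Lemma cReJ x : Re x^* = Re x. Proof. by case: x. Qed.
Lemma cImJ x : Im x^* = - Im x. Proof. by case: x. Qed.
Lemma cReC a : Re a%:C = a. Proof. by []. Qed.
Lemma cImC a : Im a%:C = 0. Proof. by []. Qed.

Lemma cRe_sum (I : Type) (r : seq I) (Q : pred I) (f : I -> R[i]) :
  Re (\sum_(i <- r | Q i) f i) = \sum_(i <- r | Q i) Re (f i).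
Proof. by elim/big_ind2 : _ => // ? ? ? ? <- <-; rewrite cReD. Qed.
Lemma ReIm_eq x y : Re x = Re y -> Im x = Im y -> x = y.
Proof. by case: x y => [? ?] [? ?] /= -> ->. Qed.

(* The library's [`|z|] is an element of [R[i]]; [nm z] is the modulus as an element of [R]. *)
Definition nm z : R := ComplexField.Normc.normc z.
Definition sqm z : R := Re z ^+ 2 + Im z ^+ 2.

Lemma sqm_ge0 z : 0 <= sqm z. Proof. by rewrite addr_ge0 ?sqr_ge0. Qed.
Lemma nmE z : nm z = Num.sqrt (sqm z). Proof. by case: z. Qed.
Lemma nm_ge0 z : 0 <= nm z. Proof. by rewrite nmE sqrtr_ge0. Qed.
Lemma nm_sqr z : nm z ^+ 2 = sqm z.
Proof. by rewrite nmE sqr_sqrtr ?sqm_ge0. Qed.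
Lemma nmM x y : nm (x * y) = nm x * nm y.
Proof. exact: ComplexField.Normc.normcM. Qed.
Lemma nmD x y : nm (x + y) <= nm x + nm y. Proof. exact: le_normcD. Qed.
Lemma nmN x : nm (- x) = nm x. Proof. exact: normcN. Qed.
Lemma nm0 : nm 0 = 0. Proof. exact: ComplexField.Normc.normc0. Qed.
Lemma nm1 : nm 1 = 1. Proof. exact: ComplexField.Normc.normc1. Qed.
Lemma nm0_eq0 z : nm z = 0 -> z = 0. Proof. exact: ComplexField.Normc.eq0_normc. Qed.
Lemma nmB x y : nm (x - y) <= nm x + nm y.
Proof. by rewrite -(nmN y) nmD. Qed.
Lemma nmJ x : nm x^* = nm x.
Proof. by rewrite !nmE /sqm cReJ cImJ sqrrN. Qed.
Lemma nmC a : nm a%:C = `|a|.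
Proof. by rewrite nmE /sqm cReC cImC expr0n addr0 sqrtr_sqr. Qed.
Lemma nmX x n : nm (x ^+ n) = nm x ^+ n.
Proof. by elim: n => [|n IH]; rewrite ?expr0 ?nm1// !exprS nmM IH. Qed.
Lemma nmi : nm ('i : R[i]) = 1.
Proof. by rewrite nmE /sqm /= expr0n add0r expr1n sqrtr1. Qed.
Lemma nm_sum (I : Type) (r : seq I) (Q : pred I) (f : I -> R[i]) :
  nm (\sum_(i <- r | Q i) f i) <= \sum_(i <- r | Q i) nm (f i).
Proof.
elim/big_ind2 : _ => [|x a y b hx hy|//]; first by rewrite nm0.
by rewrite (le_trans (nmD _ _))// lerD.
Qed.

Lemma normr_nm z : `|z| = (nm z)%:C. Proof. by []. Qed.

Lemma nm_Re z : `|Re z| <= nm z.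
Proof. by rewrite -(ler_pXn2r (ltn0Sn 1)) ?nnegrE ?nm_ge0// nm_sqr real_normK ?num_real// lerDl sqr_ge0. Qed.
Lemma nm_Im z : `|Im z| <= nm z.
Proof. by rewrite -(ler_pXn2r (ltn0Sn 1)) ?nnegrE ?nm_ge0// nm_sqr real_normK ?num_real// lerDr sqr_ge0. Qed.
Lemma nm_ReIm z : nm z <= `|Re z| + `|Im z|.
Proof.
rewrite -(ler_pXn2r (ltn0Sn 1)) ?nnegrE ?nm_ge0 ?addr_ge0// nm_sqr /sqm.
rewrite sqrrD !real_normK ?num_real//.
by rewrite -addrA [X in _ <= _ + X]addrC addrA lerDl mulrn_wge0// mulr_ge0.
Qed.

Lemma sqm0 : sqm 0 = 0. Proof. by rewrite -nm_sqr nm0 expr0n. Qed.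
Lemma sqmM x y : sqm (x * y) = sqm x * sqm y.
Proof. by rewrite -!nm_sqr nmM exprMn. Qed.
Lemma sqmJ x : sqm x^* = sqm x. Proof. by rewrite -!nm_sqr nmJ. Qed.
Lemma sqmN x : sqm (- x) = sqm x. Proof. by rewrite -!nm_sqr nmN. Qed.
Lemma sqmi x : sqm ('i * x) = sqm x. Proof. by rewrite sqmM -nm_sqr nmi expr1n mul1r. Qed.
Lemma sqmC a : sqm a%:C = a ^+ 2.
Proof. by rewrite -nm_sqr nmC real_normK ?num_real. Qed.
Lemma sqmE z : (sqm z)%:C = z * z^*.
Proof. by apply: ReIm_eq; rewrite ?cReM ?cImM ?cReC ?cImC ?cReJ ?cImJ /sqm; ring. Qed.
Lemma sqm_normr z : (sqm z)%:C = `|z| ^+ 2.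
Proof. by rewrite normr_nm -nm_sqr rmorphXn. Qed.
Lemma sqmD x y : sqm (x + y) <= 2 * sqm x + 2 * sqm y.
Proof.
rewrite /sqm cReD cImD -subr_ge0.
have -> : 2 * (Re x ^+ 2 + Im x ^+ 2) + 2 * (Re y ^+ 2 + Im y ^+ 2) -
  ((Re x + Re y) ^+ 2 + (Im x + Im y) ^+ 2) =
  (Re x - Re y) ^+ 2 + (Im x - Im y) ^+ 2 by ring.
by rewrite addr_ge0 ?sqr_ge0.
Qed.
Lemma sqmB x y : sqm (x - y) <= 2 * sqm x + 2 * sqm y.
Proof. by rewrite -(sqmN y) sqmD. Qed.
(** Cauchy-Schwarz by induction: for the partial sum [s], the induction hypothesis bounds
    [|s|^2 / n], and [2 |x| |s| <= n |x|^2 + |s|^2 / n] then raises the factor from [n] to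
    [n + 1]. *)
Lemma sqm_sum (n : nat) (f : 'I_n -> R[i]) :
  sqm (\sum_i f i) <= n%:R * \sum_i sqm (f i).
Proof.
elim: n f => [|n IH] f; first by rewrite !big_ord0 sqm0 mul0r.
have [n0|n0] := posnP n; first by subst n; rewrite !big_ord1 mul1r.
rewrite !big_ord_recl.
have {IH} IH := IH (fun i => f (lift ord0 i)).
set x := f ord0; set s := \sum_(i < n) _ in IH *; set S := \sum_(i < n) sqm _ in IH *.
have n0' : 0 < n%:R :> R by rewrite ltr0n.
have key : 2 * nm x * nm s <= n%:R * sqm x + n%:R^-1 * sqm s.
  rewrite -!nm_sqr -subr_ge0.
  have -> : n%:R * nm x ^+ 2 + n%:R^-1 * nm s ^+ 2 - 2 * nm x * nm s =
     n%:R^-1 * (n%:R * nm x - nm s) ^+ 2 by field; rewrite gt_eqF.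
  by apply: mulr_ge0; [rewrite invr_ge0 ltW|exact: sqr_ge0].
have h1 : sqm (x + s) <= sqm x + sqm s + 2 * nm x * nm s.
  rewrite -!nm_sqr (_ : _ + _ + _ = (nm x + nm s) ^+ 2); last by ring.
  by rewrite ler_pXn2r ?nnegrE ?addr_ge0 ?nm_ge0// nmD.
apply: (le_trans h1); apply: (le_trans (lerD (lexx _) key)).
have h2 : n%:R^-1 * sqm s <= S.
  by rewrite mulrC ler_pdivrMr// mulrC.
have F (a b c e k : R) : b <= k * c -> e * b <= c -> a + b + (k * a + e * b) <= (k + 1) * (a + c) by nra.
by rewrite -natr1; exact: F.
Qed.
End modulus.

Section cmeas.
Context d (T : measurableType d) (R : realType).
Implicit Types (f g : T -> R[i]).

(** Measurability by components avoids choosing a sigma-algebra on [R[i]]. The measurable type is a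
    parameter, so that the same closure lemmas serve for sub-sigma-algebras. *)
Definition cmeas f := measurable_fun setT (fun w => Re (f w)) /\
  measurable_fun setT (fun w => Im (f w)).

Lemma cmeas_cst (c : R[i]) : cmeas (fun=> c). Proof. by split. Qed.
Lemma cmeasD f g : cmeas f -> cmeas g -> cmeas (fun w => f w + g w).
Proof.
move=> [f1 f2] [g1 g2]; split.
  by under eq_fun do rewrite cReD; exact: measurable_funD.
by under eq_fun do rewrite cImD; exact: measurable_funD.
Qed.
Lemma cmeasM f g : cmeas f -> cmeas g -> cmeas (fun w => f w * g w).
Proof.
move=> [f1 f2] [g1 g2]; split.
  by under eq_fun do rewrite cReM; apply: measurable_funB; exact: measurable_funM.
by under eq_fun do rewrite cImM; apply: measurable_funD; exact: measurable_funM.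
Qed.
Lemma cmeasJ f : cmeas f -> cmeas (fun w => (f w)^*).
Proof.
move=> [f1 f2]; split; first by under eq_fun do rewrite cReJ.
by under eq_fun do rewrite cImJ; exact: measurable_funN.
Qed.
Lemma cmeasN f : cmeas f -> cmeas (fun w => - f w).
Proof.
move=> [f1 f2]; split; first by under eq_fun do rewrite cReN; exact: measurable_funN.
by under eq_fun do rewrite cImN; exact: measurable_funN.
Qed.
Lemma cmeasB f g : cmeas f -> cmeas g -> cmeas (fun w => f w - g w).
Proof. by move=> ? ?; apply: cmeasD => //; exact: cmeasN. Qed.
Lemma cmeasC (f : T -> R) : measurable_fun setT f -> cmeas (fun w => (f w)%:C).
Proof. by move=> mf; split => //=; exact: measurable_cst. Qed.
Lemma cmeas_sum (I : Type) (r : seq I) (F : I -> T -> R[i]) :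
  (forall i, cmeas (F i)) -> cmeas (fun w => \sum_(i <- r) F i w).
Proof.
move=> mF; elim: r => [|i r IH]; first by under eq_fun do rewrite big_nil; exact: cmeas_cst.
by under eq_fun do rewrite big_cons; exact: cmeasD.
Qed.
Lemma cmeas_sqm f : cmeas f -> measurable_fun setT (fun w => sqm (f w)).
Proof. by move=> [f1 f2]; apply: measurable_funD; exact: measurable_funX. Qed.
Lemma cmeas_exp f : cmeas f -> cmeas (fun w => cexp (f w)).
Proof.
move=> [f1 f2]; split; apply: measurable_funM.
- by apply: (measurableT_comp _ f1); exact: measurable_expR.
- by apply: (measurableT_comp _ f2); apply: continuous_measurable_fun; exact: continuous_cos.
- by apply: (measurableT_comp _ f1); exact: measurable_expR.
- by apply: (measurableT_comp _ f2); apply: continuous_measurable_fun; exact: continuous_sin.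
Qed.
End cmeas.

Local Open Scope complex_scope.

Section calculus.
Context d (T : measurableType d) (R : realType) (P : probability T R).

Definition rint (f : T -> R) := P.-integrable setT (EFin \o f).
Definition RE (f : T -> R) : R := \int[P]_w f w.
Definition cint (f : T -> R[i]) := cintegrable P setT f.
Definition CE (f : T -> R[i]) : R[i] := cintegral P setT f.

End calculus.
Section real_calculus.
Context d (T : measurableType d) (R : realType) (P : probability T R).
Implicit Types (f g : T -> R).
Local Notation rint := (rint P).
Local Notation RE := (RE P).

Lemma rint_meas f : rint f -> measurable_fun setT f.
Proof. by move=> /measurable_int /measurable_EFinP. Qed.

Lemma rint_le f g : measurable_fun setT f -> (forall w, `|f w| <= g w) ->
  rint g -> rint f.
Proof.
move=> mf fg; apply: le_integrable => //; first exact/measurable_EFinP.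
by move=> w _ /=; rewrite lee_fin (le_trans (fg w))// ler_norm.
Qed.

Lemma rint_cst (a : R) : rint (fun=> a).
Proof. by apply: finite_measure_integrable_cst. Qed.

Lemma rint_bnd f (a : R) : measurable_fun setT f -> (forall w, `|f w| <= a) -> rint f.
Proof. by move=> mf fa; apply: (rint_le mf fa); exact: rint_cst. Qed.

Lemma rintD f g : rint f -> rint g -> rint (fun w => f w + g w).
Proof. by move=> hf hg; have := integrableD measurableT hf hg; apply: eq_integrable. Qed.

Lemma rintZ (a : R) f : rint f -> rint (fun w => a * f w).
Proof. by move=> hf; have := integrableZl measurableT a hf; apply: eq_integrable. Qed.

Lemma rintN f : rint f -> rint (fun w => - f w).
Proof. by move=> hf; have := integrableN hf; apply: eq_integrable. Qed.

Lemma rintB f g : rint f -> rint g -> rint (fun w => f w - g w).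
Proof. by move=> ? ?; apply: rintD => //; exact: rintN. Qed.

Lemma rint_norm f : rint f -> rint (fun w => `|f w|).
Proof. by move/integrable_norm. Qed.

Lemma rint_sum (I : Type) (r : seq I) (F : I -> T -> R) :
  (forall i, rint (F i)) -> rint (fun w => \sum_(i <- r) F i w).
Proof.
move=> mF; elim: r => [|i r IH]; first by under eq_fun do rewrite big_nil; exact: rint_cst.
by under eq_fun do rewrite big_cons; exact: rintD.
Qed.

Lemma RE_cst (a : R) : RE (fun=> a) = a.
Proof.
rewrite /RE Rintegral_cst// -[RHS]mulr1; congr (a * _).
exact: (congr1 fine (probability_setT P)).
Qed.

Lemma RED f g : rint f -> rint g -> RE (fun w => f w + g w) = RE f + RE g.
Proof. by move=> hf hg; rewrite /RE RintegralD. Qed.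

Lemma REZ (a : R) f : rint f -> RE (fun w => a * f w) = a * RE f.
Proof. by move=> hf; rewrite /RE RintegralZl. Qed.

Lemma REN f : rint f -> RE (fun w => - f w) = - RE f.
Proof.
move=> hf; rewrite -mulN1r -REZ//; congr RE; apply/funext => w.
by rewrite mulN1r.
Qed.

Lemma REB f g : rint f -> rint g -> RE (fun w => f w - g w) = RE f - RE g.
Proof. by move=> hf hg; rewrite RED// ?REN//; exact: rintN. Qed.

Lemma RE_sum (I : Type) (r : seq I) (F : I -> T -> R) :
  (forall i, rint (F i)) -> RE (fun w => \sum_(i <- r) F i w) = \sum_(i <- r) RE (F i).
Proof.
move=> mF; elim: r => [|i r IH].
  by rewrite big_nil; under eq_fun do rewrite big_nil; rewrite RE_cst.
rewrite big_cons -IH -RED//; first by congr RE; apply/funext => w; rewrite big_cons.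
exact: rint_sum.
Qed.

Lemma RE_le f g : rint f -> rint g -> (forall w, f w <= g w) -> RE f <= RE g.
Proof. by move=> hf hg fg; apply: le_Rintegral. Qed.

Lemma RE_ge0 f : (forall w, 0 <= f w) -> 0 <= RE f.
Proof. by move=> f0; apply: Rintegral_ge0. Qed.

Lemma RE_norm f : rint f -> `|RE f| <= RE (fun w => `|f w|).
Proof. by move=> hf; apply: le_normr_Rintegral. Qed.

Lemma RE_EFin f : rint f -> (\int[P]_w (f w)%:E)%E = (RE f)%:E.
Proof. by move=> hf; rewrite /RE /Rintegral fineK//; exact: integrable_fin_num. Qed.

Lemma RE_ae f g : measurable_fun setT f -> measurable_fun setT g ->
  {ae P, forall w, f w = g w} -> RE f = RE g.
Proof.
move=> mf mg fg; rewrite /RE /Rintegral; congr fine.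
apply: ae_eq_integral => //; try exact/measurable_EFinP.
by apply: filterS fg => w -> _.
Qed.

Lemma rint_ae f g : measurable_fun setT g -> {ae P, forall w, f w = g w} ->
  rint f -> rint g.
Proof.
move=> mg fg hf; apply/integrableP; split; first exact/measurable_EFinP.
case/integrableP : (hf) => _; rewrite (ae_eq_integral (fun w => `|(EFin \o g) w|%E))//.
- by apply: measurableT_comp => //; apply/measurable_EFinP; exact: rint_meas.
- by apply: measurableT_comp => //; exact/measurable_EFinP.
- by apply: filterS fg => w /= -> _.
Qed.

End real_calculus.
Section complex_calculus.
Context d (T : measurableType d) (R : realType) (P : probability T R).
Implicit Types (f g : T -> R[i]).
Local Notation rint := (rint P).
Local Notation RE := (RE P).
Local Notation cint := (cint P).
Local Notation CE := (CE P).

Lemma cint_meas f : cint f -> cmeas f.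
Proof. by move=> [f1 f2]; split; [exact: rint_meas f1|exact: rint_meas f2]. Qed.

Lemma cint_le f (g : T -> R) : cmeas f -> (forall w, nm (f w) <= g w) -> rint g -> cint f.
Proof.
move=> [f1 f2] fg hg; split; [apply: (rint_le f1 _ hg)|apply: (rint_le f2 _ hg)] => w.
  exact: le_trans (nm_Re _) (fg w).
exact: le_trans (nm_Im _) (fg w).
Qed.

Lemma cint_bnd f (a : R) : cmeas f -> (forall w, nm (f w) <= a) -> cint f.
Proof. by move=> mf fa; apply: (cint_le mf fa); exact: rint_cst. Qed.

Lemma cint_cst (a : R[i]) : cint (fun=> a).
Proof. exact: (cint_bnd (cmeas_cst _ _) (fun=> lexx _)). Qed.

Lemma cintD f g : cint f -> cint g -> cint (fun w => f w + g w).
Proof.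
move=> [f1 f2] [g1 g2]; split.
  by under eq_fun do rewrite cReD; exact: rintD.
by under eq_fun do rewrite cImD; exact: rintD.
Qed.

Lemma cintN f : cint f -> cint (fun w => - f w).
Proof.
move=> [f1 f2]; split; first by under eq_fun do rewrite cReN; exact: rintN.
by under eq_fun do rewrite cImN; exact: rintN.
Qed.

Lemma cintB f g : cint f -> cint g -> cint (fun w => f w - g w).
Proof. by move=> ? ?; apply: cintD => //; exact: cintN. Qed.

Lemma cintJ f : cint f -> cint (fun w => (f w)^*).
Proof.
move=> [f1 f2]; split; first by under eq_fun do rewrite cReJ.
by under eq_fun do rewrite cImJ; exact: rintN.
Qed.

Lemma cintZ (a : R[i]) f : cint f -> cint (fun w => a * f w).
Proof.
move=> [f1 f2]; split.
  by under eq_fun do rewrite cReM; apply: rintB; exact: rintZ.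
by under eq_fun do rewrite cImM; apply: rintD; exact: rintZ.
Qed.

Lemma cint_sum (I : Type) (r : seq I) (F : I -> T -> R[i]) :
  (forall i, cint (F i)) -> cint (fun w => \sum_(i <- r) F i w).
Proof.
move=> mF; elim: r => [|i r IH]; first by under eq_fun do rewrite big_nil; exact: cint_cst.
by under eq_fun do rewrite big_cons; exact: cintD.
Qed.

Lemma ReCE f : Re (CE f) = RE (fun w => Re (f w)). Proof. by []. Qed.
Lemma ImCE f : Im (CE f) = RE (fun w => Im (f w)). Proof. by []. Qed.

Lemma eq_CE f g : (forall w, f w = g w) -> CE f = CE g.
Proof. by move=> fg; congr CE; exact/funext. Qed.
Lemma eq_RE (f g : T -> R) : (forall w, f w = g w) -> RE f = RE g.
Proof. by move=> fg; congr RE; exact/funext. Qed.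
Lemma eq_cint f g : (forall w, f w = g w) -> cint f -> cint g.
Proof. by move=> /funext ->. Qed.
Lemma eq_rint (f g : T -> R) : (forall w, f w = g w) -> rint f -> rint g.
Proof. by move=> /funext ->. Qed.

Lemma CED f g : cint f -> cint g -> CE (fun w => f w + g w) = CE f + CE g.
Proof.
move=> [f1 f2] [g1 g2]; apply: ReIm_eq.
  by rewrite cReD !ReCE; under eq_RE do rewrite cReD; rewrite RED.
by rewrite cImD !ImCE; under eq_RE do rewrite cImD; rewrite RED.
Qed.

Lemma CEZ (a : R[i]) f : cint f -> CE (fun w => a * f w) = a * CE f.
Proof.
move=> [f1 f2]; apply: ReIm_eq.
  rewrite cReM !ReCE ImCE; under eq_RE do rewrite cReM.
  by rewrite REB ?REZ//; exact: rintZ.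
rewrite cImM !ImCE ReCE; under eq_RE do rewrite cImM.
by rewrite RED ?REZ//; exact: rintZ.
Qed.

Lemma CEN f : cint f -> CE (fun w => - f w) = - CE f.
Proof.
by move=> hf; rewrite -mulN1r -CEZ//; apply: eq_CE => w; rewrite mulN1r.
Qed.

Lemma CEB f g : cint f -> cint g -> CE (fun w => f w - g w) = CE f - CE g.
Proof. by move=> hf hg; rewrite CED// ?CEN//; exact: cintN. Qed.

Lemma CEJ f : cint f -> CE (fun w => (f w)^*) = (CE f)^*.
Proof.
move=> [f1 f2]; apply: ReIm_eq.
  by rewrite cReJ !ReCE; under eq_RE do rewrite cReJ.
by rewrite cImJ !ImCE; under eq_RE do rewrite cImJ; rewrite REN.
Qed.

Lemma CE_cst (a : R[i]) : CE (fun=> a) = a.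
Proof. by apply: ReIm_eq; rewrite ?ReCE ?ImCE RE_cst. Qed.

Lemma CEC (f : T -> R) : CE (fun w => (f w)%:C) = (RE f)%:C.
Proof. by apply: ReIm_eq; rewrite ?ReCE ?ImCE ?cReC ?cImC//= RE_cst. Qed.

Lemma CE_sum (I : Type) (r : seq I) (F : I -> T -> R[i]) :
  (forall i, cint (F i)) -> CE (fun w => \sum_(i <- r) F i w) = \sum_(i <- r) CE (F i).
Proof.
move=> mF; elim: r => [|i r IH].
  by rewrite big_nil; under eq_CE do rewrite big_nil; rewrite CE_cst.
rewrite big_cons -IH -CED//; first by apply: eq_CE => w; rewrite big_cons.
exact: cint_sum.
Qed.

(** The factor 2 comes from bounding the real and imaginary parts separately; only orders of
    magnitude matter in what follows. *)
Lemma CE_le f (g : T -> R) : cint f -> rint g -> (forall w, nm (f w) <= g w) ->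
  nm (CE f) <= 2 * RE g.
Proof.
move=> [f1 f2] hg fg; rewrite (le_trans (nm_ReIm _))// mulr_natl mulr2n lerD//.
  rewrite ReCE (le_trans (RE_norm _))// RE_le//; first exact: rint_norm.
  by move=> w; rewrite (le_trans (nm_Re _)).
rewrite ImCE (le_trans (RE_norm _))// RE_le//; first exact: rint_norm.
by move=> w; rewrite (le_trans (nm_Im _)).
Qed.

Lemma CE_ae f g : cmeas f -> cmeas g -> {ae P, forall w, f w = g w} -> CE f = CE g.
Proof.
move=> [f1 f2] [g1 g2] fg; apply: ReIm_eq; rewrite ?ReCE ?ImCE; apply: RE_ae => //;
  by apply: filterS fg => w ->.
Qed.

Lemma cint_ae f g : cmeas g -> {ae P, forall w, f w = g w} -> cint f -> cint g.
Proof.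
move=> [g1 g2] fg [f1 f2]; split; [apply: rint_ae g1 _ f1|apply: rint_ae g2 _ f2];
  by apply: filterS fg => w ->.
Qed.

Definition l2 f := cmeas f /\ rint (fun w => sqm (f w)).

Lemma l2_meas f : l2 f -> cmeas f. Proof. by case. Qed.
Lemma l2_int f : l2 f -> rint (fun w => sqm (f w)). Proof. by case. Qed.

Lemma l2_le f (g : T -> R) : cmeas f -> (forall w, sqm (f w) <= g w) -> rint g -> l2 f.
Proof.
move=> mf fg hg; split => //; apply: rint_le (cmeas_sqm mf) _ hg => w.
by rewrite ger0_norm ?sqm_ge0.
Qed.

Lemma l2D f g : l2 f -> l2 g -> l2 (fun w => f w + g w).
Proof.
move=> [mf hf] [mg hg]; apply: (l2_le (cmeasD mf mg) (fun w => sqmD _ _)).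
by apply: rintD; exact: rintZ.
Qed.

Lemma l2Z (a : R[i]) f : l2 f -> l2 (fun w => a * f w).
Proof.
move=> [mf hf]; split; first by apply: cmeasM => //; exact: cmeas_cst.
by under eq_fun do rewrite sqmM; exact: rintZ.
Qed.

Lemma l2N f : l2 f -> l2 (fun w => - f w).
Proof.
by move=> [mf hf]; split; [exact: cmeasN|under eq_fun do rewrite sqmN].
Qed.

Lemma l2B f g : l2 f -> l2 g -> l2 (fun w => f w - g w).
Proof. by move=> ? ?; apply: l2D => //; exact: l2N. Qed.

Lemma l2J f : l2 f -> l2 (fun w => (f w)^*).
Proof.
by move=> [mf hf]; split; [exact: cmeasJ|under eq_fun do rewrite sqmJ].
Qed.

Lemma l2_bnd f (a : R) : cmeas f -> (forall w, nm (f w) <= a) -> l2 f.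
Proof.
move=> mf fa; apply: (@l2_le f (fun=> a ^+ 2) mf); last exact: rint_cst.
by move=> w; rewrite -nm_sqr ler_pXn2r ?nnegrE ?nm_ge0// (le_trans (nm_ge0 _) (fa w)).
Qed.

Lemma l2_cst (a : R[i]) : l2 (fun=> a).
Proof. exact: (l2_bnd (cmeas_cst _ _) (fun=> lexx _)). Qed.

Lemma l2_sum (I : Type) (r : seq I) (F : I -> T -> R[i]) :
  (forall i, l2 (F i)) -> l2 (fun w => \sum_(i <- r) F i w).
Proof.
move=> mF; elim: r => [|i r IH]; first by under eq_fun do rewrite big_nil; exact: l2_cst.
by under eq_fun do rewrite big_cons; exact: l2D.
Qed.

Lemma l2_bndM f g (a : R) : cmeas f -> (forall w, nm (f w) <= a) -> l2 g -> l2 (fun w => f w * g w).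
Proof.
move=> mf fa [mg hg]; apply: (l2_le (cmeasM mf mg) _ (rintZ (a ^+ 2) hg)) => w.
rewrite sqmM ler_wpM2r ?sqm_ge0// -nm_sqr ler_pXn2r ?nnegrE ?nm_ge0//.
exact: le_trans (nm_ge0 _) (fa w).
Qed.

Lemma amgm (e a b : R) : 0 < e -> a * b <= 2^-1 * (e * a ^+ 2 + e^-1 * b ^+ 2).
Proof.
move=> e0; rewrite -subr_ge0.
have -> : 2^-1 * (e * a ^+ 2 + e^-1 * b ^+ 2) - a * b = (2^-1 * e^-1) * (e * a - b) ^+ 2.
  by field; rewrite gt_eqF.
by apply: mulr_ge0; [rewrite mulr_ge0// invr_ge0 ltW|exact: sqr_ge0].
Qed.

Lemma nmM_amgm (e : R) (x y : R[i]) : 0 < e ->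
  nm (x * y) <= 2^-1 * (e * sqm x + e^-1 * sqm y).
Proof. by move=> e0; rewrite nmM -!nm_sqr; exact: amgm. Qed.

Lemma l2_cintM f g : l2 f -> l2 g -> cint (fun w => f w * g w).
Proof.
move=> [mf hf] [mg hg].
apply: (cint_le (cmeasM mf mg) (fun w => nmM_amgm (f w) (g w) ltr01)).
by apply: rintZ; apply: rintD; exact: rintZ.
Qed.

Lemma l2_cint f : l2 f -> cint f.
Proof.
by move=> hf; have := l2_cintM (l2_cst 1) hf; apply: eq_cint => w; rewrite mul1r.
Qed.

(** A weighted substitute for Cauchy-Schwarz: the free weight [e] will be the ratio of the orders of
    the two factors. The factor 2 of [CE_le] cancels the 1/2 of [amgm]. *)
Lemma CEM_amgm (e : R) f g : 0 < e -> l2 f -> l2 g ->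
  nm (CE (fun w => f w * g w)) <=
    e * RE (fun w => sqm (f w)) + e^-1 * RE (fun w => sqm (g w)).
Proof.
move=> e0 [mf hf] [mg hg].
have hfg : rint (fun w => e * sqm (f w) + e^-1 * sqm (g w)) by apply: rintD; exact: rintZ.
have := CE_le (l2_cintM (conj mf hf) (conj mg hg)) (rintZ 2^-1 hfg)
  (fun w => nmM_amgm (f w) (g w) e0).
by rewrite REZ// mulrA divff ?mul1r ?pnatr_eq0// RED ?REZ//; exact: rintZ.
Qed.

End complex_calculus.

(** * Independent factors *)

Section independence.
Context d (T : measurableType d) (R : realType) (P : probability T R).
Implicit Types (X Y : T -> R).

Lemma measurable_fun_sub (G : set (set T)) d' (T' : measurableType d') (X : T -> T') :
  G `<=` measurable ->
  measurable_fun (setT : set (g_sigma_algebraType G)) (X : g_sigma_algebraType G -> T') ->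
  measurable_fun setT X.
Proof.
move=> Gm mX _ B mB; rewrite setTI; have := mX measurableT B mB; rewrite setTI.
by apply: smallest_sub => //; exact: sigma_algebra_measurable.
Qed.

Variables (G1 G2 : set (set T)).
Hypotheses (G1m : G1 `<=` measurable) (G2m : G2 `<=` measurable).
Hypothesis indep : forall A B, <<s G1 >> A -> <<s G2 >> B ->
  P (A `&` B) = (P A * P B)%E.

Section real_pair.
Variables (X Y : T -> R).
Hypothesis (mX1 : measurable_fun (setT : set (g_sigma_algebraType G1)) (X : g_sigma_algebraType G1 -> R)).
Hypothesis (mY1 : measurable_fun (setT : set (g_sigma_algebraType G2)) (Y : g_sigma_algebraType G2 -> R)).

Let mX : measurable_fun setT X := measurable_fun_sub G1m mX1.
Let mY : measurable_fun setT Y := measurable_fun_sub G2m mY1.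
Let XY w := (X w, Y w).
Let mXY : measurable_fun setT XY. Proof. exact: measurable_fun_pair. Qed.
Let X' : {mfun T >-> measurableTypeR R} :=
  MeasurableFun.Pack (MeasurableFun.Class (isMeasurableFun.Build _ _ T (measurableTypeR R) X mX)).
Let Y' : {mfun T >-> measurableTypeR R} :=
  MeasurableFun.Pack (MeasurableFun.Class (isMeasurableFun.Build _ _ T (measurableTypeR R) Y mY)).
Let XY' : {mfun T >-> (measurableTypeR R * measurableTypeR R)%type} :=
  MeasurableFun.Pack (MeasurableFun.Class (isMeasurableFun.Build _ _ T
    (measurableTypeR R * measurableTypeR R)%type XY mXY)).

Let pX : probability (measurableTypeR R) R := distribution P X'.
Let pY : probability (measurableTypeR R) R := distribution P Y'.
Let pXY : probability (measurableTypeR R * measurableTypeR R)%type R :=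
  distribution P XY'.

(** Two measures on the product that agree on rectangles coincide, and on rectangles this is the
    independence hypothesis. *)
Let joint A : measurable A -> (pX \x pY)%E A = pXY A.
Proof.
apply: product_measure_unique => B C mB mC; rewrite /pXY /pX /pY /=.
rewrite /distribution /pushforward /=.
rewrite -indep; last 2 first.
- by have := mX1 measurableT mB; rewrite setTI.
- by have := mY1 measurableT mC; rewrite setTI.
by [].
Qed.

Hypotheses (iX : rint P X) (iY : rint P Y).
Let f (z : measurableTypeR R * measurableTypeR R) : \bar R := (z.1 * z.2)%:E.
Let mf : measurable_fun setT f.
Proof.
apply/measurable_EFinP; apply: measurable_funM; [exact: measurable_fst|exact: measurable_snd].
Qed.

(** Tonelli for the absolute values; its finiteness is the integrability over the product that
    Fubini needs for [z.1 * z.2]. *)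
Let int12 : (\int[pX]_x \int[pY]_y `|f (x, y)|)%E = (RE P (fun w => `|X w|) * RE P (fun w => `|Y w|))%:E.
Proof.
have hY (x : R) : (\int[pY]_y `|f (x, y)|)%E = ((`|x| * RE P (fun w => `|Y w|))%:E)%E.
  under eq_integral do rewrite /f /= normrM EFinM.
  rewrite ge0_integralZl//; last by apply/measurable_EFinP; exact: (@normr_measurable R setT).
  rewrite EFinM ge0_integral_distribution//; last first.
    by apply/measurable_EFinP; exact: (@normr_measurable R setT).
  by congr (_ * _)%E; rewrite -RE_EFin//; exact: rint_norm.
under eq_integral do rewrite hY EFinM.
rewrite ge0_integralZr//; last 2 first.
- by apply/measurable_EFinP; exact: (@normr_measurable R setT).
- by rewrite lee_fin; apply: RE_ge0.
rewrite EFinM ge0_integral_distribution//; last first.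
  by apply/measurable_EFinP; exact: (@normr_measurable R setT).
by congr (_ * _)%E; rewrite -RE_EFin//; exact: rint_norm.
Qed.

Let fint : (pX \x pY)%E.-integrable setT f.
Proof. by apply/(integrable12ltyP pX pY mf); rewrite int12 ltry. Qed.

Lemma indep_rint : rint P (fun w => X w * Y w).
Proof.
apply/integrableP; split.
  by apply/measurable_EFinP; exact: measurable_funM.
have -> : (\int[P]_w `|(X w * Y w)%:E| = \int[pXY]_z `|f z|)%E.
  rewrite ge0_integral_distribution//; exact: measurableT_comp.
rewrite (eq_measure_integral (pX \x pY)%E); last by move=> A mA _; exact: esym (joint mA).
by case/integrableP : fint.
Qed.

Lemma indep_RE : RE P (fun w => X w * Y w) = RE P X * RE P Y.
Proof.
apply: EFin_inj; rewrite -RE_EFin; last exact: indep_rint.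
have -> : (\int[P]_w (X w * Y w)%:E = \int[pXY]_z f z)%E.
  by rewrite integral_distribution//; exact: indep_rint.
rewrite (eq_measure_integral (pX \x pY)%E); last by move=> A mA _; exact: esym (joint mA).
rewrite -integral12_prod_meas1//.
have hY (x : R) : (\int[pY]_y f (x, y))%E = (x * RE P Y)%:E.
  under eq_integral do rewrite /f /= EFinM.
  rewrite integralZl//; last first.
    by apply: integrable_pushforward.
  rewrite EFinM integral_distribution; [|exact/measurable_EFinP|exact: iY].
  by congr (_ * _)%E; rewrite -RE_EFin.
rewrite /fubini_F; under eq_integral do rewrite hY EFinM.
rewrite integralZr//; last by apply: integrable_pushforward.
rewrite EFinM integral_distribution; [|exact/measurable_EFinP|exact: iX].
by congr (_ * _)%E; rewrite -RE_EFin.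
Qed.

End real_pair.

(** [cmeas] itself, on the carrier equipped with the sigma-algebra generated by [G]; every closure
    lemma for [cmeas] applies to it unchanged. *)
Definition gmeas (G : set (set T)) (f : T -> R[i]) :=
  @cmeas _ (g_sigma_algebraType G) R f.

Lemma indep_cint (f g : T -> R[i]) : gmeas G1 f -> gmeas G2 g ->
  cint P f -> cint P g -> cint P (fun w => f w * g w).
Proof.
move=> [mf1 mf2] [mg1 mg2] [f1 f2] [g1 g2]; split.
  by under eq_fun do rewrite cReM; apply: rintB; exact: indep_rint.
by under eq_fun do rewrite cImM; apply: rintD; exact: indep_rint.
Qed.

Lemma indep_CE (f g : T -> R[i]) : gmeas G1 f -> gmeas G2 g ->
  cint P f -> cint P g -> CE P (fun w => f w * g w) = CE P f * CE P g.
Proof.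
move=> [mf1 mf2] [mg1 mg2] [f1 f2] [g1 g2]; apply: ReIm_eq.
  rewrite cReM !ReCE !ImCE; under eq_RE do rewrite cReM.
  by rewrite REB ?indep_RE//; exact: indep_rint.
rewrite cImM !ReCE !ImCE; under eq_RE do rewrite cImM.
by rewrite RED ?indep_RE//; exact: indep_rint.
Qed.

End independence.

Section gmeas.
Context d (T : measurableType d) (R : realType).
Implicit Types (f : T -> R[i]).

Lemma gmeas_sub (G : set (set T)) f : G `<=` measurable -> gmeas G f -> cmeas f.
Proof. by move=> Gm [f1 f2]; split; exact: (measurable_fun_sub Gm). Qed.

Lemma gmeasS (G G' : set (set T)) f : G `<=` <<s G' >> -> gmeas G f -> gmeas G' f.
Proof.
have sub : G `<=` <<s G' >> -> <<s G >> `<=` <<s G' >>.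
  by move=> GG'; apply: smallest_sub => //; exact: smallest_sigma_algebra.
move=> /sub GG' [f1 f2]; split => _ B mB; apply: GG'; [exact: f1|exact: f2].
Qed.
End gmeas.

(** * Gaussian increments *)

Section normal_moments.
Variable R : realType.
Local Notation mu := (@lebesgue_measure R).

(** The change of variables comes with the abstract Radon-Nikodym derivative. The latter equals the
    Gaussian density almost everywhere because both have the same integral over every measurable
    set. *)
Lemma ge0_integral_normal (m s : R) (f : R -> \bar R) :
  measurable_fun setT f -> (forall x, (0 <= f x)%E) ->
  (\int[normal_prob m s]_x f x = \int[mu]_x (f x * (normal_pdf m s x)%:E))%E.
Proof.
move=> mf f0; have dom := @normal_prob_dominates R m s.
rewrite -(Radon_Nikodym_SigmaFinite.change_of_variables dom)//.
have gi := Radon_Nikodym_SigmaFinite.f_integrable dom.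
apply: ae_eq_integral => //.
- by apply: emeasurable_funM => //; exact: measurable_int gi.
- by apply: emeasurable_funM => //; apply/measurable_EFinP; exact: measurable_normal_pdf.
- apply: ae_eqe_mul2l; apply: integral_ae_eq => //.
  + by apply/measurable_EFinP; exact: measurable_normal_pdf.
  + by move=> E _ mE; rewrite -Radon_Nikodym_SigmaFinite.f_integral.
Qed.

Lemma integral_oppr (f : R -> \bar R) : measurable_fun setT f -> (forall x, (0 <= f x)%E) ->
  (\int[mu]_x f (- x)%R = \int[mu]_x f x)%E.
Proof.
move=> mf f0.
have mN : measurable_fun setT (-%R : R -> measurableTypeR R) by exact: oppr_measurable.
transitivity (\int[pushforward mu (-%R : R -> measurableTypeR R)]_x f x)%E.
  by rewrite ge0_integral_pushforward.
by apply: eq_measure_integral => A mA _; exact: lebesgue_measureN.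
Qed.

Lemma normal_pdf_pos (s x : R) : 0 < s ->
  normal_pdf 0 s x = normal_peak s * normal_fun 0 s x.
Proof. by move=> s0; rewrite /normal_pdf gt_eqF. Qed.

Lemma normal_pdfN (s x : R) : 0 < s -> normal_pdf 0 s (- x) = normal_pdf 0 s x.
Proof. by move=> s0; rewrite !normal_pdf_pos// /normal_fun !subr0 sqrrN. Qed.

(** Trades [x ^ 4] for a wider Gaussian, so that the fourth moment is bounded without being
    computed. With [y = x^2 / s^2], the two densities have ratio [exp (3 y / 8) / 2], and
    [y^2 <= 16 exp (3 y / 8)]. *)
Lemma normal_pdf_dom (s x : R) : 0 < s ->
  x ^+ 4 * normal_pdf 0 s x <= 32 * s ^+ 4 * normal_pdf 0 (2 * s) x.
Proof.
move=> s0; have s20 : 2 * s != 0 by rewrite mulf_neq0// gt_eqF.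
rewrite !normal_pdf_pos ?mulr_gt0// /normal_fun /normal_peak !subr0.
have -> : (2 * s) ^+ 2 * pi *+ 2 = 2 ^+ 2 * (s ^+ 2 * pi *+ 2) by ring.
rewrite sqrtrM ?exprn_ge0// sqrtr_sqr ger0_norm// invfM.
set p := Num.sqrt _; set q := p^-1.
have q0 : 0 <= q by rewrite invr_ge0 sqrtr_ge0.
set y := x ^+ 2 / s ^+ 2.
have y0 : 0 <= y by rewrite divr_ge0 ?sqr_ge0.
have -> : - x ^+ 2 / (s ^+ 2 *+ 2) = - (y / 2) by rewrite /y; field; rewrite gt_eqF.
have -> : - x ^+ 2 / ((2 * s) ^+ 2 *+ 2) = 3 / 8 * y - y / 2 by rewrite /y; field; rewrite gt_eqF.
have -> : x ^+ 4 = y ^+ 2 * s ^+ 4 by rewrite /y; field; rewrite gt_eqF.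
rewrite expRD.
have h := @expR_ge1Dxn R (3 / 8 * y) 1.
have {}h : 1 + (3 / 8 * y) ^+ 2 / 2 <= expR (3 / 8 * y).
  by apply: h; rewrite mulr_ge0// divr_ge0.
have : y ^+ 2 <= 16 * expR (3 / 8 * y) by nra.
set e1 := expR (3 / 8 * y); set e2 := expR (- _); move=> hy.
have -> : 32 * s ^+ 4 * (2^-1 * q * (e1 * e2)) = (16 * e1) * (s ^+ 4 * q * e2) by field.
have -> : y ^+ 2 * s ^+ 4 * (q * e2) = y ^+ 2 * (s ^+ 4 * q * e2) by ring.
by rewrite ler_wpM2r// mulr_ge0 ?expR_ge0// mulr_ge0// exprn_ge0// ltW.
Qed.

(** This amounts to [pi >= 2]; the constant is chosen so that an interval of length [s] has mass at
    most one half. *)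
Lemma normal_peak_le (s : R) : 0 < s -> normal_peak s <= (2 * s)^-1.
Proof.
move=> s0; rewrite /normal_peak.
have h0 : 0 <= s ^+ 2 * pi *+ 2 by rewrite mulrn_wge0// mulr_ge0 ?sqr_ge0 ?pi_ge0.
have h : 2 * s <= Num.sqrt (s ^+ 2 * pi *+ 2).
  rewrite -ler_sqr ?nnegrE ?sqrtr_ge0 ?(mulr_ge0 _ (ltW s0))// sqr_sqrtr//.
  rewrite -subr_ge0 (_ : _ - _ = 2 * (s ^+ 2 * (pi - 2))); last by ring.
  by rewrite mulr_ge0// mulr_ge0 ?sqr_ge0// subr_ge0 pi_ge2.
rewrite lef_pV2// ?posrE ?mulr_gt0//.
by rewrite (lt_le_trans _ h)// mulr_gt0.
Qed.

End normal_moments.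

(* Any constant K with E X^4 <= K (E X^2)^2 for centered Gaussian X would do. *)
Definition kurtosis_bound (R : realType) : R := 2 ^+ 11.
Lemma kurtosis_bound_ge0 (R : realType) : 0 <= kurtosis_bound R. Proof. exact: exprn_ge0. Qed.

Section gaussian_moments.
Context d (T : measurableType d) (R : realType) (P : probability T R).
Variable X : T -> R.
Hypothesis gX : centered_gaussian P X.
Local Notation mu := (@lebesgue_measure R).

Let mX : measurable_fun setT X. Proof. by case: gX. Qed.
Let X' : {mfun T >-> measurableTypeR R} :=
  MeasurableFun.Pack (MeasurableFun.Class (isMeasurableFun.Build _ _ T (measurableTypeR R) X mX)).

Section positive_deviation.
Variable s : R.
Hypotheses (s0 : 0 < s) (law : forall B : set R, measurable B -> P (X @^-1` B) = normal_prob 0 s B).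

Let lawE (f : R -> \bar R) : measurable_fun setT f -> (forall x, (0 <= f x)%E) ->
  (\int[P]_w f (X w) = \int[mu]_x (f x * (normal_pdf 0 s x)%:E))%E.
Proof.
move=> mf f0; rewrite -ge0_integral_normal//.
transitivity (\int[distribution P X']_x f x)%E.
  by rewrite ge0_integral_distribution.
by apply: eq_measure_integral => A mA _; exact: law.
Qed.

Let pdf_ge0 x : (0 <= (normal_pdf 0 s x)%:E)%E.
Proof. by rewrite lee_fin normal_pdf_ge0. Qed.

Let pow4 : (\int[P]_w (X w ^+ 4)%:E <= (32 * s ^+ 4)%:E)%E.
Proof.
rewrite (@lawE (fun x => (x ^+ 4)%:E)); last 2 first.
- by apply/measurable_EFinP; exact: exprn_measurable.
- by move=> x; rewrite lee_fin exprn_even_ge0.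
apply: (@le_trans _ _ (\int[mu]_x ((32 * s ^+ 4)%:E * (normal_pdf 0 (2 * s) x)%:E))%E).
  apply: ge0_le_integral => //.
  - by move=> x _; rewrite mule_ge0// lee_fin exprn_even_ge0.
  - apply: emeasurable_funM; apply/measurable_EFinP; first exact: exprn_measurable.
    exact: measurable_normal_pdf.
  - apply: emeasurable_funM; apply/measurable_EFinP => //.
    exact: measurable_normal_pdf.
  - by move=> x _; rewrite -!EFinM lee_fin normal_pdf_dom.
rewrite ge0_integralZl//; last 3 first.
- by apply/measurable_EFinP; exact: measurable_normal_pdf.
- by move=> x _; rewrite lee_fin normal_pdf_ge0.
- by rewrite lee_fin mulr_ge0// exprn_ge0// ltW.
by rewrite integral_normal_pdf mule1.
Qed.

Let rint4 : rint P (fun w => X w ^+ 4).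
Proof.
apply/integrableP; split; first by apply/measurable_EFinP; exact: measurable_funX.
under eq_integral do rewrite /= ger0_norm ?exprn_even_ge0//.
by rewrite (le_lt_trans pow4)// ltry.
Qed.

Let rint2 : rint P (fun w => X w ^+ 2).
Proof.
apply: (@rint_le _ _ _ P _ (fun w => 1 + X w ^+ 4)).
- exact: measurable_funX.
- move=> w; rewrite ger0_norm ?sqr_ge0//; set y := X w.
  by have := sqr_ge0 (y ^+ 2 - 2^-1); nra.
- by apply: rintD => //; exact: rint_cst.
Qed.

(** The interval has length [s] and the density is at most [1 / (2 s)]. This anticoncentration
    yields a lower bound of the variance without evaluating it. *)
Let small : (P [set w | (`|X w| < s / 2)%R] <= (2^-1)%:E)%E.
Proof.
have -> : [set w | `|X w| < s / 2] = X @^-1` `](- (s / 2)), (s / 2)[.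
  by apply/seteqP; split => w /=; rewrite in_itv/= ltr_norml.
rewrite law// /normal_prob.
apply: (@le_trans _ _ (\int[mu]_(x in `](- (s / 2))%R, (s / 2)%R[) (normal_peak s)%:E)%E).
  apply: ge0_le_integral => //.
  - by apply/measurable_funTS/measurable_EFinP; exact: measurable_normal_pdf.
  - by move=> x _; rewrite lee_fin normal_pdf_ub// gt_eqF.
rewrite integral_cst//= lebesgue_measure_itv/= lte_fin.
rewrite (_ : - (s / 2) < s / 2); last by rewrite -subr_gt0 opprK -splitr.
rewrite -EFinB -EFinM lee_fin opprK -splitr.
have := normal_peak_le s0.
rewrite -(ler_pM2r s0) => h; apply: (le_trans h).
by rewrite invfM -mulrA mulVf ?mulr1// gt_eqF.
Qed.

(** Off an event of probability at most one half, [X ^ 2] is at least [s^2 / 4]. *)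
Let var_lb : s ^+ 2 / 8 <= RE P (fun w => X w ^+ 2).
Proof.
pose A := [set w | `|X w| < s / 2].
have mA : measurable A.
  rewrite /A (_ : [set _ | _] = X @^-1` `](- (s / 2)), (s / 2)[).
    by rewrite -[X in measurable X]setTI; exact: mX.
  by apply/seteqP; split => w /=; rewrite in_itv/= ltr_norml.
have iA : rint P (\1_A : T -> R) by apply: integrable_indic.
have PA : RE P (\1_A) = fine (P A).
  by rewrite /RE /Rintegral integral_indic// setIT.
have PA2 : RE P (\1_A) <= 2^-1.
  rewrite PA -lee_fin fineK ?small//; exact: fin_num_measure.
have : RE P (fun w => (s / 2) ^+ 2 * (1 - \1_A w)) <= RE P (fun w => X w ^+ 2).
  apply: RE_le => //.
    by apply: rintZ; apply: rintB => //; exact: rint_cst.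
  move=> w; rewrite indicE; case: (boolP (w \in A)) => wA.
    by rewrite subrr mulr0 sqr_ge0.
  rewrite subr0 mulr1 -(real_normK (num_real (X w))) ler_pXn2r ?nnegrE//.
    by rewrite leNgt; apply: contra wA => h; rewrite inE.
  by rewrite divr_ge0// ltW.
rewrite REZ; last by apply: rintB => //; exact: rint_cst.
rewrite REB//; last exact: rint_cst.
rewrite RE_cst; apply: le_trans.
have := exprn_gt0 2 s0; set p := RE P _ in PA2 *; set q := s ^+ 2.
rewrite exprMn -/q exprVn; nra.
Qed.

(** Symmetry of the density equates the means of the positive and negative parts; splitting [X]
    keeps every integrand nonnegative, as [lawE] requires. *)
Let mean_pos : RE P X = 0.
Proof.
have mp : measurable_fun setT (fun x : R => Num.max x 0).
  by apply: measurable_maxr.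
have pos : RE P (fun w => Num.max (X w) 0) = RE P (fun w => Num.max (- X w) 0).
  rewrite /RE /Rintegral; congr fine.
  rewrite (@lawE (fun x => (Num.max x 0)%:E)); last 2 first.
  - exact/measurable_EFinP.
  - by move=> x; rewrite lee_fin le_max lexx orbT.
  rewrite (@lawE (fun x => (Num.max (- x) 0)%:E)); last 2 first.
  - apply/measurable_EFinP; apply: (measurableT_comp mp); exact: oppr_measurable.
  - by move=> x; rewrite lee_fin le_max lexx orbT.
  rewrite -integral_oppr; last 2 first.
  - apply: emeasurable_funM; apply/measurable_EFinP => //; exact: measurable_normal_pdf.
  - by move=> x; rewrite mule_ge0// lee_fin le_max lexx orbT.
  by apply: eq_integral => x _; rewrite normal_pdfN.
have i1 : rint P X.
  apply: (@rint_le _ _ _ P _ (fun w => 1 + X w ^+ 2)) => //.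
  - move=> w; rewrite -(real_normK (num_real (X w))).
    by have := sqr_ge0 (`|X w| - 1); have := normr_ge0 (X w); set y := `|X w|; nra.
  - by apply: rintD => //; exact: rint_cst.
have ip : rint P (fun w => Num.max (X w) 0).
  apply: (@rint_le _ _ _ P _ (fun w => `|X w|)) => //; last exact: rint_norm.
    by apply: measurable_maxr.
  by move=> w; rewrite ger0_norm ?le_max ?lexx ?orbT// ge_max ler_norm normr_ge0.
have im : rint P (fun w => Num.max (- X w) 0).
  apply: (@rint_le _ _ _ P _ (fun w => `|X w|)) => //; last exact: rint_norm.
    by apply: measurable_maxr => //; exact: measurable_funN.
  by move=> w; rewrite ger0_norm ?le_max ?lexx ?orbT// ge_max -{1}normrN ler_norm normr_ge0.
transitivity (RE P (fun w => Num.max (X w) 0 - Num.max (- X w) 0)).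
  apply: eq_RE => w; have [h|h] := leP 0 (X w).
    by rewrite (max_idPr _) ?oppr_le0// subr0.
  by rewrite (max_idPl _) ?oppr_ge0 1?ltW// sub0r opprK.
by rewrite REB// pos subrr.
Qed.

(** The constant [2 ^ 11] is [32 * 8 ^ 2]: the fourth moment is at most [32 s^4], and [s^2] is at
    most 8 times the second moment. *)
Lemma gaussian_pos : [/\ rint P (fun w => X w ^+ 4), RE P X = 0 &
  RE P (fun w => X w ^+ 4) <= kurtosis_bound R * RE P (fun w => X w ^+ 2) ^+ 2].
Proof.
split => //; apply: (@le_trans _ _ (32 * s ^+ 4)).
  by rewrite -lee_fin -RE_EFin.
have := var_lb; have := sqr_ge0 s.
rewrite (_ : s ^+ 4 = (s ^+ 2) ^+ 2); last by rewrite -exprM.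
set q := s ^+ 2; set v := RE _ _ => q0 hv.
have -> : kurtosis_bound R * v ^+ 2 = 32 * (8 * v) ^+ 2 by rewrite /kurtosis_bound; ring.
rewrite ler_wpM2l// ler_pXn2r ?nnegrE//; lra.
Qed.
End positive_deviation.

Lemma gaussian_moments : [/\ rint P (fun w => X w ^+ 4), RE P X = 0 &
  RE P (fun w => X w ^+ 4) <= kurtosis_bound R * RE P (fun w => X w ^+ 2) ^+ 2].
Proof.
have [_ [s [s0]]] := gX; have [_|sn0] := eqVneq s 0; last first.
  by move=> law; apply: (@gaussian_pos s) => //; rewrite lt_def sn0.
(* Degenerate case: the law is the Dirac mass at 0, so [X] vanishes almost surely. *)
move=> law; have X0 : {ae P, forall w, (cst 0 : T -> R) w = X w}.
  exists (X @^-1` [set~ 0]); split.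
  - by rewrite -[X in measurable X]setTI; apply: mX => //; exact: measurableC.
  - rewrite law; last exact: measurableC.
    by rewrite diracE memNset// => /(_ erefl).
  - by move=> w /= h; apply: contra_not h => ->.
have X4 : {ae P, forall w, (cst 0 : T -> R) w = X w ^+ 4}.
  by apply: filterS X0 => w <-; rewrite /cst expr0n.
have m4 : measurable_fun setT (fun w => X w ^+ 4) by exact: measurable_funX.
split.
- by apply: (rint_ae m4 X4); exact: rint_cst.
- by rewrite -(RE_ae _ mX X0)// RE_cst.
- rewrite -(RE_ae _ m4 X4)//; rewrite RE_cst; apply: mulr_ge0; [exact: kurtosis_bound_ge0|exact: sqr_ge0].
Qed.

End gaussian_moments.

(** * Coordinates of Hermitian matrices and of their increments *)

Section hermitian.
Variables (R : realType) (N : nat).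
Implicit Types (A M : 'M[R[i]]_N).

Lemma hermP M : reflect (forall j k, M j k = (M k j)^*) (M \is hermsymmx).
Proof.
rewrite is_hermitianmxE expr0 scale1r; apply: (iffP eqP) => [h j k|h].
  by rewrite {1}h !mxE.
by apply/matrixP => j k; rewrite !mxE; exact: h.
Qed.

(** The hypotheses on [H] speak only of pairings with Hermitian matrices. Pairing with [re_mx j k]
    and [im_mx j k] reads off the real and imaginary parts of the entry [(j, k)]; the factor
    [(2 N)^-1] undoes the [N] of the pairing and the double occurrence of the entry. *)
Definition re_mx (j k : 'I_N) : 'M[R[i]]_N :=
  \matrix_(l, m) (((2 * N%:R)^-1 * (((l == j) && (m == k))%:R + ((l == k) && (m == j))%:R))%:C).

Definition im_mx (j k : 'I_N) : 'M[R[i]]_N :=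
  \matrix_(l, m) (0 +i* ((2 * N%:R)^-1 * (((l == j) && (m == k))%:R - ((l == k) && (m == j))%:R))).

Lemma re_mx_herm j k : re_mx j k \is hermsymmx.
Proof. 
apply/hermP => l m; rewrite !mxE; apply: ReIm_eq => //=; rewrite ?oppr0//.
by rewrite [X in _ * X]addrC ![(m == _) && _]andbC.
Qed.

Lemma im_mx_herm j k : im_mx j k \is hermsymmx.
Proof.
apply/hermP => l m; rewrite !mxE; apply: ReIm_eq => //=.
by rewrite -mulrN opprB ![(m == _) && _]andbC.
Qed.

Lemma herm_pairingE A M : herm_pairing A M = N%:R * \sum_l \sum_m Re (A l m * M m l).
Proof.
rewrite /herm_pairing /mxtrace cRe_sum; congr (_ * _); apply: eq_bigr => l _.
by rewrite !mxE cRe_sum.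
Qed.

Lemma sum_delta2 (S : pzRingType) (j k : 'I_N) (f : 'I_N -> 'I_N -> S) :
  \sum_l \sum_m (((l == j) && (m == k))%:R * f l m) = f j k.
Proof.
rewrite (bigD1 j)//= [X in _ + X]big1 ?addr0; last first.
  by move=> l /negPf lj; rewrite big1// => m _; rewrite lj mul0r.
rewrite (bigD1 k)//= [X in _ + X]big1 ?addr0 ?eqxx ?mul1r// => m /negPf mk.
by rewrite mk andbF mul0r.
Qed.

Hypothesis N0 : (0 < N)%N.
Let NR : N%:R != 0 :> R. Proof. by rewrite pnatr_eq0 -lt0n. Qed.

Lemma pairing_re j k M : M \is hermsymmx -> herm_pairing (re_mx j k) M = Re (M j k).
Proof.
move=> /hermP hM; rewrite herm_pairingE.
under eq_bigr => l _ do under eq_bigr => m _ do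
  rewrite !mxE cReM /= mul0r subr0 -mulrA.
under eq_bigr => l _ do rewrite -mulr_sumr.
rewrite -mulr_sumr.
under eq_bigr => l _ do under eq_bigr => m _ do rewrite mulrDl.
under eq_bigr => l _ do rewrite big_split/=.
rewrite big_split/= !sum_delta2 (hM k j) cReJ; field.
by rewrite NR.
Qed.

Lemma pairing_im j k M : M \is hermsymmx -> herm_pairing (im_mx j k) M = Im (M j k).
Proof.
move=> /hermP hM; rewrite herm_pairingE.
under eq_bigr => l _ do under eq_bigr => m _ do
  rewrite !mxE cReM /= mul0r sub0r -mulrN -mulrA.
under eq_bigr => l _ do rewrite -mulr_sumr.
rewrite -mulr_sumr.
under eq_bigr => l _ do under eq_bigr => m _ do rewrite mulrBl.
under eq_bigr => l _ do rewrite sumrB/=.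
rewrite sumrB/= !sum_delta2 (hM k j) cImJ; field.
by rewrite NR.
Qed.

Lemma herm_pairingD A M M' : herm_pairing A (M - M') = herm_pairing A M - herm_pairing A M'.
Proof. by rewrite /herm_pairing mulmxBr linearB/= -mulrBr cReD cReN. Qed.

Lemma herm_pairingN A M : herm_pairing (- A) M = - herm_pairing A M.
Proof. by rewrite /herm_pairing mulNmx linearN/= cReN mulrN. Qed.

Lemma hermN M : M \is hermsymmx -> - M \is hermsymmx.
Proof. by move=> /hermP h; apply/hermP => j k; rewrite !mxE h rmorphN. Qed.

Lemma hermB M M' : M \is hermsymmx -> M' \is hermsymmx -> M - M' \is hermsymmx.
Proof. by move=> /hermP h /hermP h'; apply/hermP => j k; rewrite !mxE h h' rmorphB. Qed.

End hermitian.

(** Locked, so that an increment stays a single term for [ring], rewriting and unification. *)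
HB.lock Definition incr (R : realType) (T : Type) (N : nat) (H : R -> T -> 'M[R[i]]_N)
  (s t : R) (j k : 'I_N) (w : T) : R[i] := H t w j k - H s w j k.

Section increment_algebra.
Variables (R : realType) (T : Type) (N : nat) (H : R -> T -> 'M[R[i]]_N).

Lemma incrE s t j k w : incr H s t j k w = H t w j k - H s w j k.
Proof. by rewrite unlock. Qed.

Lemma incr_split a b c j k w : incr H a c j k w = incr H a b j k w + incr H b c j k w.
Proof. by rewrite !incrE; ring. Qed.

End increment_algebra.

Section increments.
Context (R : realType) d (T : measurableType d) (P : probability T R) (N : nat).
Variables (N0 : (0 < N)%N) (H : R -> T -> 'M[R[i]]_N).
Hypothesis hH : hermitian_brownian_motion P H.
Local Notation rint := (rint P).
Local Notation RE := (RE P).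
Local Notation CE := (CE P).
Local Notation incr := (incr H).

Local Opaque herm_pairing re_mx im_mx kurtosis_bound.


Lemma rint_sqr_mul (f g : T -> R) : measurable_fun setT f -> measurable_fun setT g ->
  rint (fun w => f w ^+ 2) -> rint (fun w => g w ^+ 2) -> rint (fun w => f w * g w).
Proof.
move=> mf mg f2 g2; apply: (@rint_le _ _ _ P _ (fun w => f w ^+ 2 + g w ^+ 2)).
- exact: measurable_funM.
- move=> w; rewrite normrM -(real_normK (num_real (f w))) -(real_normK (num_real (g w))).
  have := sqr_ge0 (`|f w| - `|g w|); have := normr_ge0 (f w); have := normr_ge0 (g w).
  set a := `|f w|; set b := `|g w|; nra.
- exact: rintD.
Qed.

Lemma rint4_2 (f : T -> R) : measurable_fun setT f ->
  rint (fun w => f w ^+ 4) -> rint (fun w => f w ^+ 2).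
Proof.
move=> mf f4; apply: (@rint_le _ _ _ P _ (fun w => 1 + f w ^+ 4)).
- exact: measurable_funX.
- move=> w; rewrite ger0_norm ?sqr_ge0//; set y := f w.
  by have := sqr_ge0 (y ^+ 2 - 2^-1); nra.
- by apply: rintD => //; exact: rint_cst.
Qed.

Section increment.
Variables (s t : R).
Hypotheses (s0 : 0 <= s) (st : s <= t).
Let t0 : 0 <= t. Proof. exact: le_trans st. Qed.
Let dH w : 'M[R[i]]_N := H t w - H s w.

Let dH_herm w : dH w \is hermsymmx.
Proof. by apply: hermB; apply: (hbm_herm hH). Qed.

Let gauss1 A r : A \is hermsymmx -> 0 <= r ->
  centered_gaussian P (fun w => herm_pairing A (H r w)).
Proof.
move=> hA r0; have := hbm_gauss hH (fun _ : 'I_1 => hA) (fun _ : 'I_1 => r0).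
by under eq_fun do rewrite big_ord1.
Qed.

Let gauss A : A \is hermsymmx -> centered_gaussian P (fun w => herm_pairing A (dH w)).
Proof.
move=> hA.
(* Joint Gaussianity at two times: the weights are [A] at time [t] and [- A] at time [s]. *)
have := @hbm_gauss _ _ _ _ _ _ hH 2 (fun k => if k == 0 then A else - A)
  (fun k => if k == 0 then t else s).
under [X in _ -> _ -> centered_gaussian _ X]eq_fun do
  rewrite big_ord_recl big_ord1 /= herm_pairingN -herm_pairingD.
apply => k; case: ifP => // _; exact: hermN.
Qed.

Let meas A r : A \is hermsymmx -> 0 <= r -> measurable_fun setT (fun w => herm_pairing A (H r w)).
Proof. by move=> hA r0; case: (gauss1 hA r0). Qed.

Let int2 A r : A \is hermsymmx -> 0 <= r -> rint (fun w => herm_pairing A (H r w) ^+ 2).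
Proof.
by move=> hA r0; apply: rint4_2; [exact: meas|case: (gaussian_moments (gauss1 hA r0))].
Qed.

Let covE A B r r' : A \is hermsymmx -> B \is hermsymmx -> 0 <= r -> 0 <= r' ->
  RE (fun w => herm_pairing A (H r w) * herm_pairing B (H r' w)) =
    Num.min r r' * herm_pairing A B.
Proof.
move=> hA hB r0 r'0; have := hbm_cov hH hA hB r0 r'0.
by rewrite unlock => h; apply: EFin_inj; rewrite -h RE_EFin//; apply: rint_sqr_mul;
  solve [exact: meas|exact: int2].
Qed.

Let intm A B r r' : A \is hermsymmx -> B \is hermsymmx -> 0 <= r -> 0 <= r' ->
  rint (fun w => herm_pairing A (H r w) * herm_pairing B (H r' w)).
Proof. by move=> *; apply: rint_sqr_mul; solve [exact: meas|exact: int2]. Qed.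

Let cov A B : A \is hermsymmx -> B \is hermsymmx ->
  RE (fun w => herm_pairing A (dH w) * herm_pairing B (dH w)) = (t - s) * herm_pairing A B.
Proof.
move=> hA hB; rewrite (@eq_RE _ _ _ P _ (fun w =>
  herm_pairing A (H t w) * herm_pairing B (H t w) - herm_pairing A (H t w) * herm_pairing B (H s w)
  - (herm_pairing A (H s w) * herm_pairing B (H t w) - herm_pairing A (H s w) * herm_pairing B (H s w)))); last first.
  by move=> w; rewrite !herm_pairingD; ring.
rewrite REB ?REB ?covE//; try (by apply: rintB; exact: intm); try exact: intm.
rewrite !minxx (min_idPr st) (min_idPl st); ring.
Qed.

Let ReE j k w : Re (incr s t j k w) = herm_pairing (re_mx R j k) (dH w).
Proof. by rewrite pairing_re// !mxE incrE. Qed.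
Let ImE j k w : Im (incr s t j k w) = herm_pairing (im_mx R j k) (dH w).
Proof. by rewrite pairing_im// !mxE incrE. Qed.

Lemma incr_meas j k : cmeas (incr s t j k).
Proof.
split; [under eq_fun do rewrite ReE; case: (gauss (re_mx_herm R j k))|
  under eq_fun do rewrite ImE; case: (gauss (im_mx_herm R j k))] => //.
Qed.

Let i2 A : A \is hermsymmx -> rint (fun w => herm_pairing A (dH w) ^+ 2).
Proof.
move=> hA; apply: rint4_2; first by case: (gauss hA).
by case: (gaussian_moments (gauss hA)).
Qed.

Let im A B : A \is hermsymmx -> B \is hermsymmx ->
  rint (fun w => herm_pairing A (dH w) * herm_pairing B (dH w)).
Proof.
by move=> hA hB; apply: rint_sqr_mul; [case: (gauss hA)|case: (gauss hB)|exact: i2|exact: i2].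
Qed.

Lemma incr_l2 j k : l2 P (incr s t j k).
Proof.
split; first exact: incr_meas.
rewrite /sqm; apply: rintD.
  by under eq_fun do rewrite ReE; apply: i2; exact: re_mx_herm.
by under eq_fun do rewrite ImE; apply: i2; exact: im_mx_herm.
Qed.

Lemma incr_herm j k w : incr s t j k w = (incr s t k j w)^*.
Proof. by have /hermP := dH_herm w => /(_ j k); rewrite !mxE !incrE. Qed.

Lemma CE_incr j k : CE (incr s t j k) = 0.
Proof.
apply: ReIm_eq; rewrite ?ReCE ?ImCE.
  under eq_RE do rewrite ReE.
  by case: (gaussian_moments (gauss (re_mx_herm R j k))).
under eq_RE do rewrite ImE.
by case: (gaussian_moments (gauss (im_mx_herm R j k))).
Qed.

(** The real part is the covariance of the real parts minus that of the imaginary parts: the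
    contributions of [(j, k) = (l, m)] cancel and those of [(j, k) = (m, l)] add up. *)
Lemma CE_incrM j k l m : CE (fun w => incr s t j k w * incr s t l m w) =
  ((t - s) / N%:R * ((j == m) && (k == l))%:R)%:C.
Proof.
have rh := re_mx_herm R; have ih := im_mx_herm R.
have NR : N%:R != 0 :> R by rewrite pnatr_eq0 -lt0n.
apply: ReIm_eq; rewrite ?ReCE ?ImCE ?cReC ?cImC.
  under eq_RE do rewrite cReM !ReE !ImE.
  rewrite REB ?cov//; try exact: im.
  rewrite pairing_re// pairing_im// !mxE /= -mulrBr -mulrBr.
  rewrite [(j == m) && _]andbC.
  by case: ((j == l) && (k == m)); case: ((k == l) && (j == m)) => /=; field; rewrite NR.
under eq_RE do rewrite cImM !ReE !ImE.
rewrite RED ?cov//; try exact: im.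
by rewrite pairing_re// pairing_im// !mxE/=; ring.
Qed.

(** The real and imaginary parts are Gaussian with variance at most [t - s], since the dual matrices
    pair with themselves to at most 1; then [(x^2 + y^2)^2 <= 2 (x^4 + y^4)]. *)
Lemma incr_pow4 j k : rint (fun w => sqm (incr s t j k w) ^+ 2) /\
  RE (fun w => sqm (incr s t j k w) ^+ 2) <= 4 * kurtosis_bound R * (t - s) ^+ 2.
Proof.
have NR : 1 <= N%:R :> R by rewrite ler1n.
have bnd A : A \is hermsymmx -> `|herm_pairing A A| <= 1 ->
  RE (fun w => herm_pairing A (dH w) ^+ 4) <= kurtosis_bound R * (t - s) ^+ 2.
  move=> hA A1; case: (gaussian_moments (gauss hA)) => _ _ /le_trans; apply.
  rewrite ler_wpM2l ?kurtosis_bound_ge0//.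
  under eq_RE do rewrite expr2.
  rewrite cov// exprMn ler_piMr ?sqr_ge0//.
  by rewrite -(real_normK (num_real _)) exprn_ile1.
have i4 A : A \is hermsymmx -> rint (fun w => herm_pairing A (dH w) ^+ 4).
  by move=> hA; case: (gaussian_moments (gauss hA)).
have rh := re_mx_herm R j k; have ih := im_mx_herm R j k.
have N1 : 0 <= (2 * N%:R : R)^-1 <= 2^-1.
  rewrite invr_ge0 mulr_ge0//= lef_pV2 ?posrE ?mulr_gt0 ?ltr0n//.
  by rewrite ler_peMr.
have b1 : `|herm_pairing (re_mx R j k) (re_mx R j k)| <= 1.
  rewrite pairing_re// !mxE/=; move: N1; set p := _^-1.
  by case: ((j == j) && _); case: ((j == k) && _) => /=; rewrite ler_norml; lra.
have b2 : `|herm_pairing (im_mx R j k) (im_mx R j k)| <= 1.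
  rewrite pairing_im// !mxE/=; move: N1; set p := _^-1.
  by case: ((j == j) && _); case: ((j == k) && _) => /=; rewrite ler_norml; lra.
have dom w : sqm (incr s t j k w) ^+ 2 <=
   2 * (herm_pairing (re_mx R j k) (dH w) ^+ 4 + herm_pairing (im_mx R j k) (dH w) ^+ 4).
  rewrite /sqm ReE ImE; set x := herm_pairing _ _; set y := herm_pairing _ _.
  by have := sqr_ge0 (x ^+ 2 - y ^+ 2); nra.
have id : rint (fun w => 2 * (herm_pairing (re_mx R j k) (dH w) ^+ 4 + herm_pairing (im_mx R j k) (dH w) ^+ 4)).
  by apply: rintZ; apply: rintD; exact: i4.
have i : rint (fun w => sqm (incr s t j k w) ^+ 2).
  apply: rint_le id; last by move=> w; rewrite ger0_norm ?sqr_ge0.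
  by apply: measurable_funX; apply: cmeas_sqm; exact: incr_meas.
split => //; apply: (le_trans (RE_le i id dom)).
rewrite REZ; last by apply: rintD; exact: i4.
rewrite RED; try exact: i4.
have h1 := bnd _ rh b1; have h2 := bnd _ ih b2.
rewrite (_ : 4 * _ * _ = 2 * (kurtosis_bound R * (t - s) ^+ 2 + kurtosis_bound R * (t - s) ^+ 2)); last by ring.
by apply: ler_wpM2l; [exact: ler0n|apply: lerD; [exact: h1|exact: h2]].
Qed.

Lemma incr_gmeas j k : gmeas (coord_events (fun w => H t w - H s w)) (incr s t j k).
Proof.
split => _ B mB; rewrite setTI; apply: sub_sigma_algebra; exists j, k, B; split => //.
- by left; apply/seteqP; split => w /=; rewrite !mxE incrE.
- by right; apply/seteqP; split => w /=; rewrite !mxE incrE.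
Qed.

End increment.

End increments.

Section conjugation.
Variable R : realType.
Implicit Types (x y : R[i]).
Lemma cJM x y : (x * y)^* = x^* * y^*. Proof. exact: rmorphM. Qed.
Lemma cJD x y : (x + y)^* = x^* + y^*. Proof. exact: rmorphD. Qed.
Lemma cJB x y : (x - y)^* = x^* - y^*. Proof. exact: rmorphB. Qed.
Lemma cJC (a : R) : (a%:C : R[i])^* = a%:C. Proof. exact: conjc_real. Qed.
Lemma cJi : ('i : R[i])^* = - 'i. Proof. by apply: ReIm_eq => /=; rewrite ?oppr0. Qed.
Lemma cJ_sum (I : Type) (r : seq I) (f : I -> R[i]) :
  (\sum_(i <- r) f i)^* = \sum_(i <- r) (f i)^*.
Proof. exact: rmorph_sum. Qed.
End conjugation.

(** * Products of increments with adapted variables *)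

Section adapted_products.
Context (R : realType) d (T : measurableType d) (P : probability T R) (N : nat).
Variables (N0 : (0 < N)%N) (F : R -> set (set T)) (H : R -> T -> 'M[R[i]]_N).
Hypotheses (hH : hermitian_brownian_motion P H) (hF : brownian_filtration P F H).
Implicit Types (a b c e s t : R) (f g : T -> R[i]).
Local Notation rint := (rint P).
Local Notation RE := (RE P).
Local Notation CE := (CE P).
Local Notation cint := (cint P).
Local Notation l2 := (l2 P).
Local Notation incr := (incr H).

Lemma F_id s : 0 <= s -> <<s F s >> = F s.
Proof.
by move=> s0; apply: sigma_algebra_id; exact: (filtration_sigma (bf_filtration hF)).
Qed.

Lemma F_sub s : 0 <= s -> F s `<=` measurable.
Proof. exact: (filtration_sub (bf_filtration hF)). Qed.

Lemma F_meas s f : 0 <= s -> gmeas (F s) f -> @cmeas _ T R f.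
Proof. by move=> s0; apply: gmeas_sub; exact: F_sub. Qed.

Lemma F_mono s t f : 0 <= s -> s <= t -> @gmeas _ T R (F s) f -> gmeas (F t) f.
Proof.
move=> s0 st; apply: gmeasS => A FA; rewrite F_id ?(le_trans s0)//.
exact: (filtration_mono (bf_filtration hF) s0 st).
Qed.

Lemma measurable_wrt_gmeas s (X : T -> 'M[R[i]]_N) j k : 0 <= s ->
  measurable_wrt (F s) X -> gmeas (F s) (fun w => X w j k).
Proof.
move=> s0 hX; split => _ B mB; rewrite setTI; apply: sub_sigma_algebra; apply: hX;
  by exists j, k, B; split => //; first [by left|by right].
Qed.

Lemma H_gmeas s j k : 0 <= s -> gmeas (F s) (fun w => H s w j k).
Proof. by move=> s0; apply: measurable_wrt_gmeas => //; exact: (bf_adapted hF). Qed.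

Lemma incr_adapted s t j k : 0 <= s -> s <= t -> gmeas (F t) (incr s t j k).
Proof.
move=> s0 st; have t0 := le_trans s0 st.
rewrite (_ : incr s t j k = fun w => H t w j k - H s w j k); last first.
  by apply/funext => w; rewrite incrE.
apply: cmeasB; first exact: H_gmeas.
by apply: (F_mono s0 st); exact: H_gmeas.
Qed.

Section one_increment.
Variables (s t : R).
Hypotheses (s0 : 0 <= s) (st : s <= t).
Local Notation G := (coord_events (fun w => H t w - H s w)).

Let ind A B : <<s F s >> A -> <<s G >> B -> P (A `&` B) = (P A * P B)%E.
Proof. by rewrite F_id// => FA GB; exact: (bf_indep hF s0 st FA GB). Qed.

Let Gm : G `<=` measurable.
Proof.
move=> A [j [k [B [mB]]]]; have [h1 h2] := incr_meas N0 hH s0 st j k.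
have e1 w : Re ((H t w - H s w) j k) = Re (incr s t j k w) by rewrite !mxE incrE.
have e2 w : Im ((H t w - H s w) j k) = Im (incr s t j k w) by rewrite !mxE incrE.
case=> ->.
  by rewrite (eq_fun e1) -[X in measurable X]setTI; exact: h1.
by rewrite (eq_fun e2) -[X in measurable X]setTI; exact: h2.
Qed.

Let Fm := F_sub s0.

Lemma CE_ind (f g : T -> R[i]) : gmeas (F s) f -> gmeas G g -> cint f -> cint g ->
  CE (fun w => f w * g w) = CE f * CE g.
Proof. exact: (indep_CE Fm Gm ind). Qed.

Lemma cint_ind (f g : T -> R[i]) : gmeas (F s) f -> gmeas G g -> cint f -> cint g ->
  cint (fun w => f w * g w).
Proof. exact: (indep_cint Fm Gm ind). Qed.

Lemma RE_ind_sqm (f g : T -> R[i]) : gmeas (F s) f -> gmeas G g -> l2 f -> l2 g ->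
  RE (fun w => sqm (f w) * sqm (g w)) = RE (fun w => sqm (f w)) * RE (fun w => sqm (g w)).
Proof.
move=> mf mg [_ f2] [_ g2].
by apply: (indep_RE Fm Gm ind) => //; [exact: cmeas_sqm mf|exact: cmeas_sqm mg].
Qed.

Lemma l2_ind (f g : T -> R[i]) : gmeas (F s) f -> gmeas G g -> l2 f -> l2 g ->
  l2 (fun w => f w * g w).
Proof.
move=> mf mg [f1 f2] [g1 g2]; split; first exact: cmeasM.
under eq_fun do rewrite sqmM.
by apply: (indep_rint Fm Gm ind) => //; [exact: cmeas_sqm mf|exact: cmeas_sqm mg].
Qed.

Lemma incr_ind_l2 f j k : gmeas (F s) f -> l2 f -> l2 (fun w => incr s t j k w * f w).
Proof.
move=> mf f2; under eq_fun do rewrite mulrC.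
by apply: l2_ind => //; [exact: incr_gmeas|exact: incr_l2].
Qed.

Lemma CE_incr_ind f j k : gmeas (F s) f -> cint f -> CE (fun w => f w * incr s t j k w) = 0.
Proof.
move=> mf cf; rewrite CE_ind//; first by rewrite CE_incr// mulr0.
- exact: incr_gmeas.
- by apply: l2_cint; exact: incr_l2.
Qed.

Lemma cint_incr_ind f j k : gmeas (F s) f -> cint f -> cint (fun w => f w * incr s t j k w).
Proof.
move=> mf cf; apply: cint_ind => //; first exact: incr_gmeas.
by apply: l2_cint; exact: incr_l2.
Qed.

Lemma CE_incr2_ind f j k l m : gmeas (F s) f -> cint f ->
  CE (fun w => f w * (incr s t j k w * incr s t l m w)) =
  ((t - s) / N%:R * ((j == m) && (k == l))%:R)%:C * CE f.
Proof.
move=> mf cf; rewrite CE_ind//; first by rewrite CE_incrM// mulrC.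
- by apply: cmeasM; exact: incr_gmeas.
- by apply: l2_cintM; exact: incr_l2.
Qed.

Lemma cint_incr2_ind f j k l m : gmeas (F s) f -> cint f ->
  cint (fun w => f w * (incr s t j k w * incr s t l m w)).
Proof.
move=> mf cf; apply: cint_ind => //.
- by apply: cmeasM; exact: incr_gmeas.
- by apply: l2_cintM; exact: incr_l2.
Qed.
End one_increment.

Definition overlap (a b c e : R) : R := Num.max 0 (Num.min b e - Num.max a c).

Section covariance.
Variables (j k l : 'I_N).

Let cv a b (f : T -> R[i]) c e (g : T -> R[i]) :=
  CE (fun w => incr a b j k w * f w * (incr c e j l w * g w)^*).

Let cvint a b f c e g : 0 <= a -> a <= b -> 0 <= c -> c <= e ->
  gmeas (F a) f -> l2 f -> gmeas (F c) g -> l2 g ->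
  cint (fun w => incr a b j k w * f w * (incr c e j l w * g w)^*).
Proof.
move=> a0 ab c0 ce mf lf mg lg; apply: l2_cintM; first exact: incr_ind_l2.
by apply: l2J; exact: incr_ind_l2.
Qed.

(** As [H] is Hermitian, the conjugate of the later increment is again one of its entries. The other
    factors are known at its starting time [c], so it averages to 0. *)
Let disjoint_r a b f c e g : 0 <= a -> a <= b -> b <= c -> c <= e ->
  gmeas (F a) f -> l2 f -> gmeas (F c) g -> l2 g -> cv a b f c e g = 0.
Proof.
move=> a0 ab bc ce mf lf mg lg.
have b0 := le_trans a0 ab; have c0 := le_trans b0 bc; have ac := le_trans ab bc.
transitivity (CE (fun w => (incr a b j k w * f w * (g w)^*) * incr c e l j w)).
  by apply: eq_CE => w; rewrite cJM -(incr_herm hH c0 ce) mulrCA mulrC.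
rewrite CE_incr_ind//.
- apply: cmeasM; last by apply: cmeasJ.
  apply: cmeasM; last exact: F_mono mf.
  by apply: (F_mono b0 bc); exact: incr_adapted.
- apply: l2_cintM; first exact: incr_ind_l2.
  exact: l2J.
Qed.

Let same a b f g : 0 <= a -> a <= b -> gmeas (F a) f -> l2 f -> gmeas (F a) g -> l2 g ->
  cv a b f a b g = ((b - a) / N%:R * (k == l)%:R)%:C * CE (fun w => f w * (g w)^*).
Proof.
move=> a0 ab mf lf mg lg.
transitivity (CE (fun w => (f w * (g w)^*) * (incr a b j k w * incr a b l j w))).
  apply: eq_CE => w; rewrite cJM -(incr_herm hH a0 ab); ring.
rewrite CE_incr2_ind ?eqxx//=.
- by apply: cmeasM => //; exact: cmeasJ.
- by apply: l2_cintM => //; exact: l2J.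
Qed.

Let left_le a b f e g : 0 <= a -> a <= b -> b <= e ->
  gmeas (F a) f -> l2 f -> gmeas (F a) g -> l2 g ->
  cv a b f a e g = ((b - a) / N%:R * (k == l)%:R)%:C * CE (fun w => f w * (g w)^*).
Proof.
move=> a0 ab be mf lf mg lg; have b0 := le_trans a0 ab; have ae := le_trans ab be.
have mg' : gmeas (F b) g by exact: F_mono mg.
rewrite -same//.
transitivity (CE (fun w => incr a b j k w * f w * (incr a b j l w * g w)^* +
  incr a b j k w * f w * (incr b e j l w * g w)^*)).
  by apply: eq_CE => w; rewrite (incr_split _ a b e) mulrDl cJD mulrDr.
rewrite CED; try exact: cvint.
by rewrite [X in _ + X](disjoint_r a0 ab (lexx b))// addr0.
Qed.

Let left_ge a b f e g : 0 <= a -> a <= e -> e <= b ->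
  gmeas (F a) f -> l2 f -> gmeas (F a) g -> l2 g ->
  cv a b f a e g = ((e - a) / N%:R * (k == l)%:R)%:C * CE (fun w => f w * (g w)^*).
Proof.
move=> a0 ae eb mf lf mg lg; have e0 := le_trans a0 ae; have ab := le_trans ae eb.
have mf' : gmeas (F e) f by exact: F_mono mf.
rewrite -same//.
transitivity (CE (fun w => incr a e j k w * f w * (incr a e j l w * g w)^* +
  ((incr a e j l w * g w) * (incr e b j k w * f w)^*)^*)).
  apply: eq_CE => w.
  by rewrite (incr_split _ a e b) mulrDl mulrDl [in X in _ = _ + X]cJM conjcK [X in _ + X]mulrC.
rewrite CED; [|exact: cvint|].
  rewrite CEJ; last by apply: l2_cintM; [exact: incr_ind_l2|apply: l2J; exact: incr_ind_l2].
  rewrite [X in _ + X](_ : _ = 0) ?addr0//.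
  apply/eqP; rewrite conjc_eq0; apply/eqP.
  transitivity (CE (fun w => (incr a e j l w * g w * (f w)^*) * incr e b k j w)).
    by apply: eq_CE => w; rewrite cJM -(incr_herm hH e0 eb) mulrCA mulrC.
  rewrite CE_incr_ind//.
  - apply: cmeasM; last by apply: cmeasJ.
    by apply: cmeasM; [exact: incr_adapted|exact: F_mono mg].
  - by apply: l2_cintM; [exact: incr_ind_l2|exact: l2J].
by apply: cintJ; apply: l2_cintM; [exact: incr_ind_l2|apply: l2J; exact: incr_ind_l2].
Qed.

Let left_eq a b f e g : 0 <= a -> a <= b -> a <= e ->
  gmeas (F a) f -> l2 f -> gmeas (F a) g -> l2 g ->
  cv a b f a e g = ((Num.min b e - a) / N%:R * (k == l)%:R)%:C * CE (fun w => f w * (g w)^*).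
Proof.
move=> a0 ab ae mf lf mg lg; have [be|eb] := leP b e.
  exact: left_le.
by apply: left_ge => //; exact: ltW.
Qed.

(** Cut [[a, b]] at [c]: what precedes [c] is uncorrelated with the second increment, and the rest
    shares its left endpoint with it. *)
Lemma incr_cov_le a b f c e g : 0 <= a -> a <= b -> a <= c -> c <= e ->
  gmeas (F a) f -> l2 f -> gmeas (F c) g -> l2 g ->
  CE (fun w => incr a b j k w * f w * (incr c e j l w * g w)^*) =
  (overlap a b c e / N%:R * (k == l)%:R)%:C * CE (fun w => f w * (g w)^*).
Proof.
move=> a0 ab ac ce mf lf mg lg; have c0 := le_trans a0 ac.
rewrite /overlap (max_idPr ac); have [bc|cb] := leP b c.
  rewrite -/(cv _ _ _ _ _ _) disjoint_r// (max_idPl _); first by rewrite !mul0r.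
  by rewrite subr_le0 ge_min bc.
have mf' : gmeas (F c) f by exact: F_mono mf.
rewrite (max_idPr _); last by rewrite subr_ge0 le_min (ltW cb).
rewrite -left_eq// ?(ltW cb)//.
transitivity (CE (fun w =>
   incr a c j k w * f w * (incr c e j l w * g w)^* +
   incr c b j k w * f w * (incr c e j l w * g w)^*)).
  by apply: eq_CE => w; rewrite (incr_split _ a c b) mulrDl mulrDl.
rewrite CED; [|exact: cvint|by apply: cvint => //; exact: ltW].
by rewrite [X in X + _](disjoint_r a0 ac (lexx c))// add0r.
Qed.

End covariance.

(** The polarised Ito isometry for a row of [H]. When the second interval starts first, conjugation
    exchanges the two factors. *)
Lemma incr_cov j k l a b f c e g : 0 <= a -> a <= b -> 0 <= c -> c <= e ->
  gmeas (F a) f -> l2 f -> gmeas (F c) g -> l2 g ->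
  CE (fun w => incr a b j k w * f w * (incr c e j l w * g w)^*) =
  (overlap a b c e / N%:R * (k == l)%:R)%:C * CE (fun w => f w * (g w)^*).
Proof.
move=> a0 ab c0 ce mf lf mg lg; have [ac|ca] := leP a c.
  exact: incr_cov_le.
have := incr_cov_le j l k c0 ce (ltW ca) ab mg lg mf lf.
move=> /(congr1 (@conjc R)); rewrite -CEJ; last first.
  by apply: l2_cintM; [exact: incr_ind_l2|apply: l2J; exact: incr_ind_l2].
rewrite cJM -CEJ; last by apply: l2_cintM => //; exact: l2J.
rewrite cJC => h.
transitivity (CE (fun w => (incr c e j l w * g w * (incr a b j k w * f w)^*)^*)).
  by apply: eq_CE => w; rewrite [RHS]cJM conjcK mulrC.
rewrite h /overlap [Num.min e b]minC [Num.max c a]maxC [l == k]eq_sym; congr (_ * _).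
by apply: eq_CE => w; rewrite [LHS]cJM conjcK mulrC.
Qed.

End adapted_products.

(** * Elementary integrals *)

(* The process equal to [val] on [[lo, hi[] and to 0 elsewhere. *)
Record elem (R : realType) (T : Type) (N : nat) := Elem {
  lo : R; hi : R; val : 'I_N -> T -> R[i] }.

Section elementary.
Context (R : realType) d (T : measurableType d) (P : probability T R) (N : nat).
Variables (N0 : (0 < N)%N) (F : R -> set (set T)) (H : R -> T -> 'M[R[i]]_N).
Hypotheses (hH : hermitian_brownian_motion P H) (hF : brownian_filtration P F H).
Local Notation rint := (rint P).
Local Notation RE := (RE P).
Local Notation CE := (CE P).
Local Notation cint := (cint P).
Local Notation l2 := (l2 P).
Local Notation incr := (incr H).
Local Notation elem := (elem R T N).
Local Notation mu := (@lebesgue_measure R).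

Definition adapted_elem (x : elem) := [/\ 0 <= lo x, lo x <= hi x &
  forall k, gmeas (F (lo x)) (val x k) /\ l2 (val x k)].

Definition elem_integral (I : finType) (X : I -> elem) (j : 'I_N) (w : T) : R[i] :=
  \sum_i \sum_k incr (lo (X i)) (hi (X i)) j k w * val (X i) k w.

Definition elem_value (I : finType) (X : I -> elem) (k : 'I_N) (r : R) (w : T) : R[i] :=
  \sum_i (if lo (X i) <= r < hi (X i) then val (X i) k w else 0).

Definition elem_overlap (x y : elem) : R := overlap (lo x) (hi x) (lo y) (hi y).

Definition qx (x y : elem) (w : T) : R := \sum_k Re (val x k w * (val y k w)^*).

Section family.
Variables (I : finType) (X : I -> elem).
Hypothesis okX : forall i, adapted_elem (X i).

Lemma EI_l2 j : l2 (elem_integral X j).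
Proof.
apply: l2_sum => i; apply: l2_sum => k; have [h1 h2 h3] := okX i; have [mk lk] := h3 k.
exact: (incr_ind_l2 N0 hH hF).
Qed.

Lemma qx_rint i i' : rint (qx (X i) (X i')).
Proof.
apply: rint_sum => k; have [_ _ h] := okX i; have [_ _ h'] := okX i'.
by have [] := l2_cintM (proj2 (h k)) (l2J (proj2 (h' k))).
Qed.

(** The intervals of the family may overlap, hence the double sum; families built on unrelated
    partitions can thus be superposed without a common refinement. The factor [N] offsets the
    variance of the entries of [H]. *)
Lemma EI_sqm j : N%:R * RE (fun w => sqm (elem_integral X j w)) =
  \sum_i \sum_i' elem_overlap (X i) (X i') * RE (qx (X i) (X i')).
Proof.
have NR : N%:R != 0 :> R by rewrite pnatr_eq0 -lt0n.
pose c i k w := incr (lo (X i)) (hi (X i)) j k w * val (X i) k w.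
have lc i k : l2 (c i k).
  have [h1 h2 h3] := okX i; have [mk lk] := h3 k; exact: (incr_ind_l2 N0 hH hF).
have icc i k i' l : cint (fun w => c i k w * (c i' l w)^*).
  by apply: l2_cintM => //; exact: l2J.
have E : (RE (fun w => sqm (elem_integral X j w)))%:C =
    \sum_i \sum_k \sum_i' \sum_l CE (fun w => c i k w * (c i' l w)^*).
  rewrite -CEC.
  transitivity (CE (fun w => \sum_i \sum_k \sum_i' \sum_l (c i k w * (c i' l w)^*))).
    apply: eq_CE => w; rewrite sqmE {1}/elem_integral mulr_suml; apply: eq_bigr => i _.
    rewrite mulr_suml; apply: eq_bigr => k _.
    rewrite /elem_integral cJ_sum mulr_sumr; apply: eq_bigr => i' _.
    by rewrite cJ_sum mulr_sumr.
  rewrite CE_sum; last by move=> i; do 3 (apply: cint_sum => ?).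
  apply: eq_bigr => i _; rewrite CE_sum; last by move=> k; do 2 (apply: cint_sum => ?).
  apply: eq_bigr => k _; rewrite CE_sum; last by move=> i'; apply: cint_sum => ?.
  by apply: eq_bigr => i' _; rewrite CE_sum.
have E2 : (RE (fun w => sqm (elem_integral X j w)))%:C =
    \sum_i \sum_i' \sum_k ((elem_overlap (X i) (X i') / N%:R)%:C * CE (fun w => val (X i) k w * (val (X i') k w)^*)).
  rewrite E; apply: eq_bigr => i _; rewrite exchange_big; apply: eq_bigr => i' _.
  apply: eq_bigr => k _; rewrite (bigD1 k)//= big1 ?addr0; last first.
    move=> l lk; have [h1 h2 h3] := okX i; have [h1' h2' h3'] := okX i'.
    have [? ?] := h3 k; have [? ?] := h3' l.
    rewrite (incr_cov N0 hH hF)// eq_sym (negPf lk) mulr0 mul0r//.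
  have [h1 h2 h3] := okX i; have [h1' h2' h3'] := okX i'.
  have [? ?] := h3 k; have [? ?] := h3' k.
  by rewrite (incr_cov N0 hH hF)// eqxx mulr1.
have : Re ((RE (fun w => sqm (elem_integral X j w)))%:C) = RE (fun w => sqm (elem_integral X j w)) by [].
rewrite E2 => <-; rewrite cRe_sum mulr_sumr; apply: eq_bigr => i _.
rewrite cRe_sum mulr_sumr; apply: eq_bigr => i' _.
rewrite cRe_sum /qx RE_sum; last first.
  move=> k; have [_ _ h] := okX i; have [_ _ h'] := okX i'.
  by have [] := l2_cintM (proj2 (h k)) (l2J (proj2 (h' k))).
rewrite !mulr_sumr; apply: eq_bigr => k _.
by rewrite cReM cImC mul0r subr0 cReC ReCE; field.
Qed.

Variable t : R.
Hypothesis hit : forall i, hi (X i) <= t.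

Let A i i' : set R := `[Num.max (lo (X i)) (lo (X i')), Num.min (hi (X i)) (hi (X i'))[.

Let muA i i' : mu (A i i' `&` `[0, t]) = (elem_overlap (X i) (X i'))%:E.
Proof.
have [h1 h2 _] := okX i; have [h1' h2' _] := okX i'.
rewrite setIidl; last first.
  move=> r; rewrite /A /= !in_itv/= ge_max lt_min => /andP[/andP[a b] /andP[c e]].
  by rewrite (le_trans h1 a)/= (le_trans (ltW c) (hit i)).
rewrite /A lebesgue_measure_itv/= lte_fin /elem_overlap /overlap.
case: ltP => h; first by rewrite -EFinB; congr EFin; apply/esym/max_idPr; rewrite subr_ge0 ltW.
by congr EFin; apply/esym/max_idPl; rewrite subr_le0.
Qed.

Let int1A i i' : (\int[mu]_(r in `[0%R, t]) (\1_(A i i') r)%:E = (elem_overlap (X i) (X i'))%:E)%E.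
Proof.
rewrite -muA; apply: integral_indic; first exact: measurable_itv.
exact: measurable_itv.
Qed.

Let sqmES r w : \sum_k sqm (elem_value X k r w) = \sum_i \sum_i' qx (X i) (X i') w * \1_(A i i') r.
Proof.
transitivity (\sum_k \sum_i \sum_i' Re (val (X i) k w * (val (X i') k w)^*) * \1_(A i i') r).
  apply: eq_bigr => k _.
  have -> : sqm (elem_value X k r w) = Re (elem_value X k r w * (elem_value X k r w)^*) by rewrite -sqmE.
  rewrite {1}/elem_value mulr_suml cRe_sum; apply: eq_bigr => i _.
  rewrite /elem_value cJ_sum mulr_sumr cRe_sum; apply: eq_bigr => i' _.
  rewrite indicE mem_setE /A in_itv/= ge_max lt_min.
  case: (lo (X i) <= r); case: (r < hi (X i)); case: (lo (X i') <= r); case: (r < hi (X i'));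
    rewrite !cReM /=; ring.
rewrite exchange_big; apply: eq_bigr => i _; rewrite exchange_big; apply: eq_bigr => i' _.
by rewrite mulr_suml.
Qed.

Lemma ES_inner w : (\int[mu]_(r in `[0%R, t]) (\sum_k sqm (elem_value X k r w))%:E =
  (\sum_i \sum_i' elem_overlap (X i) (X i') * qx (X i) (X i') w)%:E)%E.
Proof.
have mA i i' : measurable (A i i') by exact: measurable_itv.
have iA0 i i' : mu.-integrable `[0, t] (EFin \o \1_(A i i')).
  apply/integrableP; split; first by apply/measurable_EFinP/measurable_indic; exact: mA.
  under eq_integral do rewrite /= ger0_norm//.
  by rewrite int1A ltry.
have iA i i' : mu.-integrable `[0, t] (fun r => (qx (X i) (X i') w * \1_(A i i') r)%:E).
  have mD : measurable (`[0, t]%classic : set (measurableTypeR R)) by exact: measurable_itv.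
  by have := integrableZl mD (qx (X i) (X i') w) (iA0 i i'); apply: eq_integrable.
under eq_integral do rewrite sqmES.
under eq_integral do rewrite -sumEFin.
rewrite integral_sum//; last first.
  move=> i; rewrite (_ : (fun r => _) = (fun r =>
    \sum_i' (qx (X i) (X i') w * \1_(A i i') r)%:E)%E); last first.
    by apply/funext => r; rewrite sumEFin.
  by apply: integrable_sum => // i' _; exact: iA.
rewrite -[RHS]sumEFin; apply: eq_bigr => i _.
under eq_integral do rewrite -sumEFin.
rewrite integral_sum//.
rewrite -[RHS]sumEFin; apply: eq_bigr => i' _.
under eq_integral do rewrite EFinM.
rewrite integralZl//; last exact: iA0.
by rewrite int1A -EFinM mulrC.
Qed.

(** Both sides reduce to the same double sum of overlaps, the left one by integrating products of
    indicators over time. The right one is the same for every [j] because all rows of [H] have the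
    same covariance. *)
Lemma ito_isometry j :
  (\int[P]_w \int[mu]_(r in `[0%R, t]) (\sum_k sqm (elem_value X k r w))%:E =
  (N%:R * RE (fun w => sqm (elem_integral X j w)))%:E)%E.
Proof.
under eq_integral do rewrite ES_inner.
have iq i : rint (fun w => \sum_i' elem_overlap (X i) (X i') * qx (X i) (X i') w).
  by apply: rint_sum => i'; apply: rintZ; exact: qx_rint.
rewrite RE_EFin; last by apply: rint_sum => i; exact: iq.
congr EFin; rewrite EI_sqm RE_sum//; apply: eq_bigr => i _.
rewrite RE_sum; last by move=> i'; apply: rintZ; exact: qx_rint.
by apply: eq_bigr => i' _; rewrite REZ//; exact: qx_rint.
Qed.

End family.
End elementary.

(** * Joint measurability and integrals over time and sample space *)

Section joint_measurability.
Context (R : realType) d (T : measurableType d).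

(** A continuous path is the limit of its samples at the grid points [truncn ((n + 1) r) / (n + 1)],
    and each sampled process is measurable on the countably many slabs where the grid point is
    constant. The grid points stay in the half-line, where continuity is known. *)
Lemma joint_measurable (f : R -> T -> R) :
  (forall r, 0 <= r -> measurable_fun setT (f r)) ->
  (forall w, {within `[0, +oo[, continuous (f ^~ w)}) ->
  measurable_fun (setT `*` `[0%R, +oo[ : set (T * measurableTypeR R)) (fun z => f z.2 z.1).
Proof.
move=> mf cf.
pose D : set (T * measurableTypeR R) := setT `*` `[0%R, +oo[.
have mD : measurable D by apply: measurableX.
pose k n (r : R) := Num.truncn (n.+1%:R * r).
pose g n (z : T * measurableTypeR R) := f ((k n z.2)%:R / n.+1%:R) z.1.
apply: (@measurable_fun_cvg _ _ _ D g (fun z => f z.2 z.1)).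
- move=> n; pose A i : set (T * measurableTypeR R) := setT `*` `[i%:R / n.+1%:R, i.+1%:R / n.+1%:R[.
  have n0 : 0 < n.+1%:R :> R by rewrite ltr0n.
  have kE i r : i%:R / n.+1%:R <= r < i.+1%:R / n.+1%:R -> k n r = i.
    rewrite ler_pdivrMr// ltr_pdivlMr// mulrC => h.
    by apply/truncn_def.
  have DA : D = \bigcup_i A i.
    apply/seteqP; split => [[w r] [_ /=]|[w r] [i _ [_ /=]]].
      rewrite in_itv/= andbT => r0; exists (k n r) => //; split => //=.
      have /truncn_itv h : 0 <= n.+1%:R * r by rewrite mulr_ge0.
      by rewrite in_itv/= ler_pdivrMr// ltr_pdivlMr// mulrC.
    rewrite in_itv/= => /andP[h _]; split => //=; rewrite in_itv/= andbT.
    by apply: le_trans h; rewrite divr_ge0.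
  have mA i : measurable (A i) by apply: measurableX.
  rewrite DA; apply/measurable_fun_bigcup => // i.
  apply: (@eq_measurable_fun _ _ _ _ _ (fun z => f (i%:R / n.+1%:R) z.1)).
    move=> [w r]; rewrite inE => -[_ /=]; rewrite in_itv/= => h.
    by rewrite /g /= (kE i r h).
  apply: measurable_funTS; apply: (measurableT_comp _ measurable_fst).
  by apply: mf; rewrite divr_ge0.
- move=> [w r] [_ /=]; rewrite in_itv/= andbT => r0.
  have cw := cf w.
  have q0 n : 0 <= (k n r)%:R / n.+1%:R :> R by rewrite divr_ge0.
  have qr : (fun n => (k n r)%:R / n.+1%:R : R) @ \oo --> r.
    apply: (@squeeze_cvgr _ _ _ _ (fun n => r - n.+1%:R^-1) (fun=> r)).
    - near=> n; have n0 : 0 < n.+1%:R :> R by rewrite ltr0n.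
      have /truncn_itv/andP[h1 h2] : 0 <= n.+1%:R * r by rewrite mulr_ge0.
      rewrite /k ler_pdivrMr// [r * _]mulrC h1 andbT.
      rewrite ler_pdivlMr// mulrBl mulVf ?gt_eqF// lerBlDr natr1 mulrC.
      exact: ltW.
    - rewrite -[X in _ --> X]subr0; apply: cvgB; first exact: cvg_cst.
      exact: cvg_harmonic.
    - exact: cvg_cst.
  have rA : `[0, +oo[%classic r by rewrite /= in_itv/= andbT.
  have /subspace_continuousP/(_ r rA) cr := cw.
  apply: (cvg_comp _ _ _ cr) => B /= hB.
  have := qr _ hB; rewrite /nbhs /=; apply: filterS => n; apply.
  by rewrite in_itv/= andbT q0.
Unshelve. all: by end_near.
Qed.

End joint_measurability.

Section time_average.
Context (R : realType) d (T : measurableType d) (P : probability T R).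
Local Notation mu := (@lebesgue_measure R).
Local Notation TR := (T * measurableTypeR R)%type.
Implicit Types (a b c : R) (G : TR -> R).

Definition slab a b : set TR := setT `*` `[a, b].
Definition jmeas a b G := measurable_fun (slab a b) G.
(** Extended-real valued, so that energy bounds can be stated and compared before any integrability
    is known. *)
Definition dint a b G : \bar R := (\int[P]_w \int[mu]_(r in `[a, b]) (G (w, r))%:E)%E.

Lemma measurable_slab a b : measurable (slab a b).
Proof. by apply: measurableX => //; exact: measurable_itv. Qed.

Lemma jmS a b a' b' G : a <= a' -> b' <= b -> jmeas a b G -> jmeas a' b' G.
Proof.
move=> aa bb; apply: measurable_funS; first exact: measurable_slab.
move=> [w r] [_ /=]; rewrite !in_itv/= => /andP[h1 h2]; split => //=.
by rewrite in_itv/= (le_trans aa)//= (le_trans h2).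
Qed.

(** Extension by 0 outside the slab, so that Tonelli is applied on the full product space. *)
Let GP a b G : TR -> \bar R := (EFin \o G) \_ (slab a b).

Let GP_meas a b G : jmeas a b G -> measurable_fun setT (GP a b G).
Proof.
move=> h; apply/(measurable_restrictT _ (measurable_slab a b)).
exact/measurable_EFinP.
Qed.

Let GP_ge0 a b G : (forall z, 0 <= G z) -> forall z, (0 <= GP a b G z)%E.
Proof. by move=> G0 z; rewrite /GP patchE; case: ifP => // _; rewrite lee_fin. Qed.

Let GPE a b G w : (\int[mu]_(r in `[a, b]) (G (w, r))%:E = \int[mu]_r GP a b G (w, r))%E.
Proof.
rewrite integral_mkcond; apply: eq_integral => r _; rewrite /GP !patchE.
have -> : ((w, r) \in slab a b) = (r \in `[a, b]%classic) by apply/idP/idP; rewrite !inE; [case|split].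
by [].
Qed.

Let QE a b G : jmeas a b G -> (forall z, 0 <= G z) ->
  dint a b G = (\int[P \x mu]_z GP a b G z)%E.
Proof.
move=> jG G0; rewrite (fubini_tonelli1 _ (GP_meas jG) (@GP_ge0 a b G G0)).
by apply: eq_integral => w _; rewrite GPE.
Qed.

Lemma dint_swap a b G : jmeas a b G -> (forall z, 0 <= G z) ->
  dint a b G = (\int[mu]_(r in `[a, b]) \int[P]_w (G (w, r))%:E)%E.
Proof.
move=> jG G0; rewrite QE// (fubini_tonelli2 _ (GP_meas jG) (@GP_ge0 a b G G0)) [RHS]integral_mkcond.
apply: eq_integral => r _; rewrite /fubini_G /GP patchE.
case: ifPn => rI; last first.
  rewrite integral0_eq// => w _; rewrite patchE ifF//.
  by apply/negbTE; apply: contra rI; rewrite !inE => -[].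
apply: eq_integral => w _; rewrite patchE ifT// inE; split => //=.
by move: rI; rewrite inE.
Qed.

Lemma dint_inner_meas a b G : jmeas a b G -> (forall z, 0 <= G z) ->
  measurable_fun setT (fun w => \int[mu]_(r in `[a, b]) (G (w, r))%:E)%E.
Proof.
move=> jG G0; rewrite (_ : (fun w => _) = fubini_F mu (GP a b G)); last first.
  by apply/funext => w; rewrite GPE.
exact: (measurable_fun_fubini_tonelli_F _ (GP_meas jG) (@GP_ge0 a b G G0)).
Qed.

Lemma dint_outer_meas a b G : jmeas a b G -> (forall z, 0 <= G z) ->
  measurable_fun `[a, b] (fun r => \int[P]_w (G (w, r))%:E)%E.
Proof.
move=> jG G0.
apply: (@eq_measurable_fun _ _ _ _ _ (fubini_G P (GP a b G))).
  move=> r rI; rewrite /fubini_G; apply: eq_integral => w _; rewrite /GP patchE ifT// inE.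
  by split => //=; move: rI; rewrite inE.
apply: measurable_funTS.
exact: (measurable_fun_fubini_tonelli_G _ (GP_meas jG) (@GP_ge0 a b G G0)).
Qed.

Lemma dint_ge0 a b G : (forall z, 0 <= G z) -> (0 <= dint a b G)%E.
Proof. by move=> G0; apply: integral_ge0 => w _; apply: integral_ge0 => r _; rewrite lee_fin. Qed.

Lemma dint_le a b G G' : jmeas a b G -> jmeas a b G' -> (forall z, 0 <= G z) -> (forall z, 0 <= G' z) ->
  (forall z, slab a b z -> G z <= G' z) -> (dint a b G <= dint a b G')%E.
Proof.
move=> jG jG' G0 G'0 GG'; rewrite !QE//; apply: ge0_le_integral => //.
- by move=> z _; exact: GP_ge0.
- exact: GP_meas.
- exact: GP_meas.
- by move=> z _; rewrite /GP !patchE; case: ifP => //; rewrite inE => hz; rewrite lee_fin GG'.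
Qed.

Lemma dintD a b G G' : jmeas a b G -> jmeas a b G' -> (forall z, 0 <= G z) -> (forall z, 0 <= G' z) ->
  dint a b (fun z => G z + G' z) = (dint a b G + dint a b G')%E.
Proof.
move=> jG jG' G0 G'0.
rewrite !QE//; last 2 first.
- exact: measurable_funD.
- by move=> z; rewrite addr_ge0.
rewrite -ge0_integralD//.
- by apply: eq_integral => z _; rewrite /GP !patchE; case: ifP => // _; rewrite adde0.
- by move=> z _; exact: GP_ge0.
- exact: GP_meas.
- by move=> z _; exact: GP_ge0.
- exact: GP_meas.
Qed.

Lemma dintZ a b c G : 0 <= c -> jmeas a b G -> (forall z, 0 <= G z) ->
  dint a b (fun z => c * G z) = (c%:E * dint a b G)%E.
Proof.
move=> c0 jG G0.
rewrite !QE//; last 2 first.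
- by apply: measurable_funM => //; exact: measurable_cst.
- by move=> z; rewrite mulr_ge0.
rewrite -ge0_integralZl//.
- by apply: eq_integral => z _; rewrite /GP !patchE; case: ifP => // _; rewrite mule0.
- exact: GP_meas.
- by move=> z _; exact: GP_ge0.
Qed.

Lemma dint_sub a b a' b' G : a <= a' -> b' <= b -> jmeas a b G -> (forall z, 0 <= G z) ->
  (dint a' b' G <= dint a b G)%E.
Proof.
move=> aa bb jG G0; rewrite !QE//; last exact: jmS jG.
apply: ge0_le_integral => //.
- by move=> z _; exact: GP_ge0.
- by apply: GP_meas; exact: jmS jG.
- exact: GP_meas.
- move=> [w r] _; rewrite /GP !patchE; case: ifP; last first.
    by move=> _; case: ifP => // _; rewrite lee_fin.
  rewrite inE => -[_ /=]; rewrite in_itv/= => /andP[h1 h2].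
  rewrite ifT// inE; split => //=; rewrite in_itv/= (le_trans aa)//=.
  exact: le_trans bb.
Qed.

(** For integrands cut at a given time: [G] is integrated over the larger slab but vanishes off the
    smaller one. *)
Lemma dint_le_sub a b a' b' G G' : a <= a' -> b' <= b -> jmeas a b G -> jmeas a' b' G' ->
  (forall z, 0 <= G z) -> (forall z, 0 <= G' z) ->
  (forall z, slab a b z -> ~ slab a' b' z -> G z = 0) ->
  (forall z, slab a' b' z -> G z <= G' z) -> (dint a b G <= dint a' b' G')%E.
Proof.
move=> aa bb jG jG' G0 G'0 Gz GG'; rewrite !QE//; apply: ge0_le_integral => //.
- by move=> z _; exact: GP_ge0.
- exact: GP_meas.
- exact: GP_meas.
- move=> z _; rewrite /GP !patchE; case: ifP; rewrite ?inE => hz.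
    case: ifP => hz'; first by rewrite lee_fin GG'//; rewrite inE in hz'.
    by rewrite /= Gz// => h; move: hz'; rewrite (mem_set h).
  by case: ifP => // _; rewrite lee_fin.
Qed.

End time_average.

(** * Operations on families of elementary integrands *)

Section families.
Context (R : realType) d (T : measurableType d) (P : probability T R) (N : nat).
Variables (N0 : (0 < N)%N) (F : R -> set (set T)) (H : R -> T -> 'M[R[i]]_N).
Hypotheses (hH : hermitian_brownian_motion P H) (hF : brownian_filtration P F H).
Local Notation rint := (rint P).
Local Notation RE := (RE P).
Local Notation CE := (CE P).
Local Notation cint := (cint P).
Local Notation l2 := (l2 P).
Local Notation elem := (elem R T N).
Local Notation adapted_elem := (adapted_elem P F).
Implicit Types (s t : R) (x : elem).

Definition elem_opp x : elem := Elem (lo x) (hi x) (fun k w => - val x k w).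
(** [elem_before s] and [elem_after s] cut an element at time [s]. The outer maxima keep [lo <= hi]
    when the element lies on one side of [s]: the other piece is then empty. *)
Definition elem_before s x : elem := Elem (lo x) (Num.max (lo x) (Num.min s (hi x))) (val x).
Definition elem_after s x : elem :=
  Elem (Num.max (lo x) s) (Num.max (Num.max (lo x) s) (hi x)) (val x).
Definition cat3 (I J K : finType) (X : I -> elem) (Y : J -> elem) (Z : K -> elem)
  (i : I + (J + K)) : elem :=
  match i with inl i => X i | inr (inl j) => Y j | inr (inr k) => Z k end.

Lemma EI_cat3 (I J K : finType) (X : I -> elem) (Y : J -> elem) (Z : K -> elem) j w :
  elem_integral H (cat3 X Y Z) j w = elem_integral H X j w + (elem_integral H Y j w + elem_integral H Z j w).
Proof. by rewrite /elem_integral !big_sumType. Qed.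

Lemma ES_cat3 (I J K : finType) (X : I -> elem) (Y : J -> elem) (Z : K -> elem) k r w :
  elem_value (cat3 X Y Z) k r w = elem_value X k r w + (elem_value Y k r w + elem_value Z k r w).
Proof. by rewrite /elem_value !big_sumType. Qed.

Lemma EI_neg (I : finType) (X : I -> elem) j w :
  elem_integral H (elem_opp \o X) j w = - elem_integral H X j w.
Proof.
rewrite /elem_integral -sumrN; apply: eq_bigr => i _; rewrite -sumrN; apply: eq_bigr => k _ /=.
by rewrite mulrN.
Qed.

Lemma ES_neg (I : finType) (X : I -> elem) k r w :
  elem_value (elem_opp \o X) k r w = - elem_value X k r w.
Proof. by rewrite /elem_value -sumrN; apply: eq_bigr => i _ /=; case: ifP; rewrite ?oppr0. Qed.

Lemma okel_neg x : adapted_elem x -> adapted_elem (elem_opp x).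
Proof.
by move=> [h1 h2 h3]; split => // k; have [m l] := h3 k; split; [exact: cmeasN|exact: l2N].
Qed.

Lemma okel_low s x : adapted_elem x -> adapted_elem (elem_before s x).
Proof. by move=> [h1 h2 h3]; split => //=; rewrite le_max lexx. Qed.

Lemma okel_up s x : adapted_elem x -> adapted_elem (elem_after s x).
Proof.
move=> [h1 h2 h3]; split => /=.
- by rewrite le_max h1.
- by rewrite le_max lexx.
- move=> k; have [m l] := h3 k; split => //; apply: (F_mono hF h1 _ m).
  by rewrite le_max lexx.
Qed.

Lemma EI_split s (I : finType) (X : I -> elem) j w : (forall i, adapted_elem (X i)) ->
  elem_integral H X j w = elem_integral H (elem_before s \o X) j w + elem_integral H (elem_after s \o X) j w.
Proof.
move=> ok; rewrite /elem_integral -big_split; apply: eq_bigr => i _; rewrite -big_split.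
apply: eq_bigr => k _ /=; rewrite -mulrDl; congr (_ * _).
have [_ h _] := ok i; rewrite !incrE.
case: (boolP (lo (X i) <= s)) => h1; case: (boolP (s <= hi (X i))) => h2.
- by rewrite (min_idPl h2) (max_idPr h1) (max_idPr h2); ring.
- have h2' : hi (X i) <= s by apply: ltW; rewrite ltNge.
  by rewrite (min_idPr h2') (max_idPr h) (max_idPr h1) (max_idPl h2'); ring.
- have h1' : s <= lo (X i) by apply: ltW; rewrite ltNge.
  by rewrite (min_idPl h2) (max_idPl h1') (max_idPr h); ring.
- move: h1; rewrite -ltNge => h1; move: h2; rewrite -ltNge => h2.
  by have := lt_trans (le_lt_trans h h2) h1; rewrite ltxx.
Qed.

Lemma ES_low s (I : finType) (X : I -> elem) k r w : (forall i, adapted_elem (X i)) ->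
  elem_value (elem_before s \o X) k r w = if r < s then elem_value X k r w else 0.
Proof.
move=> ok; rewrite /elem_value; case: ifP => rs.
  apply: eq_bigr => i _ /=; rewrite lt_max lt_min rs/=.
  by case: (leP (lo (X i)) r) => h; rewrite ?ltNge ?h//= ltNge h.
rewrite big1// => i _ /=; case: ifP => //; rewrite lt_max lt_min rs/= orbF.
by case/andP => h; rewrite ltNge h.
Qed.

Lemma ES_up s (I : finType) (X : I -> elem) k r w : (forall i, adapted_elem (X i)) ->
  elem_value (elem_after s \o X) k r w = if s <= r then elem_value X k r w else 0.
Proof.
move=> ok; rewrite /elem_value; case: ifP => rs.
  apply: eq_bigr => i _ /=; rewrite ge_max rs andbT !lt_max [r < s]ltNge rs /= orbF.
  by case: (leP (lo (X i)) r) => h; rewrite ?ltNge ?h//= ltNge h.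
by rewrite big1// => i _ /=; rewrite ge_max rs andbF.
Qed.

(** Martingale property: each increment starts at a time when [Z] and the value that it multiplies
    are both known. *)
Lemma CE_EI_up s (I : finType) (X : I -> elem) j (Z : T -> R[i]) (K : R) : 0 <= s ->
  (forall i, adapted_elem (X i)) -> gmeas (F s) Z -> (forall w, nm (Z w) <= K) ->
  CE (fun w => Z w * elem_integral H (elem_after s \o X) j w) = 0.
Proof.
move=> s0 ok mZ ZK.
have bnd i k : l2 (fun w => Z w * val (X i) k w).
  by have [_ _ h] := ok i; apply: l2_bndM ZK _; [exact: (F_meas hF s0)|case: (h k)].
have lo0 i : 0 <= Num.max (lo (X i)) s by rewrite le_max s0 orbT.
have mZ' i k : gmeas (F (Num.max (lo (X i)) s)) (fun w => Z w * val (X i) k w).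
  have [h1 h2 h3] := ok i; apply: cmeasM.
    by apply: (F_mono hF s0 _ mZ); rewrite le_max lexx orbT.
  by apply: (F_mono hF h1 _ (h3 k).1); rewrite le_max lexx.
have le i : Num.max (lo (X i)) s <= Num.max (Num.max (lo (X i)) s) (hi (X i)).
  by rewrite le_max lexx.
transitivity (CE (fun w => \sum_i \sum_k (Z w * val (X i) k w) *
    incr H (Num.max (lo (X i)) s) (Num.max (Num.max (lo (X i)) s) (hi (X i))) j k w)).
  apply: eq_CE => w; rewrite /elem_integral mulr_sumr; apply: eq_bigr => i _.
  by rewrite mulr_sumr; apply: eq_bigr => k _ /=; ring.
have ci i k : cint (fun w => (Z w * val (X i) k w) *
    incr H (Num.max (lo (X i)) s) (Num.max (Num.max (lo (X i)) s) (hi (X i))) j k w).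
  by apply: (cint_incr_ind N0 hH hF) => //; exact: l2_cint.
rewrite CE_sum; last by move=> i; apply: cint_sum.
rewrite big1// => i _; rewrite CE_sum// big1// => k _.
by apply: (CE_incr_ind N0 hH hF) => //; exact: l2_cint.
Qed.

Lemma l2_of_le f (x : R) : cmeas f -> (\int[P]_w (sqm (f w))%:E <= x%:E)%E ->
  l2 f /\ RE (fun w => sqm (f w)) <= x.
Proof.
move=> mf fx; have l2f : l2 f.
  split => //; apply/integrableP; split; first by apply/measurable_EFinP; exact: cmeas_sqm.
  under eq_integral do rewrite /= ger0_norm ?sqm_ge0//.
  by rewrite (le_lt_trans fx)// ltry.
by split => //; rewrite -lee_fin -RE_EFin//; exact: l2_int.
Qed.

Lemma ereal_cvg0_near (f : nat -> \bar R) (e : R) : 0 < e -> f @ \oo --> 0%E ->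
  \forall n \near \oo, (f n <= e%:E)%E.
Proof.
move=> e0 /(_ [set x | (x < e%:E)%E]) h.
have /h : nbhs (0%E : \bar R) [set x | (x < e%:E)%E].
  exists e => //= r /=; rewrite sub0r normrN => re.
  by rewrite lte_fin (le_lt_trans (ler_norm _)).
by rewrite /nbhs /=; apply: filterS => n /ltW.
Qed.

Section simple.
Variable c : 'I_N.

(** Since [H] multiplies on the left, a column of the integral involves only the same column of the
    integrand. *)
Definition step_elems (m : nat) (tau : nat -> R) (xi : nat -> T -> 'M[R[i]]_N) (i : 'I_m) : elem :=
  Elem (tau i) (tau i.+1) (fun k w => xi i w k c).

Lemma famx_ES m tau xi k r w : elem_value (@step_elems m tau xi) k r w = step m tau xi r w k c.
Proof.
rewrite /elem_value /step summxE; apply: eq_bigr => i _ /=.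
by case: ifP => //; rewrite mxE.
Qed.

Lemma famx_EI m tau xi j w : elem_integral H (@step_elems m tau xi) j w = step_integral H m tau xi w j c.
Proof.
rewrite /elem_integral /step_integral summxE; apply: eq_bigr => i _; rewrite mxE.
by apply: eq_bigr => k _ /=; rewrite incrE !mxE.
Qed.

Lemma sqnorm_entry (A : 'M[R[i]]_N) k l : sqm (A k l) <= sqnorm A.
Proof.
rewrite /sqnorm (bigD1 k)//= (bigD1 l)//= -addrA lerDl addr_ge0//.
  by apply: sumr_ge0 => ? _; exact: sqm_ge0.
by apply: sumr_ge0 => ? _; apply: sumr_ge0 => ? _; exact: sqm_ge0.
Qed.

Lemma sqnorm_col (A : 'M[R[i]]_N) l : \sum_k sqm (A k l) <= sqnorm A.
Proof.
apply: ler_sum => k _; rewrite (bigD1 l)//= lerDl.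
by apply: sumr_ge0 => ? _; exact: sqm_ge0.
Qed.

Lemma simple_okel t m tau xi : 0 <= t -> simple_on F t m tau xi ->
  forall i : 'I_m, adapted_elem (@step_elems m tau xi i) /\ hi (@step_elems m tau xi i) <= t.
Proof.
move=> t0 S.
have tau0 n : (n <= m)%N -> 0 <= tau n.
  elim: n => [_|n IH nm]; first by rewrite (simple_start S).
  by rewrite (le_trans (IH (ltnW nm)))// (simple_mono S).
(* Downward induction from [tau m = t]. *)
have taut n : (n <= m)%N -> tau (m - n)%N <= t.
  elim: n => [_|n IH nm]; first by rewrite subn0 (simple_end S).
  apply: le_trans (IH (ltnW nm)); rewrite -(subSS n m) subSn//.
  by apply: (simple_mono S); rewrite ltn_subrL/= (leq_trans _ nm).
move=> i; have im := ltn_ord i; split; last first.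
  by rewrite /= -[i.+1](subKn im); apply: taut; rewrite leq_subr.
split => /=; [exact: tau0 (ltnW im)|exact: (simple_mono S)|move=> k].
have g := measurable_wrt_gmeas k c (tau0 _ (ltnW im)) (simple_meas S im).
split => //; have [K hK] := Defs.simple_bounded S.
apply: (@l2_le _ _ _ _ _ (fun=> K)); last exact: rint_cst.
  exact: (F_meas hF (tau0 _ (ltnW im)) g).
by move=> w; apply: le_trans (sqnorm_entry _ k c) (hK _ _ im).
Qed.

End simple.
End families.

(** * From the stochastic equation to elementary families *)

Section sde.
Context (R : realType) d (T : measurableType d) (P : probability T R) (N : nat).
Variables (N0 : (0 < N)%N) (F : R -> set (set T)) (H U : R -> T -> 'M[R[i]]_N) (V : 'M[R[i]]_N).
Hypotheses (hH : hermitian_brownian_motion P H) (hF : brownian_filtration P F H).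
Hypothesis hU : unitary_brownian_motion P F H V U.
Variable c : 'I_N.
Local Notation rint := (rint P).
Local Notation RE := (RE P).
Local Notation CE := (CE P).
Local Notation cint := (cint P).
Local Notation l2 := (l2 P).
Local Notation elem := (elem R T N).
Local Notation adapted_elem := (adapted_elem P F).
Local Notation mu := (@lebesgue_measure R).
Local Notation TR := (T * measurableTypeR R)%type.
Local Notation dint := (dint P).
Implicit Types (s t r : R) (j k : 'I_N).

Let u r k w := U r w k c.

Lemma u_gmeas r k l : 0 <= r -> gmeas (F r) (fun w => U r w k l).
Proof. by move=> r0; apply: measurable_wrt_gmeas => //; exact: (ubm_adapted hU). Qed.

Definition jcmeas (a b : R) (f : TR -> R[i]) :=
  jmeas a b (fun z => Re (f z)) /\ jmeas a b (fun z => Im (f z)).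

Lemma cjmD a b f g : jcmeas a b f -> jcmeas a b g -> jcmeas a b (fun z => f z + g z).
Proof.
move=> [f1 f2] [g1 g2]; split; rewrite /jmeas.
  by under eq_fun do rewrite cReD; exact: measurable_funD.
by under eq_fun do rewrite cImD; exact: measurable_funD.
Qed.

Lemma cjmN a b f : jcmeas a b f -> jcmeas a b (fun z => - f z).
Proof.
move=> [f1 f2]; split; rewrite /jmeas.
  by under eq_fun do rewrite cReN; exact: measurable_funN.
by under eq_fun do rewrite cImN; exact: measurable_funN.
Qed.

Lemma cjmB a b f g : jcmeas a b f -> jcmeas a b g -> jcmeas a b (fun z => f z - g z).
Proof. by move=> ? ?; apply: cjmD => //; exact: cjmN. Qed.

Lemma cjm_sqm a b f : jcmeas a b f -> jmeas a b (fun z => sqm (f z)).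
Proof. by move=> [f1 f2]; apply: measurable_funD; exact: measurable_funX. Qed.

Lemma jm_sum (I : Type) (r : seq I) a b (f : I -> TR -> R) : (forall i, jmeas a b (f i)) ->
  jmeas a b (fun z => \sum_(i <- r) f i z).
Proof. move=> h; exact (measurable_sum r h). Qed.

Lemma meas_sum (I : Type) (r : seq I) (f : I -> T -> R) : (forall i, measurable_fun setT (f i)) ->
  measurable_fun setT (fun w => \sum_(i <- r) f i w).
Proof. move=> h; exact (measurable_sum r h). Qed.

Lemma cjmT a b f : cmeas f -> jcmeas a b (fun z => f z.1).
Proof.
move=> [f1 f2]; split; apply: measurable_funTS.
  exact: (measurableT_comp f1 measurable_fst).
exact: (measurableT_comp f2 measurable_fst).
Qed.

Lemma u_cjm a b k l : 0 <= a -> jcmeas a b (fun z => U z.2 z.1 k l).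
Proof.
move=> a0; have sub : slab a b `<=` (setT `*` `[0%R, +oo[ : set TR).
  move=> [w r] [_ /=]; rewrite in_itv/= => /andP[ar _]; split => //=.
  by rewrite in_itv/= andbT (le_trans a0).
have mD : measurable (setT `*` `[0%R, +oo[ : set TR) by apply: measurableX.
have mU r : 0 <= r -> cmeas (fun w => U r w k l).
  by move=> r0; apply: (F_meas hF r0); exact: u_gmeas.
split; apply: (measurable_funS mD sub).
  apply: (@joint_measurable _ _ _ (fun r w => Re (U r w k l))).
    by move=> r /mU[].
  by move=> w; have [] := ubm_cont hU w k l.
apply: (@joint_measurable _ _ _ (fun r w => Im (U r w k l))).
  by move=> r /mU[].
by move=> w; have [] := ubm_cont hU w k l.
Qed.

Lemma ES_cjm a b (I : finType) (X : I -> elem) k : (forall i, cmeas (val (X i) k)) ->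
  jcmeas a b (fun z => elem_value X k z.2 z.1).
Proof.
move=> mX; suff [h1 h2] : @cmeas _ TR R (fun z => elem_value X k z.2 z.1).
  by split; exact: measurable_funTS.
apply: cmeas_sum => i; have [m1 m2] := mX i.
have mb : measurable_fun setT (fun z : TR => lo (X i) <= z.2 < hi (X i)).
  apply: measurable_and.
    by apply: measurable_fun_ler; [exact: measurable_cst|exact: measurable_snd].
  by apply: measurable_fun_ltr; [exact: measurable_snd|exact: measurable_cst].
split.
  rewrite (_ : (fun z => _) = (fun z : TR => if lo (X i) <= z.2 < hi (X i) then Re (val (X i) k z.1) else 0)); last first.
    by apply/funext => z; case: ifP.
  by apply: measurable_fun_ifT => //; exact: (measurableT_comp m1 measurable_fst).
rewrite (_ : (fun z => _) = (fun z : TR => if lo (X i) <= z.2 < hi (X i) then Im (val (X i) k z.1) else 0)); last first.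
  by apply/funext => z; case: ifP.
by apply: measurable_fun_ifT => //; exact: (measurableT_comp m2 measurable_fst).
Qed.

(** All that is kept of the equation at time [t]: one adapted family is close both to the column, in
    energy, and, after integration, to the martingale part. Nothing relates the families of
    different times. *)
Lemma sde_approx t : 0 <= t -> exists M : 'I_N -> T -> R[i],
  [/\ forall j, cmeas (M j),
      {ae P, forall w j, u t j w = V j c + 'i * M j w -
         2^-1 * cintegral mu `[0%R, t] (fun r => u r j w)} &
      forall e : R, 0 < e -> exists (m : nat) (X : 'I_m -> elem),
        [/\ forall i, adapted_elem (X i), forall i, hi (X i) <= t,
            (dint 0%R t (fun z => \sum_k sqm (u z.2 k z.1 - elem_value X k z.2 z.1))%R <= e%:E)%E &
            forall j, (\int[P]_w (sqm (M j w - elem_integral H X j w)%R)%:E <= e%:E)%E] ].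
Proof.
move=> t0; have [M [[mM [m [tau [xi [S cvU cvM]]]]] sde]] := ubm_sde hU t0.
have cM j l : cmeas (fun w => M w j l).
  split => _ B mB; rewrite setTI; apply: mM; exists j, l, B; split => //; first by left.
  by right.
exists (fun j w => M w j c); split => //.
  apply: filterS sde => w h j; rewrite /u h !mxE.
  by rewrite /cintegral /=.
move=> e e0.
have [n _ /(_ n (leqnn n)) [hn1 hn2]] :
    \forall n \near \oo,
     (\int[P]_w \int[mu]_(s in `[0%R, t]) (sqnorm (U s w - step (m n) (tau n) (xi n) s w)%R)%:E <= e%:E)%E /\
     (\int[P]_w (sqnorm (M w - step_integral H (m n) (tau n) (xi n) w)%R)%:E <= e%:E)%E.
  by apply: filterI; apply: ereal_cvg0_near.
exists (m n), (@step_elems R d T N c (m n) (tau n) (xi n)).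
have ok (l : 'I_N) (i : 'I_(m n)) := simple_okel hF l t0 (S n) i.
have ES_ok l k : jcmeas 0 t (fun z => elem_value (@step_elems R d T N l (m n) (tau n) (xi n)) k z.2 z.1).
  apply: ES_cjm => i; have [[h1 h2 h3] _] := ok l i.
  by case: (h3 k) => _ /l2_meas.
have EI_ok l j : cmeas (elem_integral H (@step_elems R d T N l (m n) (tau n) (xi n)) j).
  by apply: l2_meas; apply: (EI_l2 N0 hH hF) => i; case: (ok l i).
split.
- by move=> i; case: (ok c i).
- by move=> i; case: (ok c i).
- apply: le_trans hn1.
  pose G := fun z : TR => sqnorm (U z.2 z.1 - step (m n) (tau n) (xi n) z.2 z.1).
  rewrite -[leRHS]/(dint 0 t G).
  apply: dint_le.
  + apply: jm_sum => k; apply: cjm_sqm; apply: cjmB; first exact: u_cjm.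
    exact: ES_ok.
  + apply: jm_sum => k; apply: jm_sum => l.
    apply: (@cjm_sqm 0 t (fun z => (U z.2 z.1 - step (m n) (tau n) (xi n) z.2 z.1) k l)).
    rewrite (_ : (fun z => _) = (fun z => U z.2 z.1 k l - elem_value (@step_elems R d T N l (m n) (tau n) (xi n)) k z.2 z.1)).
      by apply: cjmB; [exact: u_cjm|exact: ES_ok].
    by apply/funext => z; rewrite famx_ES !mxE.
  + by move=> z; apply: sumr_ge0 => k _; exact: sqm_ge0.
  + by move=> z; apply: sumr_ge0 => k _; apply: sumr_ge0 => l _; exact: sqm_ge0.
  + move=> z _; apply: le_trans (sqnorm_col _ c); apply: ler_sum => k _.
    by rewrite famx_ES !mxE.
- move=> j; apply: le_trans hn2; apply: ge0_le_integral => //.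
  + by move=> w _; rewrite lee_fin sqm_ge0.
  + apply/measurable_EFinP; apply: cmeas_sqm; apply: cmeasB => //; exact: EI_ok.
  + apply/measurable_EFinP; apply: meas_sum => k; apply: meas_sum => l.
    apply: (@cmeas_sqm _ _ _ (fun w => (M w - step_integral H (m n) (tau n) (xi n) w) k l)).
    rewrite (_ : (fun w => _) = (fun w => M w k l - elem_integral H (@step_elems R d T N l (m n) (tau n) (xi n)) k w)).
      by apply: cmeasB => //; exact: EI_ok.
    by apply/funext => w; rewrite famx_EI !mxE.
  + move=> w _; rewrite lee_fin; apply: le_trans (sqnorm_entry _ j c).
    by rewrite famx_EI !mxE.
Qed.

End sde.

(** * One step of the equation *)

Section ito_increment.
Context (R : realType) d (T : measurableType d) (P : probability T R) (N : nat).
Variables (N0 : (0 < N)%N) (F : R -> set (set T)) (H U : R -> T -> 'M[R[i]]_N) (V : 'M[R[i]]_N).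
Hypotheses (hH : hermitian_brownian_motion P H) (hF : brownian_filtration P F H).
Hypothesis hU : unitary_brownian_motion P F H V U.
Variable c : 'I_N.
Local Notation rint := (rint P).
Local Notation RE := (RE P).
Local Notation CE := (CE P).
Local Notation cint := (cint P).
Local Notation l2 := (l2 P).
Local Notation elem := (elem R T N).
Local Notation adapted_elem := (adapted_elem P F).
Local Notation mu := (@lebesgue_measure R).
Local Notation TR := (T * measurableTypeR R)%type.
Local Notation dint := (dint P).
Implicit Types (s t r : R) (j k : 'I_N).

Let u r k w := U r w k c.

Lemma path_integrable (f : R -> R) (s t : R) : 0 <= s ->
  {within `[0, +oo[, continuous f} -> mu.-integrable `[s, t] (EFin \o f).
Proof.
move=> s0 cf; apply: continuous_compact_integrable; first exact: segment_compact.
apply: continuous_subspaceW cf => r /=; rewrite !in_itv/= andbT => /andP[sr _].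
exact: le_trans sr.
Qed.

Lemma cintegral_itvB (f : R -> R[i]) (s t : R) : 0 <= s -> s <= t ->
  {within `[0, +oo[, continuous (fun r => Re (f r))} ->
  {within `[0, +oo[, continuous (fun r => Im (f r))} ->
  cintegral mu `[0, t] f - cintegral mu `[0, s] f = cintegral mu `[s, t] f.
Proof.
move=> s0 st f1 f2.
have key (g : R -> R) : {within `[0, +oo[, continuous g} ->
    \int[mu]_(r in `[0, t]) g r - \int[mu]_(r in `[0, s]) g r = \int[mu]_(r in `[s, t]) g r.
  move=> cg; rewrite Rintegral_itvB ?bnd_simp//; last exact: path_integrable.
  rewrite Rintegral_itv_obnd_cbnd//.
  have := path_integrable t s0 cg; apply: integrableS; [exact: measurable_itv|exact: measurable_itv|].
  by apply: subset_itvr; rewrite bnd_simp.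
by apply: ReIm_eq => /=; rewrite -key.
Qed.

Let B s (z : TR) : R := \sum_k sqm (u z.2 k z.1 - u s k z.1).

Let B_jm s a b : 0 <= s -> 0 <= a -> jmeas a b (B s).
Proof.
move=> s0 a0; apply: jm_sum => k; apply: cjm_sqm; apply: cjmB.
  by apply: (u_cjm hF hU).
by apply: cjmT; apply: (F_meas hF s0); exact: (u_gmeas hU).
Qed.

Section one.
Variables s t : R.
Hypotheses (s0 : 0 <= s) (st : s <= t) (l2u : forall k, l2 (u s k)).
Let t0 : 0 <= t := le_trans s0 st.

Section approx.
Variables (e : R) (m m' : nat) (X : 'I_m -> elem) (Y : 'I_m' -> elem).
Hypotheses (e0 : 0 < e) (okX : forall i, adapted_elem (X i)) (okY : forall i, adapted_elem (Y i)).
Hypotheses (hiX : forall i, hi (X i) <= t) (hiY : forall i, hi (Y i) <= s).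
Let A (r : R) m (X : 'I_m -> elem) (z : TR) : R := \sum_k sqm (u z.2 k z.1 - elem_value X k z.2 z.1).
Hypothesis QX : (dint 0%R t (A t X) <= e%:E)%E.
Hypothesis QY : (dint 0%R s (A s Y) <= e%:E)%E.

Definition diff_family : 'I_m + ('I_m' + 'I_1) -> elem :=
  cat3 X (@elem_opp R d T N \o Y) (@elem_opp R d T N \o (fun _ : 'I_1 => Elem s t (u s))).
Local Notation K := diff_family.

Let okK i : adapted_elem (K i).
Proof.
case: i => [i|[i|i]] /=; [exact: okX|exact: okel_neg|apply: okel_neg; split => //= k].
by split => //; exact: (u_gmeas hU).
Qed.

Let hiK i : hi (K i) <= t.
Proof. by case: i => [i|[i|i]] //=; rewrite (le_trans (hiY i)). Qed.

Lemma EI_diff j w : elem_integral H K j w = elem_integral H X j w - elem_integral H Y j w - \sum_k incr H s t j k w * u s k w.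
Proof.
rewrite /diff_family EI_cat3 !EI_neg addrA; congr (_ + - _).
by rewrite /elem_integral big_ord1.
Qed.

Let ES_K k r w : elem_value K k r w = elem_value X k r w - elem_value Y k r w - (if s <= r < t then u s k w else 0).
Proof.
rewrite /diff_family ES_cat3 !ES_neg addrA; congr (_ + - _).
by rewrite /elem_value big_ord1.
Qed.

Let ESlow k r w : elem_value (elem_before s \o K) k r w = if r < s then elem_value K k r w else 0.
Proof. exact: (ES_low s k r w okK). Qed.

Let ESup k r w : elem_value (elem_after s \o K) k r w = if s <= r then elem_value K k r w else 0.
Proof. exact: (ES_up s k r w okK). Qed.

Let hi_lt (n : nat) (Z : 'I_n -> elem) (b : R) k r w : (forall i, hi (Z i) <= b) -> b <= r ->
  elem_value Z k r w = 0.
Proof.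
move=> hb br; rewrite /elem_value big1// => i _; case: ifP => // /andP[_].
by rewrite ltNge (le_trans (hb i) br).
Qed.

Let A_jm r n (Z : 'I_n -> elem) a b : (forall i, adapted_elem (Z i)) -> 0 <= a -> jmeas a b (A r Z).
Proof.
move=> okZ a0; apply: jm_sum => k; apply: cjm_sqm; apply: cjmB.
  by apply: (u_cjm hF hU).
by apply: ES_cjm => i; have [_ _ h] := okZ i; case: (h k) => _ /l2_meas.
Qed.

Let A_ge0 r n (Z : 'I_n -> elem) z : 0 <= A r Z z.
Proof. by apply: sumr_ge0 => k _; exact: sqm_ge0. Qed.

Let B_ge0 z : 0 <= B s z.
Proof. by apply: sumr_ge0 => k _; exact: sqm_ge0. Qed.

Let G (I : finType) (Z : I -> elem) (z : TR) : R := \sum_k sqm (elem_value Z k z.2 z.1).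

Let G_ge0 (I : finType) (Z : I -> elem) z : 0 <= G Z z.
Proof. by apply: sumr_ge0 => k _; exact: sqm_ge0. Qed.

Let G_jm (I : finType) (Z : I -> elem) a b : (forall i, adapted_elem (Z i)) -> jmeas a b (G Z).
Proof.
move=> okZ; apply: jm_sum => k; apply: cjm_sqm; apply: ES_cjm => i.
by have [_ _ h] := okZ i; case: (h k) => _ /l2_meas.
Qed.

Let okL i : adapted_elem ((elem_before s \o K) i). Proof. exact: okel_low. Qed.
Let okU i : adapted_elem ((elem_after s \o K) i). Proof. exact: (okel_up hF). Qed.

Let le_NRE (I : finType) (Z : I -> elem) j (x : \bar R) : (forall i, adapted_elem (Z i)) ->
  (forall i, hi (Z i) <= t) -> (dint 0%R t (G Z) <= x)%E ->
  ((RE (fun w => sqm (elem_integral H Z j w)))%:E <= x)%E.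
Proof.
move=> okZ hZ; apply: le_trans.
have -> : dint 0 t (G Z) = (N%:R * RE (fun w => sqm (elem_integral H Z j w)))%:E.
  exact: (ito_isometry N0 hH hF okZ hZ j).
rewrite lee_fin ler_peMl ?ler1n//; apply: RE_ge0 => w; exact: sqm_ge0.
Qed.

(** Before [s] the family is a difference of two approximations of [u], each within energy [e];
    squaring the difference costs a factor 2 on each. *)
Lemma low_bound j : RE (fun w => sqm (elem_integral H (elem_before s \o K) j w)) <= 4 * e.
Proof.
rewrite -lee_fin; apply: le_NRE => //.
  by move=> i; rewrite /= ge_max (le_trans _ (hiK i)) ?ge_min ?hiK ?orbT//; have [] := okK i.
apply: (@le_trans _ _ (dint 0 s (fun z => 2 * A t X z + 2 * A s Y z))).
  apply: dint_le_sub => //.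
  - exact: G_jm.
  - by apply: measurable_funD; apply: measurable_funM; first [exact: measurable_cst|exact: A_jm].
  - by move=> z; rewrite addr_ge0// mulr_ge0.
  - move=> [w r] [_ /=]; rewrite in_itv/= => /andP[r0 _] nz.
    rewrite /G big1// => k _; rewrite ESlow/= ifF ?sqm0//.
    apply/negbTE/negP => rs; apply: nz; split => //=.
    by rewrite in_itv/= r0 ltW.
  - move=> [w r] _; rewrite /G /A !mulr_sumr -big_split; apply: ler_sum => k _ /=.
    rewrite ESlow; case: ifP => rs; last first.
      by rewrite sqm0 addr_ge0// mulr_ge0// sqm_ge0.
    rewrite ES_K [s <= r]leNgt rs /= subr0 -sqmN.
    have -> : - (elem_value X k r w - elem_value Y k r w) = (u r k w - elem_value X k r w) - (u r k w - elem_value Y k r w) by ring.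
    exact: sqmB.
rewrite dintD//; last 4 first.
- by apply: measurable_funM; first [exact: measurable_cst|exact: A_jm].
- by apply: measurable_funM; first [exact: measurable_cst|exact: A_jm].
- by move=> z; rewrite mulr_ge0.
- by move=> z; rewrite mulr_ge0.
rewrite !dintZ//; try exact: A_jm.
have -> : (4 * e)%:E = ((2%:E * e%:E) + (2%:E * e%:E))%E.
  by rewrite -!EFinM -EFinD; congr EFin; ring.
apply: leeD; (apply: lee_wpmul2l; first by rewrite lee_fin); last exact: QY.
by apply: le_trans QX; apply: dint_sub; [exact: lexx|exact: st|exact: A_jm|exact: A_ge0].
Qed.

Lemma up_bound j : ((RE (fun w => sqm (elem_integral H (elem_after s \o K) j w)))%:E <=
  (2 * e)%:E + 2%:E * dint s t (B s))%E.
Proof.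
apply: le_NRE => //.
  move=> i /=; rewrite !ge_max hiK st andbT; apply/andP; split => //.
  by rewrite (le_trans _ (hiK i))//; have [] := okK i.
apply: (@le_trans _ _ (dint s t (fun z => 2 * A t X z + 2 * B s z))).
  apply: dint_le_sub => //.
  - exact: G_jm.
  - by apply: measurable_funD; apply: measurable_funM; first [exact: measurable_cst|exact: A_jm|exact: B_jm].
  - by move=> z; rewrite addr_ge0// mulr_ge0.
  - move=> [w r] [_ /=]; rewrite in_itv/= => /andP[_ rt] nz.
    rewrite /G big1// => k _; rewrite ESup/= ifF ?sqm0//.
    by apply/negbTE/negP => rs; apply: nz; split => //=; rewrite in_itv/= rs.
  - move=> [w r] [_ /=]; rewrite in_itv/= => /andP[sr rt].
    rewrite /G /A /B !mulr_sumr -big_split; apply: ler_sum => k _ /=.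
    rewrite ESup sr ES_K (hi_lt _ _ hiY sr) subr0 sr/=; case: ifP => rt'.
      have -> : elem_value X k r w - u s k w = (u r k w - u s k w) - (u r k w - elem_value X k r w) by ring.
      by rewrite [X in _ <= X]addrC; exact: sqmB.
    (* At [r = t] every half-open interval has ended and the value is 0. *)
    rewrite (hi_lt _ _ hiX); first by rewrite subr0 sqm0 addr_ge0// mulr_ge0// sqm_ge0.
    by rewrite leNgt rt'.
rewrite dintD//; last 4 first.
- by apply: measurable_funM; first [exact: measurable_cst|exact: A_jm].
- by apply: measurable_funM; first [exact: measurable_cst|exact: B_jm].
- by move=> z; rewrite mulr_ge0.
- by move=> z; rewrite mulr_ge0.
rewrite !dintZ//; try first [exact: A_jm|exact: B_jm].
rewrite EFinM; apply: leeD; last exact: lexx.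
apply: lee_wpmul2l; first by rewrite lee_fin.
by apply: le_trans QX; apply: dint_sub; [exact: s0|exact: lexx|exact: A_jm|exact: A_ge0].
Qed.

Lemma up_orth j (Z : T -> R[i]) (C : R) : gmeas (F s) Z -> (forall w, nm (Z w) <= C) ->
  CE (fun w => Z w * elem_integral H (elem_after s \o K) j w) = 0.
Proof. by move=> mZ ZC; apply: (CE_EI_up N0 hH hF). Qed.

Lemma EI_diff_split j w : elem_integral H K j w = elem_integral H (elem_before s \o K) j w + elem_integral H (elem_after s \o K) j w.
Proof. exact: EI_split. Qed.

Lemma low_l2 j : l2 (elem_integral H (elem_before s \o K) j). Proof. exact: (EI_l2 N0 hH hF). Qed.
Lemma up_l2 j : l2 (elem_integral H (elem_after s \o K) j). Proof. exact: (EI_l2 N0 hH hF). Qed.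

End approx.

(** [D] is only a limit of elementary integrals: for each [e] it is [A + B'], with [A] of second
    moment at most [16 e] and [B'] an elementary integral over times after [s]. The bound and the
    orthogonality pass to the limit [e -> 0]. *)
Lemma ito_diff : exists D : 'I_N -> T -> R[i],
  [/\ forall j, l2 (D j),
      {ae P, forall w j, u t j w - u s j w =
         'i * (\sum_k incr H s t j k w * u s k w) + 'i * D j w
         - 2^-1 * cintegral mu `[s, t] (fun r => u r j w)},
      forall j, ((RE (fun w => sqm (D j w)))%:E <= 4%:E * dint s t (B s))%E &
      forall j (Z : T -> R[i]) (C : R), gmeas (F s) Z -> (forall w, nm (Z w) <= C) ->
        CE (fun w => Z w * D j w) = 0].
Proof.
have [M [mM sdeM apM]] := sde_approx N0 hH hF hU c t0.
have [M' [mM' sdeM' apM']] := sde_approx N0 hH hF hU c s0.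
pose D j w := M j w - M' j w - \sum_k incr H s t j k w * u s k w.
have mD j : cmeas (D j).
  apply: cmeasB; first exact: cmeasB.
  by apply: cmeas_sum => k; apply: cmeasM; [exact: (incr_meas N0 hH)|exact: l2_meas].
have key e : 0 < e -> forall j, exists A B' : T -> R[i],
   [/\ l2 A, l2 B', forall w, D j w = A w + B' w &
    [/\ RE (fun w => sqm (A w)) <= 16 * e,
     ((RE (fun w => sqm (B' w)))%:E <= (2 * e)%:E + 2%:E * dint s t (B s))%E &
     forall (Z : T -> R[i]) (C : R), gmeas (F s) Z -> (forall w, nm (Z w) <= C) ->
        CE (fun w => Z w * B' w) = 0]].
  move=> e0 j; have [m [X [okX hiX QX IX]]] := apM e e0.
  have [m' [Y [okY hiY QY IY]]] := apM' e e0.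
  pose L := elem_integral H (elem_before s \o diff_family X Y) j.
  pose W := elem_integral H (elem_after s \o diff_family X Y) j.
  pose x w := M j w - elem_integral H X j w; pose y w := M' j w - elem_integral H Y j w.
  have [lx xe] : l2 x /\ RE (fun w => sqm (x w)) <= e.
    by apply: l2_of_le; [exact: (cmeasB (mM j) (l2_meas (EI_l2 N0 hH hF okX j)))|exact: IX].
  have [ly ye] : l2 y /\ RE (fun w => sqm (y w)) <= e.
    by apply: l2_of_le; [exact: (cmeasB (mM' j) (l2_meas (EI_l2 N0 hH hF okY j)))|exact: IY].
  have lL : l2 L by exact: low_l2.
  have Le : RE (fun w => sqm (L w)) <= 4 * e by exact: (low_bound okX okY hiX hiY QX QY).
  exists (fun w => (x w - y w) + L w), W; split.
  - by apply: l2D => //; exact: l2B.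
  - exact: up_l2.
  - move=> w; have h := EI_diff X Y j w; rewrite (EI_diff_split okX okY) -/(L w) -/(W w) in h.
    by rewrite -addrA h /D /x /y; ring.
  split.
  - have i1 : rint (fun w => 4 * sqm (x w) + 4 * sqm (y w) + 2 * sqm (L w)).
      by apply: rintD; [apply: rintD|]; apply: rintZ; exact: l2_int.
    apply: (@le_trans _ _ (RE (fun w => 4 * sqm (x w) + 4 * sqm (y w) + 2 * sqm (L w)))).
      apply: RE_le => //; first by apply: l2_int; apply: l2D => //; exact: l2B.
      move=> w; apply: le_trans (sqmD _ _) _.
      by have := sqmB (x w) (y w); lra.
    rewrite RED ?RED ?REZ//; try (by apply: rintZ; exact: l2_int); try exact: l2_int.
      lra.
    by apply: rintD; apply: rintZ; exact: l2_int.
  - exact: (up_bound okX okY hiX hiY QX).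
  - by move=> Z C mZ ZC; exact: (up_orth okX okY j mZ ZC).
have lD j : l2 (D j).
  have [A [B' [lA lB DE _]]] := key 1 ltr01 j.
  by rewrite (_ : D j = fun w => A w + B' w); [exact: l2D|apply/funext].
exists D; split => //.
- apply: filterS2 sdeM sdeM' => w h h' j; rewrite /u h h'.
  have [c1 c2] := ubm_cont hU w j c.
  by rewrite -(cintegral_itvB s0 st c1 c2) /D; ring.
- move=> j; apply/lee_addgt0Pr => e e0.
  (* Here [36 = 2 * 16 + 2 * 2] collects the errors of [A] and [B'] after [sqmD]. *)
  have e0' : 0 < e / 36 by rewrite divr_gt0.
  have [A [B' [lA lB DE [hA hB _]]]] := key _ e0' j.
  apply: (@le_trans _ _ (2%:E * (16 * (e / 36))%:E + 2%:E * ((2 * (e / 36))%:E + 2%:E * dint s t (B s)))%E).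
    apply: (@le_trans _ _ (2%:E * (RE (fun w => sqm (A w)))%:E + 2%:E * (RE (fun w => sqm (B' w)))%:E)%E).
      rewrite -!EFinM -EFinD lee_fin -!REZ; try exact: l2_int.
      rewrite -RED; try (by apply: rintZ; exact: l2_int).
      apply: RE_le; [exact: l2_int|by apply: rintD; apply: rintZ; exact: l2_int|].
      by move=> w; rewrite DE; exact: sqmD.
    apply: leeD; (apply: lee_wpmul2l; first by rewrite lee_fin); last exact: hB.
    by rewrite lee_fin.
  have Q0 : (0 <= dint s t (B s))%E by apply: dint_ge0 => z; apply: sumr_ge0 => k _; exact: sqm_ge0.
  rewrite ge0_muleDr//; last 2 first.
  + by rewrite lee_fin mulr_ge0// ltW.
  + by rewrite mule_ge0.
  rewrite muleA -!EFinM addeA -EFinD (_ : (2 * 2) = 4); last by ring.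
  rewrite (_ : _ + _ = e)%R; last by field.
  by rewrite addeC.
- move=> j Z C mZ ZC; apply: nm0_eq0; apply/eqP; rewrite eq_le nm_ge0 andbT.
  have lZ : l2 Z by exact: (l2_bnd P (F_meas hF s0 mZ) ZC).
  (* With tolerance [a ^ 2] in [key] and weight [a] in [CEM_amgm], the two terms add up to [a * C'],
     that is [e]; the 16 is the constant of the bound on [A]. *)
  pose C' := RE (fun w => sqm (Z w)) + 16.
  have C'0 : 0 < C' by rewrite ltr_wpDl// RE_ge0// => w; exact: sqm_ge0.
  apply/ler_addgt0Pr => e e0; rewrite add0r.
  have a0 : 0 < e / C' by rewrite divr_gt0.
  set a := e / C' in a0.
  have [A [B' [lA lB DE [hA _ orth]]]] := key (a ^+ 2) (exprn_gt0 2 a0) j.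
  have cZA : cint (fun w => Z w * A w) by exact: l2_cintM.
  have cZB : cint (fun w => Z w * B' w) by exact: l2_cintM.
  have -> : CE (fun w => Z w * D j w) = CE (fun w => Z w * A w).
    transitivity (CE (fun w => Z w * A w + Z w * B' w)).
      by apply: eq_CE => w; rewrite DE mulrDr.
    by rewrite CED// (orth Z C)// addr0.
  apply: le_trans (CEM_amgm a0 lZ lA) _.
  apply: (@le_trans _ _ (a * RE (fun w => sqm (Z w)) + a^-1 * (16 * a ^+ 2))).
    by rewrite lerD2l ler_wpM2l// invr_ge0 ltW.
  rewrite (_ : _ + _ = a * C'); last by rewrite /C'; field; rewrite gt_eqF.
  by rewrite /a divfK// gt_eqF.
Qed.

End one.
End ito_increment.

Section one_step.
Context (R : realType) d (T : measurableType d) (P : probability T R) (N : nat).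
Variables (N0 : (0 < N)%N) (F : R -> set (set T)) (H U : R -> T -> 'M[R[i]]_N) (V : 'M[R[i]]_N).
Hypotheses (hH : hermitian_brownian_motion P H) (hF : brownian_filtration P F H).
Hypothesis hU : unitary_brownian_motion P F H V U.
Variable c : 'I_N.
Local Notation rint := (rint P).
Local Notation RE := (RE P).
Local Notation CE := (CE P).
Local Notation cint := (cint P).
Local Notation l2 := (l2 P).
Local Notation mu := (@lebesgue_measure R).
Local Notation TR := (T * measurableTypeR R)%type.
Local Notation dint := (dint P).
Implicit Types (s t r : R) (j k : 'I_N).

Let u r k w := U r w k c.
Let B s (z : TR) : R := \sum_k sqm (u z.2 k z.1 - u s k z.1).

(** Jensen: expand the nonnegative integral of [(f - m) ^ 2], with [m] the mean of [f] over the
    interval. *)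
Lemma Rintegral_sqr_le (f : R -> R) (s t : R) : s <= t ->
  mu.-integrable `[s, t] (EFin \o f) -> mu.-integrable `[s, t] (EFin \o (fun r => f r ^+ 2)) ->
  (\int[mu]_(r in `[s, t]) f r) ^+ 2 <= (t - s) * \int[mu]_(r in `[s, t]) (f r ^+ 2).
Proof.
move=> st fi fi2; have [st'|ts] := ltP s t; last first.
  have -> : t = s by apply/eqP; rewrite eq_le ts st.
  by rewrite subrr mul0r set_itv1 Rintegral_set1 expr0n.
have mI : measurable (`[s, t]%classic : set (measurableTypeR R)) by exact: measurable_itv.
have d0 : 0 < t - s by rewrite subr_gt0.
pose m := (\int[mu]_(r in `[s, t]) f r) / (t - s).
have cst_i a : mu.-integrable `[s, t] (EFin \o (fun=> a : R)).
  apply: continuous_compact_integrable; first exact: segment_compact.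
  by apply: continuous_subspaceT => x; exact: cvg_cst.
have lebI : fine (mu `[s, t]%classic) = t - s.
  by rewrite lebesgue_measure_itv/= lte_fin st'.
have : 0 <= \int[mu]_(r in `[s, t]) (f r - m) ^+ 2.
  by apply: Rintegral_ge0 => r _; exact: sqr_ge0.
have -> : \int[mu]_(r in `[s, t]) (f r - m) ^+ 2 =
   \int[mu]_(r in `[s, t]) (f r ^+ 2 + ((- 2 * m) * f r + m ^+ 2)).
  by apply: eq_Rintegral => r _; ring.
have i1 : mu.-integrable `[s, t] (EFin \o (fun r => (- 2 * m) * f r)).
  by have := integrableZl mI (- 2 * m) fi; apply: eq_integrable.
have i2 : mu.-integrable `[s, t] (EFin \o (fun r => (- 2 * m) * f r + m ^+ 2)).
  by have := integrableD mI i1 (cst_i (m ^+ 2)); apply: eq_integrable.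
rewrite RintegralD// RintegralD// RintegralZl// Rintegral_cst// lebI.
rewrite /m; set I := \int[mu]_(r in _) f r; set J := \int[mu]_(r in _) _.
rewrite (_ : J + _ = J - I ^+ 2 / (t - s)); last by field; rewrite gt_eqF.
by rewrite subr_ge0 ler_pdivrMr// mulrC.
Qed.

Lemma cintegral_sqm_le (f : R -> R[i]) (a : R[i]) (s t : R) : 0 <= s -> s <= t ->
  {within `[0, +oo[, continuous (fun r => Re (f r))} ->
  {within `[0, +oo[, continuous (fun r => Im (f r))} ->
  ((sqm (cintegral mu `[s, t] f - (t - s)%:C * a))%:E <=
    (t - s)%:E * \int[mu]_(r in `[s, t]) (sqm (f r - a))%:E)%E.
Proof.
move=> s0 st f1 f2.
have cc (g : R -> R) (b : R) : {within `[0, +oo[, continuous g} ->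
    {within `[0, +oo[, continuous (fun r => g r - b)}.
  by move=> cg x; apply: cvgB; [exact: cg|exact: cvg_cst].
have c2 (g : R -> R) : {within `[0, +oo[, continuous g} ->
    {within `[0, +oo[, continuous (fun r => g r ^+ 2)}.
  move=> cg; rewrite (_ : (fun r => g r ^+ 2) = (fun r => g r * g r)); last first.
    by apply/funext => r; rewrite expr2.
  by move=> x; apply: cvgM; exact: cg.
have mI : measurable (`[s, t]%classic : set (measurableTypeR R)) by exact: measurable_itv.
have cst_i b : mu.-integrable `[s, t] (EFin \o (fun=> b : R)).
  apply: continuous_compact_integrable; first exact: segment_compact.
  by apply: continuous_subspaceT => x; exact: cvg_cst.
have lebI : fine (mu `[s, t]%classic) = t - s.
  rewrite lebesgue_measure_itv/= lte_fin; case: ltP => // ts.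
  by apply/eqP; rewrite eq_sym subr_eq0 eq_le st ts.
have key (g : R -> R) b : {within `[0, +oo[, continuous g} ->
   (\int[mu]_(r in `[s, t]) g r - (t - s) * b) ^+ 2 <=
   (t - s) * \int[mu]_(r in `[s, t]) ((g r - b) ^+ 2).
  move=> cg; have <- : \int[mu]_(r in `[s, t]) b = (t - s) * b.
    by rewrite Rintegral_cst// lebI mulrC.
  rewrite -RintegralB//; last exact: path_integrable.
  apply: Rintegral_sqr_le => //; apply: path_integrable => //; first exact: cc.
  by apply: c2; exact: cc.
have j1 := path_integrable t s0 (c2 _ (cc _ (Re a) f1)).
have j2 := path_integrable t s0 (c2 _ (cc _ (Im a) f2)).
have -> : (\int[mu]_(r in `[s, t]) (sqm (f r - a))%:E =
   (\int[mu]_(r in `[s, t]) ((Re (f r) - Re a) ^+ 2) + \int[mu]_(r in `[s, t]) ((Im (f r) - Im a) ^+ 2))%R%:E)%E.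
  rewrite -RintegralD// /Rintegral fineK; last first.
    by apply: integrable_fin_num => //; have := integrableD mI j1 j2; apply: eq_integrable.
  by apply: eq_integral => r _; rewrite /sqm !cReD !cImD !cReN !cImN.
rewrite -EFinM lee_fin mulrDr /sqm; apply: lerD.
  by rewrite cReD cReN cReM /= mul0r subr0; exact: key.
by rewrite cImD cImN cImM /= mul0r addr0; exact: key.
Qed.

(** [q] is defined as the missing term, so that the expansion holds at every sample point. The
    equation, valid almost surely, serves to bound it: there [q] is [-1/2] times the integral of
    [u r - u s]. *)
Lemma one_step s t (b : R) : 0 <= s -> s <= t -> (forall k, l2 (u s k)) ->
  (dint s t (B s) <= b%:E)%E ->
  exists p q : 'I_N -> T -> R[i],
  [/\ forall j, l2 (p j) /\ RE (fun w => sqm (p j w)) <= 4 * b,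
      forall j, l2 (q j) /\ RE (fun w => sqm (q j w)) <= (t - s) * b,
      forall j (Z : T -> R[i]) (C : R), gmeas (F s) Z -> (forall w, nm (Z w) <= C) ->
        CE (fun w => Z w * p j w) = 0 &
      forall j w, u t j w = u s j w + ('i * (\sum_k incr H s t j k w * u s k w) + 'i * p j w
         - ((t - s) / 2)%:C * u s j w + q j w)].
Proof.
move=> s0 st l2u Qb; have t0 := le_trans s0 st.
have [D [lD eqD RD orthD]] := ito_diff N0 hH hF hU s0 st l2u.
pose q j w := u t j w - u s j w - 'i * (\sum_k incr H s t j k w * u s k w) - 'i * D j w
         + ((t - s) / 2)%:C * u s j w.
have mu_ r j : 0 <= r -> cmeas (u r j) by move=> r0; apply: (F_meas hF r0); exact: (u_gmeas hU).
have mq j : cmeas (q j).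
  have m1 : cmeas (fun w => 'i * \sum_k incr H s t j k w * u s k w : R[i]).
    apply: cmeasM; first exact: cmeas_cst.
    by apply: cmeas_sum => k; apply: cmeasM; [exact: (incr_meas N0 hH)|exact: mu_].
  have m2 : cmeas (fun w => 'i * D j w).
    by apply: cmeasM; [exact: cmeas_cst|exact: l2_meas].
  have m3 : cmeas (fun w => ((t - s) / 2)%:C * u s j w).
    by apply: cmeasM; [exact: cmeas_cst|exact: mu_].
  by apply: cmeasD => //; apply: cmeasB => //; apply: cmeasB => //; apply: cmeasB; exact: mu_.
have B_jm : jmeas s t (B s).
  apply: jm_sum => k; apply: cjm_sqm; apply: cjmB; first by apply: (u_cjm hF hU).
  by apply: cjmT; exact: mu_.
have B0 z : 0 <= B s z by apply: sumr_ge0 => k _; exact: sqm_ge0.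
have bj j : jmeas s t (fun z => sqm (u z.2 j z.1 - u s j z.1)).
  apply: cjm_sqm; apply: cjmB; first by apply: (u_cjm hF hU).
  by apply: cjmT; exact: mu_.
have q_ae j : {ae P, forall w, ((sqm (q j w))%:E <= (t - s)%:E *
    \int[mu]_(r in `[s, t]) (sqm (u r j w - u s j w)%R)%:E)%E}.
  apply: filterS eqD => w /(_ j) h.
  have -> : q j w = - 2^-1 * (cintegral mu `[s, t] (fun r => u r j w) - (t - s)%:C * u s j w).
    rewrite /q h rmorphM /= fmorphV rmorph_nat; ring.
  have [c1 c2] := ubm_cont hU w j c.
  apply: le_trans (cintegral_sqm_le (u s j w) s0 st c1 c2).
  rewrite sqmM lee_fin ler_piMl ?sqm_ge0// sqmN.
  rewrite (_ : 2^-1 = (2^-1 : R)%:C); last by rewrite fmorphV rmorph_nat.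
  by rewrite sqmC expr2; lra.
have qb j : l2 (q j) /\ RE (fun w => sqm (q j w)) <= (t - s) * b.
  apply: l2_of_le => //.
  have Qj : (dint s t (fun z => sqm (u z.2 j z.1 - u s j z.1)%R) <= b%:E)%E.
    apply: le_trans Qb; apply: dint_le => //.
    - by move=> z; exact: sqm_ge0.
    - move=> z _; rewrite /B (bigD1 j)//= lerDl; apply: sumr_ge0 => k _; exact: sqm_ge0.
  have ts0 : 0 <= t - s by rewrite subr_ge0.
  have mI : measurable_fun setT (fun w => \int[mu]_(r in `[s, t]) (sqm (u r j w - u s j w)%R)%:E)%E.
    exact: (dint_inner_meas (bj j) (fun z => sqm_ge0 _)).
  apply: (@le_trans _ _ (\int[P]_w ((t - s)%:E * \int[mu]_(r in `[s, t]) (sqm (u r j w - u s j w)%R)%:E))%E).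
    apply: ae_ge0_le_integral => //.
    - by move=> w _; rewrite lee_fin sqm_ge0.
    - by apply/measurable_EFinP; exact: cmeas_sqm.
    - by move=> w _; rewrite mule_ge0//; apply: integral_ge0 => r _; rewrite lee_fin sqm_ge0.
    - exact: measurable_funeM.
    - by apply: filterS (q_ae j) => w h _.
  rewrite ge0_integralZl//; last first.
    by move=> w _; apply: integral_ge0 => r _; rewrite lee_fin sqm_ge0.
  by rewrite EFinM; apply: lee_wpmul2l; rewrite ?lee_fin.
exists D, q; split => //.
- move=> j; split => //; rewrite -lee_fin EFinM; apply: le_trans (RD j) _.
  by apply: lee_wpmul2l; rewrite ?lee_fin.
- by move=> j w; rewrite /q; ring.
Qed.

End one_step.

(** * Uniform second moments *)

Section uniform.
Context (R : realType) d (T : measurableType d) (P : probability T R) (N : nat).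
Variables (N0 : (0 < N)%N) (F : R -> set (set T)) (H U : R -> T -> 'M[R[i]]_N) (V : 'M[R[i]]_N).
Hypotheses (hH : hermitian_brownian_motion P H) (hF : brownian_filtration P F H).
Hypothesis hU : unitary_brownian_motion P F H V U.
Variable c : 'I_N.
Local Notation rint := (rint P).
Local Notation RE := (RE P).
Local Notation CE := (CE P).
Local Notation cint := (cint P).
Local Notation l2 := (l2 P).
Local Notation mu := (@lebesgue_measure R).
Local Notation TR := (T * measurableTypeR R)%type.
Local Notation dint := (dint P).
Implicit Types (s t r : R) (j k : 'I_N).

Let u r k w := U r w k c.
Let B s (z : TR) : R := \sum_k sqm (u z.2 k z.1 - u s k z.1).

Let B_ge0 s z : 0 <= B s z.
Proof. by apply: sumr_ge0 => k _; exact: sqm_ge0. Qed.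

Let u_meas r j : 0 <= r -> cmeas (u r j).
Proof. by move=> r0; apply: (F_meas hF r0); exact: (u_gmeas hU). Qed.

Let B_jm s a b : 0 <= s -> 0 <= a -> jmeas a b (B s).
Proof.
move=> s0 a0; apply: jm_sum => k; apply: cjm_sqm; apply: cjmB; first by apply: (u_cjm hF hU).
by apply: cjmT; exact: u_meas.
Qed.


Lemma sqm4 (y z v w : R[i]) :
  sqm (y + z - v + w) <= 8 * (sqm y + sqm z) + 4 * sqm v + 2 * sqm w.
Proof.
have h2 := sqmD (y + z - v) w.
have h3 := sqmB (y + z) v; have h4 := sqmD y z; lra.
Qed.

Lemma RE_incr_sqm s t j k : 0 <= s -> s <= t -> RE (fun w => sqm (incr H s t j k w)) = (t - s) / N%:R.
Proof.
move=> s0 st; have := CE_incrM N0 hH s0 st j k k j.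
rewrite !eqxx mulr1 => h; have : Re (CE (fun w => incr H s t j k w * incr H s t k j w)) = (t - s) / N%:R by rewrite h.
move=> <-; rewrite ReCE; apply: eq_RE => w.
by rewrite (incr_herm hH s0 st k j) -sqmE.
Qed.

(** Cauchy-Schwarz costs a factor [N], which the variance [(t - s) / N] of the entries gives
    back. *)
Lemma RE_noise s t j (f : 'I_N -> T -> R[i]) : 0 <= s -> s <= t ->
  (forall k, gmeas (F s) (f k)) -> (forall k, l2 (f k)) ->
  l2 (fun w => \sum_k incr H s t j k w * f k w) /\
  RE (fun w => sqm (\sum_k incr H s t j k w * f k w)) <=
    (t - s) * \sum_k RE (fun w => sqm (f k w)).
Proof.
move=> s0 st mf lf.
have lk k : l2 (fun w => incr H s t j k w * f k w) by exact: (incr_ind_l2 N0 hH hF).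
have lS : l2 (fun w => \sum_k incr H s t j k w * f k w) by exact: l2_sum.
split => //.
have iS : rint (fun w => \sum_k sqm (incr H s t j k w * f k w)).
  by apply: rint_sum => k; exact: l2_int.
apply: (@le_trans _ _ (RE (fun w => N%:R * \sum_k sqm (incr H s t j k w * f k w)))).
  apply: RE_le; [exact: l2_int|exact: rintZ|move=> w; exact: sqm_sum].
rewrite REZ// RE_sum; last by move=> k; exact: l2_int.
rewrite !mulr_sumr; apply: ler_sum => k _.
rewrite (@eq_RE _ _ _ P _ (fun w => sqm (f k w) * sqm (incr H s t j k w))); last first.
  by move=> w; rewrite sqmM mulrC.
rewrite (RE_ind_sqm N0 hH hF s0 st (mf k) (incr_gmeas H s t j k) (lf k) (incr_l2 N0 hH s0 st j k)).
rewrite RE_incr_sqm// le_eqVlt; apply/orP; left; apply/eqP; field.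
by rewrite pnatr_eq0 -lt0n.
Qed.

(** The four terms of the expansion are bounded separately, with the weights of [sqm4]. Square
    integrability at time [r] is a conclusion here. *)
Lemma step_bound s r (b C : R) : 0 <= s -> s <= r ->
  (forall k, l2 (u s k) /\ RE (fun w => sqm (u s k w)) <= C) -> (dint s r (B s) <= b%:E)%E ->
  forall k, l2 (u r k) /\ RE (fun w => sqm (u r k w - u s k w)) <=
    8 * ((r - s) * (N%:R * C) + 4 * b) + 4 * ((r - s) ^+ 2 * C) + 2 * ((r - s) * b).
Proof.
move=> s0 sr hu Qb k; have lus l : l2 (u s l) by case: (hu l).
have rs0 : 0 <= r - s by rewrite subr_ge0.
have [p [q [hp hq _ ue]]] := one_step N0 hH hF hU s0 sr lus Qb.
have [lp pb] := hp k; have [lq qb] := hq k.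
have [ln nb] := RE_noise k s0 sr (fun k => u_gmeas hU k c s0) lus.
have [_ ub] := hu k.
pose a1 w : R[i] := 'i * \sum_l incr H s r k l w * U s w l c.
pose a2 w : R[i] := 'i * p k w.
pose a3 w : R[i] := ((r - s) / 2)%:C * u s k w.
have ukE w : u r k w = u s k w + (a1 w + a2 w - a3 w + q k w) by exact: ue.
have l1 : l2 a1 by exact: l2Z.
have l2' : l2 a2 by exact: l2Z.
have l3 : l2 a3 by exact: l2Z.
have ld : l2 (fun w => a1 w + a2 w - a3 w + q k w).
  by apply: l2D => //; apply: l2B => //; exact: l2D.
split.
  rewrite (_ : u r k = fun w => u s k w + (a1 w + a2 w - a3 w + q k w)); last exact/funext.
  exact: l2D.
have i1 := l2_int l1; have i2 := l2_int l2'; have i3 := l2_int l3; have iq := l2_int lq.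
have J1 := rintZ 8 (rintD i1 i2); have J2 := rintD J1 (rintZ 4 i3).
apply: (@le_trans _ _ (RE (fun w => 8 * (sqm (a1 w) + sqm (a2 w)) + 4 * sqm (a3 w) + 2 * sqm (q k w)))).
  rewrite (@eq_RE _ _ _ P _ (fun w => sqm (a1 w + a2 w - a3 w + q k w))); last first.
    by move=> w; rewrite ukE addrC addrA addNr add0r.
  apply: RE_le; [exact: l2_int|exact: (rintD J2 (rintZ 2 iq))|].
  by move=> w; exact: sqm4.
rewrite (RED J2 (rintZ 2 iq)) (RED J1 (rintZ 4 i3)).
rewrite (REZ 8 (rintD i1 i2)) (REZ 4 i3) (REZ 2 iq) (RED i1 i2).
have e1 : RE (fun w => sqm (a1 w)) <= (r - s) * (N%:R * C).
  under eq_RE do rewrite /a1 sqmi.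
  apply: le_trans nb _; apply: ler_wpM2l => //.
  rewrite mulr_natl -[X in C *+ X](card_ord N) -sumr_const; apply: ler_sum => l _.
  by have [] := hu l.
have e2 : RE (fun w => sqm (a2 w)) <= 4 * b.
  by under eq_RE do rewrite /a2 sqmi; exact: pb.
have e3 : RE (fun w => sqm (a3 w)) <= (r - s) ^+ 2 * C.
  under eq_RE do rewrite /a3 sqmM sqmC.
  rewrite REZ; last exact: l2_int.
  rewrite ler_pM ?sqr_ge0//; first by apply: RE_ge0 => w; exact: sqm_ge0.
  rewrite ler_pXn2r ?nnegrE ?divr_ge0//; lra.
lra.
Qed.

Section horizon.
Variable Tm : R.
Hypothesis Tm0 : 0 <= Tm.

(** Square integrability is not an assumption on [U]: the integrand is within finite energy of an
    elementary process, whose own energy is finite by the isometry. *)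
Lemma energy_fin : exists b : R, (dint 0%R Tm (fun z => \sum_k sqm (u z.2 k z.1))%R <= b%:E)%E.
Proof.
have [M [_ _ /(_ 1 ltr01) [m [X [okX hiX QX _]]]]] := sde_approx N0 hH hF hU c Tm0.
have ju : jmeas 0 Tm (fun z : TR => \sum_k sqm (u z.2 k z.1)).
  by apply: jm_sum => k; apply: cjm_sqm; apply: (u_cjm hF hU).
have jE k : jcmeas 0 Tm (fun z => elem_value X k z.2 z.1).
  by apply: ES_cjm => i; have [_ _ h] := okX i; case: (h k) => _ /l2_meas.
have j1 : jmeas 0 Tm (fun z : TR => \sum_k sqm (u z.2 k z.1 - elem_value X k z.2 z.1)).
  by apply: jm_sum => k; apply: cjm_sqm; apply: cjmB => //; apply: (u_cjm hF hU).
have j2 : jmeas 0 Tm (fun z : TR => \sum_k sqm (elem_value X k z.2 z.1)).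
  by apply: jm_sum => k; apply: cjm_sqm.
have p1 (z : TR) : 0 <= \sum_k sqm (u z.2 k z.1 - elem_value X k z.2 z.1).
  by apply: sumr_ge0 => k _; exact: sqm_ge0.
have p2 (z : TR) : 0 <= \sum_k sqm (elem_value X k z.2 z.1).
  by apply: sumr_ge0 => k _; exact: sqm_ge0.
pose j0 := Ordinal N0.
exists (2 + 2 * (N%:R * RE (fun w => sqm (elem_integral H X j0 w)))).
apply: (@le_trans _ _ (dint 0 Tm (fun z => 2 * (\sum_k sqm (u z.2 k z.1 - elem_value X k z.2 z.1)) +
   2 * (\sum_k sqm (elem_value X k z.2 z.1))))).
  apply: dint_le => //.
  - by apply: measurable_funD; apply: measurable_funM; first [exact: measurable_cst|exact: j1|exact: j2].
  - by move=> z; apply: sumr_ge0 => k _; exact: sqm_ge0.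
  - by move=> z; rewrite addr_ge0// mulr_ge0.
  - move=> z _; rewrite !mulr_sumr -big_split; apply: ler_sum => k _ /=.
    by rewrite -{1}(subrK (elem_value X k z.2 z.1) (u z.2 k z.1)); exact: sqmD.
rewrite dintD//; last 4 first.
- by apply: measurable_funM; first [exact: measurable_cst|exact: j1].
- by apply: measurable_funM; first [exact: measurable_cst|exact: j2].
- by move=> z; rewrite mulr_ge0.
- by move=> z; rewrite mulr_ge0.
rewrite !dintZ//; set x := N%:R * _.
apply: (@le_trans _ _ (2%:E + (2 * x)%:E)%E); last exact: lexx.
apply: leeD.
  by rewrite -[leRHS]mule1; apply: lee_wpmul2l; rewrite ?lee_fin.
have -> : dint 0 Tm (fun z => \sum_k sqm (elem_value X k z.2 z.1)) = x%:E.
  exact: (ito_isometry N0 hH hF okX hiX j0).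
by rewrite -EFinM.
Qed.

(* The first step starts from the deterministic time 0, where square integrability is free. *)
Lemma l2_uniform : exists C : R, 0 <= C /\ forall r k, 0 <= r -> r <= Tm ->
  l2 (u r k) /\ RE (fun w => sqm (u r k w)) <= C.
Proof.
have [b Qb] := energy_fin.
pose v := \sum_k sqm (V k c).
have v0 : 0 <= v by apply: sumr_ge0 => k _; exact: sqm_ge0.
have u0E k w : u 0 k w = V k c by rewrite /u (ubm_0 hU).
have l0 k : l2 (u 0 k).
  by rewrite (_ : u 0 k = fun=> V k c); [exact: l2_cst|apply/funext].
pose b' := 2 * `|b| + 2 * Tm * v.
have ju : jmeas 0 Tm (fun z : TR => \sum_k sqm (u z.2 k z.1)).
  by apply: jm_sum => k; apply: cjm_sqm; apply: (u_cjm hF hU).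
have pu (z : TR) : 0 <= \sum_k sqm (u z.2 k z.1).
  by apply: sumr_ge0 => k _; exact: sqm_ge0.
have Qv : dint 0 Tm (fun=> v) = (Tm * v)%:E.
  have inner : (\int[mu]_(r in `[0%R, Tm]) v%:E = (Tm * v)%:E)%E.
    rewrite integral_cst//= lebesgue_measure_itv/= lte_fin; case: ltP => h.
      by rewrite oppr0 adde0 -EFinM mulrC.
    have -> : Tm = 0 by apply/eqP; rewrite eq_le h Tm0.
    by rewrite mule0 mul0r.
  rewrite /dint; under eq_integral do rewrite inner.
  by rewrite RE_EFin ?RE_cst//; exact: rint_cst.
have b'0 : 0 <= b' by rewrite addr_ge0// !mulr_ge0.
have QB : (dint 0%R Tm (B 0%R) <= b'%:E)%E.
  apply: (@le_trans _ _ (dint 0 Tm (fun z => 2 * (\sum_k sqm (u z.2 k z.1)) + 2 * v))).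
    apply: dint_le => //; first exact: B_jm.
    - by apply: measurable_funD; apply: measurable_funM; first [exact: measurable_cst|exact: ju].
    - by move=> z; rewrite addr_ge0// mulr_ge0.
    - move=> z _; rewrite /B !mulr_sumr -big_split; apply: ler_sum => k _ /=.
      by rewrite u0E; exact: sqmB.
  have jv (x : R) : jmeas 0 Tm (fun _ : TR => x) by exact: measurable_cst.
  rewrite dintD; [|by apply: measurable_funM; first [exact: measurable_cst|exact: ju]|exact: jv|
    by move=> z; rewrite mulr_ge0|by move=> z; rewrite mulr_ge0].
  rewrite dintZ// (@dintZ _ _ _ P 0 Tm 2 (fun=> v))//.
  rewrite Qv; apply: (@le_trans _ _ ((2 * `|b|)%:E + (2 * Tm * v)%:E)%E); last exact: lexx.
  apply: leeD; last by rewrite -EFinM lee_fin mulrA.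
  rewrite EFinM; apply: lee_wpmul2l; first by rewrite lee_fin.
  by apply: le_trans Qb _; rewrite lee_fin ler_norm.
pose b1 := 8 * (Tm * (N%:R * v) + 4 * b') + 4 * (Tm ^+ 2 * v) + 2 * (Tm * b').
have b10 : 0 <= b1.
  by rewrite /b1 !addr_ge0// ?mulr_ge0// ?addr_ge0// ?mulr_ge0// ?sqr_ge0.
exists (2 * v + 2 * b1); split; first by rewrite addr_ge0// mulr_ge0.
move=> r k r0 rT.
have QBr : (dint 0%R r (B 0%R) <= b'%:E)%E.
  by apply: le_trans QB; apply: dint_sub => //; exact: B_jm.
have RE0 l : RE (fun w => sqm (u 0 l w)) = sqm (V l c).
  by rewrite (@eq_RE _ _ _ P _ (fun=> sqm (V l c))) ?RE_cst// => w; rewrite u0E.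
have sv l : sqm (V l c) <= v.
  by rewrite /v (bigD1 l)//= lerDl; apply: sumr_ge0 => ? _; exact: sqm_ge0.
have h0 l : l2 (u 0 l) /\ RE (fun w => sqm (u 0 l w)) <= v by rewrite RE0.
have [lu hb] := step_bound (lexx 0) r0 h0 QBr k.
split => //; rewrite subr0 in hb.
have hb1 : RE (fun w => sqm (u r k w - u 0 k w)) <= b1.
  apply: le_trans hb _; rewrite /b1; apply: lerD; [apply: lerD|]; rewrite ler_wpM2l//.
  - by rewrite lerD2r ler_wpM2r// mulr_ge0.
  - by rewrite ler_wpM2r// ler_pXn2r ?nnegrE.
  - by rewrite ler_wpM2r.
have ld := l2_int (l2B lu (l0 k)); have i0 := l2_int (l0 k).
apply: (@le_trans _ _ (RE (fun w => 2 * sqm (u 0 k w) + 2 * sqm (u r k w - u 0 k w)))).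
  apply: RE_le; [exact: l2_int|exact: (rintD (rintZ 2 i0) (rintZ 2 ld))|move=> w].
  by rewrite -{1}(subrK (u 0 k w) (u r k w)) addrC; exact: sqmD.
rewrite (RED (rintZ 2 i0) (rintZ 2 ld)) (REZ 2 i0) (REZ 2 ld) RE0.
have := sv k; lra.
Qed.

Lemma dint_bound s t (C : R) : 0 <= s -> s <= t -> 0 <= C ->
  (forall r k, s <= r -> r <= t -> l2 (u r k) /\ RE (fun w => sqm (u r k w - u s k w)) <= C) ->
  (dint s t (B s) <= ((t - s) * (N%:R * C))%:E)%E.
Proof.
move=> s0 st C0 hu; rewrite dint_swap//; last exact: B_jm.
have lus k : l2 (u s k) by have [] := hu s k (lexx s) st.
apply: (@le_trans _ _ (\int[mu]_(r in `[s, t]) (N%:R * C)%:E)%E).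
  apply: ge0_le_integral => //.
  - by move=> r _; apply: integral_ge0 => w _; rewrite lee_fin.
  - have := dint_outer_meas P (@B_jm s s t s0 s0) (B_ge0 s); exact.
  - move=> r /=; rewrite in_itv/= => /andP[sr rt].
    have ik k : rint (fun w => sqm (u r k w - u s k w)).
      by apply: l2_int; apply: l2B => //; have [] := hu r k sr rt.
    rewrite /B RE_EFin; last exact: rint_sum.
    rewrite lee_fin RE_sum// mulr_natl -[X in C *+ X](card_ord N) -sumr_const.
    by apply: ler_sum => k _; have [] := hu r k sr rt.
rewrite integral_cst//= lebesgue_measure_itv/= lte_fin; case: ltP => h.
  by rewrite -EFinB -EFinM lee_fin mulrC.
by rewrite mule0 lee_fin mulr_ge0// ?subr_ge0// mulr_ge0.
Qed.

(* Bootstrap: the uniform L^2 bound gives increments of order sqrt(t - s), which feed back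
   into the remainders p and q. *)
Lemma one_step_uniform : exists C : R, 0 <= C /\ forall s t, 0 <= s -> s <= t -> t <= Tm ->
  (forall k, l2 (u s k) /\ RE (fun w => sqm (u s k w)) <= C) /\
  exists p q : 'I_N -> T -> R[i],
  [/\ forall j, l2 (p j) /\ RE (fun w => sqm (p j w)) <= C * (t - s) ^+ 2,
      forall j, l2 (q j) /\ RE (fun w => sqm (q j w)) <= C * (t - s) ^+ 3,
      forall j (Z : T -> R[i]) (K : R), gmeas (F s) Z -> (forall w, nm (Z w) <= K) ->
        CE (fun w => Z w * p j w) = 0 &
      forall j w, u t j w = u s j w + ('i * (\sum_k incr H s t j k w * u s k w) + 'i * p j w
         - ((t - s) / 2)%:C * u s j w + q j w)].
Proof.
have [C [C0 hC]] := l2_uniform.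
have d4 s r k : 0 <= s -> s <= r -> r <= Tm -> RE (fun w => sqm (u r k w - u s k w)) <= 4 * C.
  move=> s0 sr rT; have r0 := le_trans s0 sr; have sT := le_trans sr rT.
  have [lr br] := hC r k r0 rT; have [ls bs] := hC s k s0 sT.
  have ir := l2_int lr; have is_ := l2_int ls.
  apply: (@le_trans _ _ (RE (fun w => 2 * sqm (u r k w) + 2 * sqm (u s k w)))).
    apply: RE_le; [by apply: l2_int; exact: l2B|exact: (rintD (rintZ 2 ir) (rintZ 2 is_))|].
    by move=> w; exact: sqmB.
  by rewrite (RED (rintZ 2 ir) (rintZ 2 is_)) (REZ 2 ir) (REZ 2 is_); lra.
have NC0 : 0 <= N%:R * (4 * C) by rewrite !mulr_ge0.
pose C1 := 8 * (N%:R * C + 4 * (N%:R * (4 * C))) + 4 * (Tm * C) + 2 * (Tm * (N%:R * (4 * C))).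
have C10 : 0 <= C1.
  by rewrite /C1 !addr_ge0// ?mulr_ge0// ?addr_ge0// ?mulr_ge0.
have d1 s r k : 0 <= s -> s <= r -> r <= Tm ->
    RE (fun w => sqm (u r k w - u s k w)) <= C1 * (r - s).
  move=> s0 sr rT; have sT := le_trans sr rT; have rs0 : 0 <= r - s by rewrite subr_ge0.
  have rsT : r - s <= Tm by rewrite lerBlDr (le_trans rT)// lerDl.
  have Qb : (dint s r (B s) <= ((r - s) * (N%:R * (4 * C)))%:E)%E.
    apply: dint_bound => //; first by rewrite mulr_ge0.
    move=> r' k' sr' r'r; split; last by apply: d4 => //; exact: le_trans rT.
    by have [] := hC r' k' (le_trans s0 sr') (le_trans r'r rT).
  have [_] := step_bound s0 sr (fun k => hC s k s0 sT) Qb k.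
  move=> h; apply: (le_trans h).
  have e1 : (r - s) ^+ 2 * C <= (r - s) * (Tm * C).
    by rewrite expr2 -mulrA ler_wpM2l// ler_wpM2r.
  have e2 : (r - s) * ((r - s) * (N%:R * (4 * C))) <= (r - s) * (Tm * (N%:R * (4 * C))).
    by rewrite ler_wpM2l// ler_wpM2r.
  rewrite /C1; move: e1 e2; set x := r - s; set y := N%:R * C; set z := N%:R * (4 * C).
  by move=> e1 e2; nra.
(* [C] bounds the second moments of the column, and [4 * (N * C1)] serves for [p] and [q], where
   [C1] is the rate of growth of the squared increments. *)
pose C2 := C + 4 * (N%:R * C1).
have NC1 : 0 <= N%:R * C1 by rewrite mulr_ge0.
exists C2; split; first by rewrite /C2; lra.
move=> s t s0 st tT; have sT := le_trans st tT; have ts0 : 0 <= t - s by rewrite subr_ge0.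
split.
  move=> k; have [l b] := hC s k s0 sT; split => //; rewrite /C2; lra.
have Qb : (dint s t (B s) <= ((t - s) * (N%:R * (C1 * (t - s))))%:E)%E.
  apply: dint_bound => //; first by rewrite mulr_ge0.
  move=> r k sr rt; have rT := le_trans rt tT; split.
    by have [] := hC r k (le_trans s0 sr) rT.
  by apply: (le_trans (d1 _ _ _ s0 sr rT)); rewrite ler_wpM2l// lerD2r.
have [p [q [hp hq o e]]] := one_step N0 hH hF hU s0 st (fun k => proj1 (hC s k s0 sT)) Qb.
exists p, q; split => //.
- move=> j; have [l b] := hp j; split => //; apply: (le_trans b).
  rewrite (_ : 4 * _ = (4 * (N%:R * C1)) * (t - s) ^+ 2); last by ring.
  by rewrite ler_wpM2r ?sqr_ge0// /C2; lra.
- move=> j; have [l b] := hq j; split => //; apply: (le_trans b).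
  rewrite (_ : (t - s) * _ = (N%:R * C1) * (t - s) ^+ 3); last by ring.
  by rewrite ler_wpM2r ?exprn_ge0// /C2; lra.
Qed.

End horizon.
End uniform.

(** * Expansions to third order *)

Section expansion.
Context (R : realType) d (T : measurableType d) (P : probability T R) (N : nat).
Variables (N0 : (0 < N)%N) (F : R -> set (set T)) (H : R -> T -> 'M[R[i]]_N).
Hypotheses (hH : hermitian_brownian_motion P H) (hF : brownian_filtration P F H).
Local Notation rint := (rint P).
Local Notation RE := (RE P).
Local Notation CE := (CE P).
Local Notation cint := (cint P).
Local Notation l2 := (l2 P).
Implicit Types (j k : 'I_N).

Definition noise (s t : R) (x : 'I_N -> T -> R[i]) j w : R[i] :=
  'i * \sum_k incr H s t j k w * x k w.

(* One time step from s to t = s + e ^ 2, from the state x to the state y. *)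
Record sde_step (Adm : set ('I_N -> R[i])) (C L : R) := SdeStep {
  ss : R; st : R; se : R;
  sx : 'I_N -> T -> R[i]; sy : 'I_N -> T -> R[i];
  sp : 'I_N -> T -> R[i]; sq : 'I_N -> T -> R[i];
  ss_ge0 : 0 <= ss;
  ss_le : ss <= st;
  se_gt0 : 0 < se;
  se_sqr : se ^+ 2 = st - ss;
  se_le : se <= L;
  sx_in : forall w, Adm (sx ^~ w);
  sy_in : forall w, Adm (sy ^~ w);
  sx_gmeas : forall k, gmeas (F ss) (sx k);
  sx_l2 : forall k, l2 (sx k);
  sx_bnd : forall k, RE (fun w => sqm (sx k w)) <= C;
  sp_l2 : forall k, l2 (sp k);
  sp_bnd : forall k, RE (fun w => sqm (sp k w)) <= C * se ^+ 4;
  sq_l2 : forall k, l2 (sq k);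
  sq_bnd : forall k, RE (fun w => sqm (sq k w)) <= C * se ^+ 6;
  sp_orth : forall j (Z : T -> R[i]) (K : R), gmeas (F ss) Z -> (forall w, nm (Z w) <= K) ->
    CE (fun w => Z w * sp j w) = 0;
  sy_eq : forall j w, sy j w = sx j w + (noise ss st sx j w + 'i * sp j w
    - ((st - ss) / 2)%:C * sx j w + sq j w) }.

Section calculus.
Variables (Adm : set ('I_N -> R[i])) (C L : R).
Hypotheses (C0 : 0 <= C) (L0 : 0 <= L).
Local Notation sde_step := (sde_step Adm C L).
Implicit Types (g : sde_step) (f h : sde_step -> T -> R[i]) (n a b : nat).

(* Orders are in powers of [se = sqrt (t - s)], uniformly over all steps; a remainder in
   [bigO 3] is negligible with respect to [t - s]. *)
Definition bigO n (z : sde_step -> R[i]) := exists K : R, 0 <= K /\ forall g, nm (z g) <= K * se g ^+ n.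

(** Order [a] in the L^2 norm, hence the exponent [2 * a] on second moments. *)
Definition L2O a f := (forall g, l2 (f g)) /\
  exists K : R, 0 <= K /\ forall g, RE (fun w => sqm (f g w)) <= K * se g ^+ (2 * a).

(** The admissible weights: known at the start of the step, as [sp_orth] requires, and bounded
    uniformly over all steps. *)
Definition bdd f := (forall g, gmeas (F (ss g)) (f g)) /\
  exists K : R, 0 <= K /\ forall g w, nm (f g w) <= K.

Lemma se_ge0 g : 0 <= se g. Proof. by rewrite ltW// se_gt0. Qed.

(** The common bound [L] on the step sizes is what allows an order to be lowered. *)
Lemma se_exp_le g n m : (m <= n)%N -> se g ^+ n <= L ^+ (n - m) * se g ^+ m.
Proof.
move=> mn; rewrite -{1}(subnK mn) exprD ler_wpM2r ?exprn_ge0 ?se_ge0//.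
by apply: lerXn2r; rewrite ?nnegrE ?se_ge0//; exact: se_le.
Qed.

Lemma bigO_ext n z z' : (forall g, z g = z' g) -> bigO n z -> bigO n z'.
Proof. by move=> /funext ->. Qed.

Lemma bigO_le n m z : (m <= n)%N -> bigO n z -> bigO m z.
Proof.
move=> mn [K [K0 h]]; exists (K * L ^+ (n - m)); split; first by rewrite mulr_ge0 ?exprn_ge0.
by move=> g; apply: (le_trans (h g)); rewrite -mulrA ler_wpM2l// se_exp_le.
Qed.

Lemma bigO0 n : bigO n (fun=> 0).
Proof. by exists 0; split => // g; rewrite nm0 mul0r. Qed.

Lemma bigOD n z z' : bigO n z -> bigO n z' -> bigO n (fun g => z g + z' g).
Proof.
move=> [K [K0 h]] [K' [K'0 h']]; exists (K + K'); split; first exact: addr_ge0.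
by move=> g; apply: le_trans (nmD _ _) _; rewrite mulrDl lerD.
Qed.

Lemma bigON n z : bigO n z -> bigO n (fun g => - z g).
Proof. by move=> [K [K0 h]]; exists K; split => // g; rewrite nmN. Qed.

Lemma bigOB n z z' : bigO n z -> bigO n z' -> bigO n (fun g => z g - z' g).
Proof. by move=> ? ?; apply: bigOD => //; exact: bigON. Qed.

Lemma bigOZ n (c : R[i]) z : bigO n z -> bigO n (fun g => c * z g).
Proof.
move=> [K [K0 h]]; exists (nm c * K); split; first by rewrite mulr_ge0 ?nm_ge0.
by move=> g; rewrite nmM -mulrA ler_wpM2l ?nm_ge0.
Qed.

Lemma bigOJ n z : bigO n z -> bigO n (fun g => (z g)^*).
Proof. by move=> [K [K0 h]]; exists K; split => // g; rewrite nmJ. Qed.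

Lemma bigO_sum n (I : Type) (r : seq I) (z : I -> sde_step -> R[i]) :
  (forall i, bigO n (z i)) -> bigO n (fun g => \sum_(i <- r) z i g).
Proof.
move=> hz; elim: r => [|i r IH].
  by apply: bigO_ext (bigO0 n) => g; rewrite big_nil.
by apply: bigO_ext (bigOD (hz i) IH) => g; rewrite big_cons.
Qed.

Lemma L2O_ext a f h : (forall g w, f g w = h g w) -> L2O a f -> L2O a h.
Proof. by move=> e; rewrite (_ : f = h)//; apply/funext => g; apply/funext => w. Qed.

Lemma L2O_l2 a f : L2O a f -> forall g, l2 (f g). Proof. by case. Qed.

Lemma L2O_le a b f : (b <= a)%N -> L2O a f -> L2O b f.
Proof.
move=> ba [l [K [K0 h]]]; split => //; exists (K * L ^+ (2 * a - 2 * b)).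
split; first by rewrite mulr_ge0 ?exprn_ge0.
by move=> g; apply: (le_trans (h g)); rewrite -mulrA ler_wpM2l// se_exp_le// leq_mul2l.
Qed.

Lemma L2OD a f h : L2O a f -> L2O a h -> L2O a (fun g w => f g w + h g w).
Proof.
move=> [lf [K [K0 hf]]] [lh [K' [K'0 hh]]]; split; first by move=> g; exact: l2D.
exists (2 * K + 2 * K'); split; first by rewrite addr_ge0// mulr_ge0.
move=> g; have i1 := l2_int (lf g); have i2 := l2_int (lh g).
apply: (@le_trans _ _ (RE (fun w => 2 * sqm (f g w) + 2 * sqm (h g w)))).
  apply: RE_le; [by apply: l2_int; exact: l2D|exact: (rintD (rintZ 2 i1) (rintZ 2 i2))|].
  by move=> w; exact: sqmD.
rewrite (RED (rintZ 2 i1) (rintZ 2 i2)) (REZ 2 i1) (REZ 2 i2).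
by have := hf g; have := hh g; lra.
Qed.

Lemma L2OZ a (c : R[i]) f : L2O a f -> L2O a (fun g w => c * f g w).
Proof.
move=> [lf [K [K0 hf]]]; split; first by move=> g; exact: l2Z.
exists (sqm c * K); split; first by rewrite mulr_ge0 ?sqm_ge0.
move=> g; under eq_RE do rewrite sqmM.
by rewrite (REZ _ (l2_int (lf g))) -mulrA ler_wpM2l ?sqm_ge0.
Qed.

Lemma L2ON a f : L2O a f -> L2O a (fun g w => - f g w).
Proof. by move=> h; apply: L2O_ext (L2OZ (-1) h) => g w; rewrite mulN1r. Qed.

Lemma L2OJ a f : L2O a f -> L2O a (fun g w => (f g w)^*).
Proof.
move=> [lf [K [K0 hf]]]; split; first by move=> g; exact: l2J.
by exists K; split => // g; under eq_RE do rewrite sqmJ.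
Qed.

Lemma L2O_sum a (I : Type) (r : seq I) (f : I -> sde_step -> T -> R[i]) :
  (forall i, L2O a (f i)) -> L2O a (fun g w => \sum_(i <- r) f i g w).
Proof.
move=> hf; elim: r => [|i r IH].
  apply: (@L2O_ext _ (fun _ _ => 0)); first by move=> g w; rewrite big_nil.
  split; first by move=> g; exact: l2_cst.
  by exists 0; split => // g; rewrite mul0r; under eq_RE do rewrite sqm0; rewrite RE_cst.
by apply: L2O_ext (L2OD (hf i) IH) => g w; rewrite big_cons.
Qed.

Lemma L2O_bM a f h (K : R) : (forall g, cmeas (h g)) -> (forall g w, nm (h g w) <= K) ->
  L2O a f -> L2O a (fun g w => h g w * f g w).
Proof.
move=> mh hK [lf [K' [K'0 hf]]]; split; first by move=> g; exact: (l2_bndM (mh g) (hK g)).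
exists (K ^+ 2 * K'); split; first by rewrite mulr_ge0 ?sqr_ge0.
move=> g; rewrite -mulrA; apply: (@le_trans _ _ (RE (fun w => K ^+ 2 * sqm (f g w)))).
  apply: RE_le; [by apply: l2_int; exact: (l2_bndM (mh g) (hK g))|exact: rintZ (l2_int (lf g))|].
  move=> w; rewrite sqmM ler_wpM2r ?sqm_ge0// -nm_sqr ler_pXn2r ?nnegrE ?nm_ge0//.
  exact: le_trans (nm_ge0 _) (hK g w).
by rewrite (REZ _ (l2_int (lf g))) ler_wpM2l ?sqr_ge0.
Qed.

Lemma bdd_meas f g : bdd f -> cmeas (f g).
Proof. by move=> [m _]; exact: (F_meas hF (ss_ge0 g)). Qed.

Lemma L2O_bddM a f h : bdd h -> L2O a f -> L2O a (fun g w => h g w * f g w).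
Proof.
move=> bh; have [_ [K [_ hK]]] := bh; apply: (@L2O_bM _ _ _ K) => // g.
exact: bdd_meas.
Qed.

Lemma L2O_bdd f : bdd f -> L2O 0 f.
Proof.
move=> bf; have [_ [K [K0 hK]]] := bf; split.
  by move=> g; exact: (l2_bnd P (bdd_meas g bf) (hK g)).
exists (K ^+ 2); split; first exact: sqr_ge0.
move=> g; rewrite muln0 expr0 mulr1 -[leRHS](RE_cst P); apply: RE_le.
- by apply: l2_int; exact: (l2_bnd P (bdd_meas g bf) (hK g)).
- exact: rint_cst.
- by move=> w; rewrite -nm_sqr ler_pXn2r ?nnegrE ?nm_ge0.
Qed.

Lemma bddM f h : bdd f -> bdd h -> bdd (fun g w => f g w * h g w).
Proof.
move=> [mf [K [K0 hK]]] [mh [K' [K'0 hK']]]; split; first by move=> g; exact: cmeasM (mf g) (mh g).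
exists (K * K'); split; first exact: mulr_ge0.
by move=> g w; rewrite nmM ler_pM ?nm_ge0.
Qed.

Lemma bddJ f : bdd f -> bdd (fun g w => (f g w)^*).
Proof.
move=> [mf [K [K0 hK]]]; split; first by move=> g; exact: cmeasJ (mf g).
by exists K; split => // g w; rewrite nmJ.
Qed.

(** Orders add up, as with Cauchy-Schwarz: the weight [se ^ b / se ^ a] gives both terms of
    [CEM_amgm] the order [a + b]. *)
Lemma bigO_CEM a b f h : L2O a f -> L2O b h -> bigO (a + b) (fun g => CE (fun w => f g w * h g w)).
Proof.
move=> [lf [K [K0 hf]]] [lh [K' [K'0 hh]]]; exists (K + K'); split; first exact: addr_ge0.
move=> g; have e0 := se_gt0 g.
have ep0 : 0 < se g ^+ b / se g ^+ a by rewrite divr_gt0// exprn_gt0.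
apply: (le_trans (CEM_amgm ep0 (lf g) (lh g))); rewrite mulrDl; apply: lerD.
  apply: (@le_trans _ _ (se g ^+ b / se g ^+ a * (K * se g ^+ (2 * a)))).
    by rewrite ler_wpM2l// ltW.
  rewrite le_eqVlt; apply/orP; left; apply/eqP; rewrite mulnC exprM exprD; field.
  by rewrite expf_neq0// gt_eqF.
apply: (@le_trans _ _ ((se g ^+ b / se g ^+ a)^-1 * (K' * se g ^+ (2 * b)))).
  by rewrite ler_wpM2l// invr_ge0 ltW.
rewrite le_eqVlt; apply/orP; left; apply/eqP; rewrite mulnC exprM exprD; field.
by rewrite !expf_neq0// gt_eqF.
Qed.

Lemma bigO_RE_le n (f h : sde_step -> T -> R) (K : R) : (forall g, rint (f g)) -> (forall g, rint (h g)) ->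
  0 <= K -> (forall g w, `|f g w| <= K * h g w) ->
  bigO n (fun g => (RE (h g))%:C) -> bigO n (fun g => (RE (f g))%:C).
Proof.
move=> rf rh K0 fh [M [M0 hM]]; exists (K * M); split; first exact: mulr_ge0.
move=> g; rewrite nmC; apply: (le_trans (RE_norm (rf g))).
apply: (@le_trans _ _ (RE (fun w => K * h g w))).
  by apply: RE_le; [exact: rint_norm|exact: rintZ|exact: fh].
rewrite (REZ _ (rh g)) -mulrA ler_wpM2l//.
by apply: le_trans (hM g); rewrite nmC ler_norm.
Qed.

Lemma bigO_CE_le n (f : sde_step -> T -> R[i]) (h : sde_step -> T -> R) (K : R) :
  (forall g, cmeas (f g)) -> (forall g, rint (h g)) ->
  0 <= K -> (forall g w, nm (f g w) <= K * h g w) ->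
  bigO n (fun g => (RE (h g))%:C) -> bigO n (fun g => CE (f g)).
Proof.
move=> mf rh K0 fh [M [M0 hM]]; exists (2 * (K * M)); split; first by rewrite !mulr_ge0.
move=> g; have rK : rint (fun w => K * h g w) by exact: rintZ.
have cf : cint (f g) by exact: cint_le (mf g) (fh g) rK.
apply: (le_trans (CE_le cf rK (fh g))).
rewrite (REZ _ (rh g)) -!mulrA ler_wpM2l// ler_wpM2l//.
by apply: le_trans (hM g); rewrite nmC ler_norm.
Qed.

(** [sa] is the noise, of order 1, [sr] the remainder, of order 2, and [sv] the whole increment of
    the column. *)
Definition sa g j w := noise (ss g) (st g) (sx g) j w.
Definition sr g j w := 'i * sp g j w - ((st g - ss g) / 2)%:C * sx g j w + sq g j w.
Definition sv g j w := sa g j w + sr g j w.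

Lemma sy_sv g j w : sy g j w = sx g j w + sv g j w.
Proof. by rewrite sy_eq /sv /sa /sr; ring. Qed.

Lemma sx_L2O j : L2O 0 (fun g => sx g j).
Proof.
split; first by move=> g; exact: sx_l2.
by exists C; split => // g; rewrite muln0 expr0 mulr1 sx_bnd.
Qed.

Lemma sp_L2O j : L2O 2 (fun g => sp g j).
Proof. by split; [move=> g; exact: sp_l2|exists C; split => // g; exact: sp_bnd]. Qed.

Lemma sq_L2O j : L2O 3 (fun g => sq g j).
Proof. by split; [move=> g; exact: sq_l2|exists C; split => // g; exact: sq_bnd]. Qed.

Lemma sa_L2O j : L2O 1 (fun g => sa g j).
Proof.
apply: L2OZ; have h g := RE_noise N0 hH hF j (ss_ge0 g) (ss_le g) (@sx_gmeas _ _ _ g) (@sx_l2 _ _ _ g).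
split; first by move=> g; case: (h g).
exists (N%:R * C); split; first exact: mulr_ge0.
move=> g; have [_ b] := h g; apply: (le_trans b).
rewrite -se_sqr mulrC ler_wpM2r ?sqr_ge0//.
rewrite mulr_natl -[X in C *+ X](card_ord N) -sumr_const.
by apply: ler_sum => k _; exact: sx_bnd.
Qed.

Lemma drift_L2O j : L2O 2 (fun g w => ((st g - ss g) / 2)%:C * sx g j w).
Proof.
split; first by move=> g; apply: l2Z; exact: sx_l2.
exists C; split => // g; under eq_RE do rewrite sqmM sqmC.
rewrite (REZ _ (l2_int (sx_l2 g j))) -se_sqr mulrC ler_pM//.
- by apply: RE_ge0 => w; exact: sqm_ge0.
- exact: sqr_ge0.
- exact: sx_bnd.
- rewrite -[in leRHS]/(se g ^+ (2 * 2)) exprM ler_pXn2r ?nnegrE ?divr_ge0 ?sqr_ge0//.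
  have := sqr_ge0 (se g); lra.
Qed.

Lemma sr_L2O j : L2O 2 (fun g => sr g j).
Proof.
apply: L2OD; last by apply: (@L2O_le 3) => //; exact: sq_L2O.
by apply: L2OD; [apply: L2OZ; exact: sp_L2O|apply: L2ON; exact: drift_L2O].
Qed.

Lemma sv_L2O j : L2O 1 (fun g => sv g j).
Proof. by apply: L2OD; [exact: sa_L2O|apply: (@L2O_le 2) => //; exact: sr_L2O]. Qed.

Definition incr_sq g w : R := \sum_j \sum_k sqm (incr H (ss g) (st g) j k w).

(** The bound on the fourth moments of the increments of [H] is used here. *)
Lemma incr_sq_L2O : L2O 2 (fun g w => (incr_sq g w)%:C).
Proof.
apply: (@L2O_ext _ (fun g w => \sum_j \sum_k (sqm (incr H (ss g) (st g) j k w))%:C)).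
  move=> g w; rewrite /incr_sq [RHS]raddf_sum /=; apply: eq_bigr => j _.
  by rewrite raddf_sum.
apply: L2O_sum => j; apply: L2O_sum => k.
have h g := incr_pow4 N0 hH (ss_ge0 g) (ss_le g) j k.
split.
  move=> g; split; last by under eq_fun do rewrite sqmC; case: (h g).
  by apply: cmeasC; apply: cmeas_sqm; exact: (incr_meas N0 hH (ss_ge0 g) (ss_le g)).
exists (4 * kurtosis_bound R); split; first by rewrite mulr_ge0 ?kurtosis_bound_ge0.
move=> g; under eq_RE do rewrite sqmC; case: (h g) => _; rewrite -se_sqr.
by rewrite -exprM.
Qed.

Lemma sa_shh g w j : sqm (sa g j w) <= N%:R * (incr_sq g w * \sum_k sqm (sx g k w)).
Proof.
rewrite /sa /noise sqmi; apply: (le_trans (sqm_sum _)); rewrite ler_wpM2l// mulr_sumr.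
apply: ler_sum => k _; rewrite sqmM ler_wpM2r ?sqm_ge0//.
rewrite /incr_sq (bigD1 j)//= (bigD1 k)//= -addrA lerDl addr_ge0//.
  by apply: sumr_ge0 => ? _; exact: sqm_ge0.
by apply: sumr_ge0 => ? _; apply: sumr_ge0 => ? _; exact: sqm_ge0.
Qed.

Definition rho g w : R := \sum_k sqm (sx g k w).

Section core.
Variable f : sde_step -> T -> R[i].
Hypothesis bf : bdd f.

Let fx_gm g k : gmeas (F (ss g)) (fun w => f g w * sx g k w).
Proof. by have [m _] := bf; apply: cmeasM; [exact: m|exact: sx_gmeas]. Qed.

Let fx_l2 g k : l2 (fun w => f g w * sx g k w).
Proof. by apply: (L2O_l2 (L2O_bddM bf (sx_L2O k))). Qed.

Lemma CE_f_sa g j : CE (fun w => f g w * sa g j w) = 0.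
Proof.
transitivity (CE (fun w => 'i * \sum_k ((f g w * sx g k w) * incr H (ss g) (st g) j k w))).
  apply: eq_CE => w; rewrite /sa /noise mulrCA; congr (_ * _); rewrite mulr_sumr.
  by apply: eq_bigr => k _; ring.
have ci k : cint (fun w => (f g w * sx g k w) * incr H (ss g) (st g) j k w).
  apply: (cint_incr_ind N0 hH hF (ss_ge0 g) (ss_le g)) => //; exact: l2_cint.
rewrite CEZ; last exact: cint_sum.
rewrite CE_sum// big1 ?mulr0// => k _.
by apply: (CE_incr_ind N0 hH hF (ss_ge0 g) (ss_le g)) => //; exact: l2_cint.
Qed.

Let f2_gm g k l : gmeas (F (ss g)) (fun w => f g w * sx g k w * sx g l w).
Proof. by apply: cmeasM; [exact: fx_gm|exact: sx_gmeas]. Qed.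

Let f2J_gm g k l : gmeas (F (ss g)) (fun w => f g w * sx g k w * (sx g l w)^*).
Proof. by apply: cmeasM; [exact: fx_gm|apply: cmeasJ; exact: sx_gmeas]. Qed.

(** The covariance of two entries forces [l = k] and [m = j], so the two components of the state
    come back exchanged; the sign is that of ['i ^ 2]. *)
Lemma CE_f_saa g j k : CE (fun w => f g w * (sa g j w * sa g k w)) =
  - ((st g - ss g) / N%:R)%:C * CE (fun w => f g w * (sx g j w * sx g k w)).
Proof.
pose c l m w := (f g w * sx g l w * sx g m w) *
  (incr H (ss g) (st g) j l w * incr H (ss g) (st g) k m w).
transitivity (CE (fun w => -1 * \sum_l \sum_m c l m w)).
  apply: eq_CE => w; have e (x A B : R[i]) : x * ('i * A * ('i * B)) = -1 * (x * (A * B)).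
    by transitivity ('i ^+ 2 * (x * (A * B))); [ring|rewrite sqr_i].
  rewrite /sa /noise e; congr (_ * _); rewrite mulr_suml mulr_sumr; apply: eq_bigr => l _.
  by rewrite mulr_sumr mulr_sumr; apply: eq_bigr => m _; rewrite /c; ring.
have cc l m : cint (fun w => f g w * sx g l w * sx g m w).
  by apply: l2_cintM => //; exact: sx_l2.
have ci l m : cint (c l m) by apply: (cint_incr2_ind N0 hH hF (ss_ge0 g) (ss_le g)).
rewrite CEZ; last by apply: cint_sum => l; exact: cint_sum.
rewrite CE_sum; last by move=> l; exact: cint_sum.
rewrite mulN1r mulNr; congr (- _).
rewrite (bigD1 k)//= [X in _ + X]big1 ?addr0; last first.
  move=> l lk; rewrite CE_sum// big1// => m _.
  by rewrite /c (CE_incr2_ind N0 hH hF (ss_ge0 g) (ss_le g))// (negPf lk) andbF mulr0 mul0r.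
rewrite CE_sum// (bigD1 j)//= [X in _ + X]big1 ?addr0; last first.
  move=> m mj; rewrite /c (CE_incr2_ind N0 hH hF (ss_ge0 g) (ss_le g))//.
  by rewrite eq_sym (negPf mj) /= mulr0 mul0r.
rewrite /c (CE_incr2_ind N0 hH hF (ss_ge0 g) (ss_le g))// !eqxx mulr1.
by congr (_ * _); apply: eq_CE => w; ring.
Qed.

(** Conjugation transposes the second increment, so the covariance now forces [l = m] and [j = k]:
    the sum over [l] yields the whole of [|x|^2]. *)
Lemma CE_f_saJ g j k : CE (fun w => f g w * (sa g j w * (sa g k w)^*)) =
  ((st g - ss g) / N%:R * (j == k)%:R)%:C * CE (fun w => f g w * (rho g w)%:C).
Proof.
pose c l m w := (f g w * sx g l w * (sx g m w)^*) *
  (incr H (ss g) (st g) j l w * incr H (ss g) (st g) m k w).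
transitivity (CE (fun w => \sum_l \sum_m c l m w)).
  apply: eq_CE => w; have e (x A B : R[i]) : x * ('i * A * (- 'i * B)) = x * (A * B).
    by transitivity (- ('i ^+ 2) * (x * (A * B))); [ring|rewrite sqr_i; ring].
  rewrite /sa /noise cJM cJi e cJ_sum mulr_suml mulr_sumr; apply: eq_bigr => l _.
  rewrite mulr_sumr mulr_sumr; apply: eq_bigr => m _.
  rewrite cJM -(incr_herm hH (ss_ge0 g) (ss_le g)) /c; ring.
have cc l m : cint (fun w => f g w * sx g l w * (sx g m w)^*).
  by apply: l2_cintM => //; apply: l2J; exact: sx_l2.
have ci l m : cint (c l m) by apply: (cint_incr2_ind N0 hH hF (ss_ge0 g) (ss_le g)).
rewrite CE_sum; last by move=> l; exact: cint_sum.
transitivity (\sum_l ((st g - ss g) / N%:R * (j == k)%:R)%:C * CE (fun w => f g w * sx g l w * (sx g l w)^*)).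
  apply: eq_bigr => l _; rewrite CE_sum// (bigD1 l)//= [X in _ + X]big1 ?addr0; last first.
    move=> m ml; rewrite /c (CE_incr2_ind N0 hH hF (ss_ge0 g) (ss_le g))//.
    by rewrite [l == m]eq_sym (negPf ml) andbF mulr0 mul0r.
  by rewrite /c (CE_incr2_ind N0 hH hF (ss_ge0 g) (ss_le g))// eqxx andbT.
rewrite -mulr_sumr -CE_sum//; congr (_ * _); apply: eq_CE => w.
rewrite /rho [in RHS]raddf_sum mulr_sumr; apply: eq_bigr => l _.
by rewrite /= sqmE mulrA.
Qed.

(** Against a weight known at the start of the step, the noise and [sp] average to exactly 0; once
    the drift is compensated, only [sq] is left. *)
Lemma CE_sv_linear j : bigO 3 (fun g => CE (fun w => f g w * sv g j w)
  + ((st g - ss g) / 2)%:C * CE (fun w => f g w * sx g j w)).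
Proof.
have [_ [K [_ hK]]] := bf; have [m _] := bf.
apply: bigO_ext (bigO_CEM (L2O_bdd bf) (sq_L2O j)) => g.
have ls : l2 (sa g j) by apply: (L2O_l2 (sa_L2O j)).
have lp := sp_l2 g j; have lx := sx_l2 g j; have lq := sq_l2 g j.
have lf : l2 (f g) by apply: (L2O_l2 (L2O_bdd bf)).
have c1 := l2_cintM lf ls; have c2 := l2_cintM lf lp; have c3 := l2_cintM lf lx; have c4 := l2_cintM lf lq.
rewrite (@eq_CE _ _ _ P (fun w => f g w * sv g j w) (fun w =>
  f g w * sa g j w + 'i * (f g w * sp g j w) - ((st g - ss g) / 2)%:C * (f g w * sx g j w) + f g w * sq g j w)); last first.
  by move=> w; rewrite /sv /sr; ring.
have d1 := cintD c1 (cintZ 'i c2); have d2 := cintB d1 (cintZ ((st g - ss g) / 2)%:C c3).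
rewrite (CED d2 c4) (CEB d1 (cintZ _ c3)) (CED c1 (cintZ _ c2)) (CEZ _ c2) (CEZ _ c3).
by rewrite CE_f_sa (sp_orth _ (m g) (hK g)); ring.
Qed.

(** Noise against noise is computed exactly; noise against remainder has order 1 + 2, remainder
    against remainder order 2 + 2. *)
Lemma CE_sv_quadratic j k : bigO 3 (fun g => CE (fun w => f g w * (sv g j w * sv g k w))
  + ((st g - ss g) / N%:R)%:C * CE (fun w => f g w * (sx g j w * sx g k w))).
Proof.
have ha l := L2O_bddM bf (sa_L2O l); have hr l := L2O_bddM bf (sr_L2O l).
have o1 := bigO_CEM (ha j) (sr_L2O k).
have o2 := bigO_CEM (ha k) (sr_L2O j).
have o3 := @bigO_le (2 + 2) 3 _ isT (bigO_CEM (hr j) (sr_L2O k)).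
apply: bigO_ext (bigOD (bigOD o1 o2) o3) => g.
have c1 := l2_cintM (L2O_l2 (ha j) g) (L2O_l2 (sr_L2O k) g).
have c2 := l2_cintM (L2O_l2 (ha k) g) (L2O_l2 (sr_L2O j) g).
have c3 := l2_cintM (L2O_l2 (hr j) g) (L2O_l2 (sr_L2O k) g).
have c0 := l2_cintM (L2O_l2 (ha j) g) (L2O_l2 (sa_L2O k) g).
rewrite (@eq_CE _ _ _ P (fun w => f g w * (sv g j w * sv g k w)) (fun w =>
  f g w * sa g j w * sa g k w + (f g w * sa g j w * sr g k w + f g w * sa g k w * sr g j w + f g w * sr g j w * sr g k w))); last first.
  by move=> w; rewrite /sv; ring.
rewrite (CED c0 (cintD (cintD c1 c2) c3)) (CED (cintD c1 c2) c3) (CED c1 c2).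
rewrite (@eq_CE _ _ _ P (fun w => f g w * sa g j w * sa g k w) (fun w => f g w * (sa g j w * sa g k w))); last first.
  by move=> w; rewrite mulrA.
by rewrite CE_f_saa; ring.
Qed.

Lemma CE_sv_quadraticJ j k : bigO 3 (fun g => CE (fun w => f g w * (sv g j w * (sv g k w)^*))
  - ((st g - ss g) / N%:R * (j == k)%:R)%:C * CE (fun w => f g w * (rho g w)%:C)).
Proof.
have ha l := L2O_bddM bf (sa_L2O l); have hr l := L2O_bddM bf (sr_L2O l).
have haJ l := L2O_bddM bf (L2OJ (sa_L2O l)).
have o1 := bigO_CEM (ha j) (L2OJ (sr_L2O k)).
have o2 := bigO_CEM (haJ k) (sr_L2O j).
have o3 := @bigO_le (2 + 2) 3 _ isT (bigO_CEM (hr j) (L2OJ (sr_L2O k))).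
apply: bigO_ext (bigOD (bigOD o1 o2) o3) => g.
have c1 := l2_cintM (L2O_l2 (ha j) g) (L2O_l2 (L2OJ (sr_L2O k)) g).
have c2 := l2_cintM (L2O_l2 (haJ k) g) (L2O_l2 (sr_L2O j) g).
have c3 := l2_cintM (L2O_l2 (hr j) g) (L2O_l2 (L2OJ (sr_L2O k)) g).
have c0 := l2_cintM (L2O_l2 (ha j) g) (L2O_l2 (L2OJ (sa_L2O k)) g).
rewrite (@eq_CE _ _ _ P (fun w => f g w * (sv g j w * (sv g k w)^*)) (fun w =>
  f g w * sa g j w * (sa g k w)^* + (f g w * sa g j w * (sr g k w)^* + f g w * (sa g k w)^* * sr g j w + f g w * sr g j w * (sr g k w)^*))); last first.
  by move=> w; rewrite /sv cJD; ring.
rewrite (CED c0 (cintD (cintD c1 c2) c3)) (CED (cintD c1 c2) c3) (CED c1 c2).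
rewrite (@eq_CE _ _ _ P (fun w => f g w * sa g j w * (sa g k w)^*) (fun w => f g w * (sa g j w * (sa g k w)^*))); last first.
  by move=> w; rewrite mulrA.
by rewrite CE_f_saJ; ring.
Qed.

End core.
End calculus.
End expansion.

(** On nonnegative reals the inverse is the power [-1], also at 0, where both are 0. *)
Lemma measurable_inv_ge0 d (T : measurableType d) (R : realType) (f : T -> R) :
  measurable_fun setT f -> (forall w, 0 <= f w) -> measurable_fun setT (fun w => (f w)^-1).
Proof.
move=> mf f0; apply: (eq_measurable_fun (fun w => f w `^ (-1))).
  by move=> w _; rewrite powR_inv1.
exact: measurableT_comp (measurable_powR _) mf.
Qed.

(* With x = |x_s|^2, y = |x_t|^2 and y - x = B + vv, both B and vv are of second order: the
   first order part of y - x vanishes, whence a third order bound. *)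
Lemma resolvent_remainder_le (R : realFieldType) (n a x y hh vv rr B e : R) : 0 <= n -> 1 <= a ->
  0 <= x -> 0 <= y -> 0 <= hh -> 0 <= vv -> 0 <= rr -> 0 < e ->
  B ^+ 2 <= 4 * n * (x * rr) -> vv <= 2 * n ^+ 2 * (hh * x) + 2 * rr -> vv <= 2 * (x + y) ->
  ((a + x) ^+ 2)^-1 * ((B + vv) ^+ 2 / (a + y)) <=
  (8 * n ^+ 2 + 8 * n + 16) * (e^-1 * hh ^+ 2 + e * vv + rr).
Proof.
move=> n0 a1 x0 y0 hh0 vv0 rr0 e0 hB hv1 hv2.
have ax : 1 <= a + x by lra.
have ay : 1 <= a + y by lra.
pose D := (a + x) ^+ 2 * (a + y).
have D1 : (a + x) ^+ 2 <= D by rewrite /D ler_peMr ?sqr_ge0.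
have q1 : a + x <= (a + x) ^+ 2 by rewrite expr2 ler_peMr//; lra.
have q2 : 1 * (a + y) <= D by rewrite /D ler_wpM2r//; lra.
have xD : x <= D by lra.
have yD : y <= D by lra.
have D0 : 0 < D by lra.
have xx : x * x <= D by apply: le_trans D1; rewrite -expr2 lerXn2r ?nnegrE//; lra.
have xy : x * y <= D.
  by rewrite /D ler_pM//; lra.
rewrite (_ : ((a + x) ^+ 2)^-1 * _ = (B + vv) ^+ 2 / D); last first.
  rewrite /D; field; apply/andP; split; apply/eqP => h; move: ax ay; rewrite h; lra.
rewrite ler_pdivrMr//.
(* The delicate term is [hh * w]: from [w <= vv] and [w <= 4] follows [w^2 <= 4 vv], which lets it
   be split into [hh^2 / e] and [e vv]. *)
pose w := vv * x / D.
have wvv : w <= vv by rewrite /w ler_pdivrMr// ler_wpM2l.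
have w0 : 0 <= w by apply: divr_ge0; [exact: mulr_ge0|exact: ltW].
have w4 : w <= 4.
  rewrite /w ler_pdivrMr//; apply: (@le_trans _ _ (2 * (x + y) * x)); first by rewrite ler_wpM2r.
  by nra.
have ww : w * w <= 4 * vv by rewrite ler_pM.
have hw : 2 * (hh * w) <= e^-1 * hh ^+ 2 + 4 * (e * vv).
  have : 0 <= e^-1 * (hh - e * w) ^+ 2 by rewrite mulr_ge0 ?sqr_ge0 ?invr_ge0// ltW.
  rewrite (_ : e^-1 * _ = e^-1 * hh ^+ 2 - 2 * (hh * w) + e * (w * w)); last first.
    by field; rewrite gt_eqF.
  have : e * (w * w) <= e * (4 * vv) by rewrite ler_pM2l.
  lra.
have b1 : (B + vv) ^+ 2 <= 2 * B ^+ 2 + 2 * (vv * vv).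
  by have := sqr_ge0 (B - vv); nra.
have b2 : vv * vv <= 2 * n ^+ 2 * (hh * (w * D)) + 4 * D * (2 * rr).
  rewrite (_ : w * D = vv * x); last by rewrite /w divfK// gt_eqF.
  apply: (@le_trans _ _ (vv * (2 * n ^+ 2 * (hh * x) + 2 * rr))); first by rewrite ler_wpM2l.
  rewrite mulrDr lerD//; first by rewrite le_eqVlt; apply/orP; left; apply/eqP; ring.
  by apply: ler_wpM2r; lra.
have b3 : n * (x * rr) <= n * (D * rr) by rewrite ler_wpM2l// ler_wpM2r.
have b4 : n ^+ 2 * D * (2 * (hh * w)) <= n ^+ 2 * D * (e^-1 * hh ^+ 2 + 4 * (e * vv)).
  by rewrite ler_wpM2l// mulr_ge0 ?sqr_ge0// ltW.
have z0 : 0 <= n ^+ 2 * D by rewrite mulr_ge0 ?sqr_ge0// ltW.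
have z1 : 0 <= n * D by rewrite mulr_ge0// ltW.
have h0 : 0 <= e^-1 * hh ^+ 2 by rewrite mulr_ge0 ?sqr_ge0 ?invr_ge0// ltW.
have h1 : 0 <= e * vv by rewrite mulr_ge0// ltW.
have k1 := mulr_ge0 z0 h0; have k2 := mulr_ge0 z0 h1; have k3 := mulr_ge0 z0 rr0.
have k4 := mulr_ge0 z1 h0; have k5 := mulr_ge0 z1 h1; have k6 := mulr_ge0 z1 rr0.
have k7 := mulr_ge0 (ltW D0) h0; have k8 := mulr_ge0 (ltW D0) h1; have k9 := mulr_ge0 (ltW D0) rr0.
nra.
Qed.

Section third_order.
Context (R : realType) d (T : measurableType d) (P : probability T R) (N : nat).
Variables (N0 : (0 < N)%N) (F : R -> set (set T)) (H : R -> T -> 'M[R[i]]_N).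
Hypotheses (hH : hermitian_brownian_motion P H) (hF : brownian_filtration P F H).
Variables (Adm : set ('I_N -> R[i])) (C L : R).
Hypotheses (C0 : 0 <= C) (L0 : 0 <= L).
Local Notation rint := (rint P).
Local Notation RE := (RE P).
Local Notation CE := (CE P).
Local Notation cint := (cint P).
Local Notation l2 := (l2 P).
Local Notation sde_step := (sde_step P F H Adm C L).
Implicit Types (j k : 'I_N) (g : sde_step) (f h : sde_step -> T -> R[i]) (n a b : nat).

Lemma bigO_RED n (f h : sde_step -> T -> R) : (forall g, rint (f g)) -> (forall g, rint (h g)) ->
  bigO n (fun g => (RE (f g))%:C) -> bigO n (fun g => (RE (h g))%:C) ->
  bigO n (fun g => (RE (fun w => f g w + h g w))%:C).
Proof.
move=> rf rh of_ oh; apply: bigO_ext (bigOD of_ oh) => g.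
by rewrite (RED (rf g) (rh g)) -raddfD.
Qed.

Lemma L2O_RE a f : L2O a f -> bigO (2 * a) (fun g => (RE (fun w => sqm (f g w)))%:C).
Proof.
move=> [lf [K [K0 hK]]]; exists K; split => // g; rewrite nmC ger0_norm//.
by apply: RE_ge0 => w; exact: sqm_ge0.
Qed.

(* A bound for third order remainders: [hh |v| <= hh^2 / e + e |v|^2] for the
   squared size [hh] of the increment. *)
Definition cubic_bound g w : R := (se g)^-1 * incr_sq g w ^+ 2 + se g * (\sum_j sqm (sv g j w))
  + \sum_j sqm (sr g j w).


Let lhh := incr_sq_L2O N0 F hH Adm C L.
Let lsx := sx_L2O P F H Adm L C0.
Let lsv := sv_L2O N0 hH hF Adm C0 L0.
Let lsr := sr_L2O P F H Adm C0 L0.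

Lemma bigO_sum_sqm a (f : 'I_N -> sde_step -> T -> R[i]) : (forall j, L2O a (f j)) ->
  bigO (2 * a) (fun g => (RE (fun w => \sum_j sqm (f j g w)))%:C).
Proof.
move=> lf; apply: bigO_ext (bigO_sum _ (fun j => L2O_RE (lf j))) => g.
rewrite RE_sum ?raddf_sum// => j; exact: l2_int (L2O_l2 (lf j) g).
Qed.

Lemma cubic_bound_rint g : rint (cubic_bound g).
Proof.
apply: rintD; last by apply: rint_sum => j; exact: l2_int (L2O_l2 (lsr j) g).
apply: rintD; apply: rintZ; last by apply: rint_sum => j; exact: l2_int (L2O_l2 (lsv j) g).
by apply: eq_rint (l2_int (L2O_l2 lhh g)) => w; rewrite sqmC.
Qed.

(** The three terms have orders 4 - 1, 2 + 1 and 4. *)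
Lemma cubic_bound_bigO : bigO 3 (fun g => (RE (cubic_bound g))%:C).
Proof.
have r1 g : rint (fun w => incr_sq g w ^+ 2) by apply: eq_rint (l2_int (L2O_l2 lhh g)) => w; rewrite sqmC.
have r2 g : rint (fun w => \sum_j sqm (sv g j w)) by apply: rint_sum => j; exact: l2_int (L2O_l2 (lsv j) g).
have r3 g : rint (fun w => \sum_j sqm (sr g j w)) by apply: rint_sum => j; exact: l2_int (L2O_l2 (lsr j) g).
apply: bigO_RED => //; first by move=> g; exact: (rintD (rintZ _ (r1 g)) (rintZ _ (r2 g))).
  apply: bigO_RED => //; [by move=> g; exact: (rintZ _ (r1 g))|by move=> g; exact: (rintZ _ (r2 g))| |].
    have [K [K0 hK]] := L2O_RE lhh; exists K; split => // g.
    rewrite (REZ _ (r1 g)) nmC normrM gtr0_norm ?invr_gt0 ?se_gt0//.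
    rewrite ler_pdivrMl ?se_gt0// mulrCA -exprS -nmC; apply: le_trans (hK g).
    by under [in leRHS]eq_RE do rewrite sqmC.
  have [K [K0 hK]] := bigO_sum_sqm lsv; exists K; split => // g.
  rewrite (REZ _ (r2 g)) nmC normrM gtr0_norm ?se_gt0// exprS mulrCA.
  by rewrite ler_pM2l ?se_gt0// -nmC; exact: hK.
by apply: (@bigO_le _ _ _ _ _ _ _ _ _ _ L0 (2 * 2) 3) => //; exact: bigO_sum_sqm.
Qed.

Lemma sum_sqm_sv g w : \sum_j sqm (sv g j w) <=
  2 * N%:R ^+ 2 * (incr_sq g w * rho g w) + 2 * \sum_j sqm (sr g j w).
Proof.
rewrite [2 * \sum_j sqm (sr g j w)]mulr_sumr.
rewrite (_ : 2 * N%:R ^+ 2 * _ = \sum_(j < N) 2 * (N%:R * (incr_sq g w * rho g w))); last first.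
  by rewrite sumr_const card_ord -[RHS]mulr_natl; ring.
rewrite -big_split /=; apply: ler_sum => j _; apply: le_trans (sqmD _ _) _.
by rewrite lerD2r ler_wpM2l//; exact: sa_shh.
Qed.

Definition rho' g w : R := \sum_k sqm (sy g k w).

Lemma rho_ge0 g w : 0 <= rho g w. Proof. by apply: sumr_ge0 => k _; exact: sqm_ge0. Qed.
Lemma rho'_ge0 g w : 0 <= rho' g w. Proof. by apply: sumr_ge0 => k _; exact: sqm_ge0. Qed.
Lemma incr_sq_ge0 g w : 0 <= incr_sq g w.
Proof. by apply: sumr_ge0 => k _; apply: sumr_ge0 => l _; exact: sqm_ge0. Qed.

Lemma sqm_sy g j w : sqm (sy g j w) =
  sqm (sx g j w) + (2 * Re ((sx g j w)^* * sv g j w) + sqm (sv g j w)).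
Proof. by rewrite sy_sv /sqm cReM cReJ cImJ cReD cImD; ring. Qed.

(* The noise is tangent to the sphere, since the increments are Hermitian. *)
Lemma Re_sx_sa g w : \sum_j Re ((sx g j w)^* * sa g j w) = 0.
Proof.
rewrite -cRe_sum.
set S := \sum_j _; suff e : S^* = - S.
  by have := congr1 (@Re R) e; rewrite cReJ cReN => ?; lra.
rewrite /S cJ_sum.
transitivity (\sum_j \sum_k - 'i * ((sx g j w) * ((incr H (ss g) (st g) j k w)^* * (sx g k w)^*))).
  apply: eq_bigr => j _; rewrite cJM conjcK /sa /noise cJM cJi cJ_sum mulr_sumr mulr_sumr.
  by apply: eq_bigr => k _; rewrite cJM; ring.
rewrite exchange_big -sumrN; apply: eq_bigr => k _ /=.
rewrite /sa /noise mulr_sumr mulr_sumr -sumrN; apply: eq_bigr => j _.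
rewrite -(incr_herm hH (ss_ge0 g) (ss_le g)); ring.
Qed.

Section resolvent.
Variable a : R.
Hypothesis a1 : 1 <= a.

(** Minus the derivative of the resolvent [1 / (a + z)] at [z = rho g w]. *)
Definition res g w : R := ((a + rho g w) ^+ 2)^-1.
Definition del g w : R := rho' g w - rho g w.

Lemma del_sv g w : del g w = \sum_j (2 * Re ((sx g j w)^* * sv g j w) + sqm (sv g j w)).
Proof.
by rewrite /del /rho' (eq_bigr _ (fun j _ => sqm_sy g j w)) big_split /= /rho addrAC subrr add0r.
Qed.

Lemma a_rho g w : 1 <= a + rho g w. Proof. by rewrite -[1]addr0 lerD ?rho_ge0. Qed.
Lemma a_rho' g w : 1 <= a + rho' g w. Proof. by rewrite -[1]addr0 lerD ?rho'_ge0. Qed.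

(** An exact identity: for the resolvent, the Taylor remainder of second order is explicit. *)
Lemma res_expand g w : (a + rho' g w)^-1 - (a + rho g w)^-1 =
  - (res g w * del g w) + res g w * (del g w ^+ 2 / (a + rho' g w)).
Proof.
rewrite /res /del; have := a_rho g w; have := a_rho' g w.
move: (rho g w) (rho' g w) => x y hx hy; field.
by rewrite !gt_eqF//; lra.
Qed.

Lemma res_quad g w : `|res g w * (del g w ^+ 2 / (a + rho' g w))| <=
  (8 * N%:R ^+ 2 + 8 * N%:R + 16) * cubic_bound g w.
Proof.
have ax := a_rho g w; have ay := a_rho' g w.
rewrite ger0_norm; last first.
  by apply: mulr_ge0; [rewrite invr_ge0 sqr_ge0|apply: divr_ge0; [exact: sqr_ge0|lra]].
rewrite del_sv big_split /= /res.
apply: resolvent_remainder_le => //.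
- exact: rho_ge0.
- exact: rho'_ge0.
- exact: incr_sq_ge0.
- by apply: sumr_ge0 => j _; exact: sqm_ge0.
- by apply: sumr_ge0 => j _; exact: sqm_ge0.
- exact: se_gt0.
(* The noise being tangential, the first order term involves [sr] only; Cauchy-Schwarz then gives
   the bound [4 N |x|^2 |sr|^2]. *)
- rewrite (_ : \sum_j _ = \sum_j 2 * Re ((sx g j w)^* * sr g j w)); last first.
    rewrite -!mulr_sumr; congr (_ * _).
    transitivity (\sum_j Re ((sx g j w)^* * sa g j w) + \sum_j Re ((sx g j w)^* * sr g j w)); last first.
      by rewrite Re_sx_sa add0r.
    rewrite -big_split /=; apply: eq_bigr => j _.
    by rewrite /sv mulrDr cReD.
  rewrite -sqmC raddf_sum /=; apply: (le_trans (sqm_sum _)).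
  rewrite -mulrA mulrCA ler_wpM2l//.
  rewrite mulr_sumr mulr_sumr; apply: ler_sum => j _; rewrite sqmC exprMn.
  rewrite (_ : 2 ^+ 2 = 4 :> R); last by ring.
  rewrite ler_wpM2l//.
  apply: (@le_trans _ _ (sqm ((sx g j w)^* * sr g j w))); first by rewrite /sqm lerDl sqr_ge0.
  rewrite sqmM sqmJ ler_wpM2r ?sqm_ge0// /rho (bigD1 j)//= lerDl.
  by apply: sumr_ge0 => ? _; exact: sqm_ge0.
- exact: sum_sqm_sv.
- rewrite mulrDr /rho /rho' !mulr_sumr -big_split /=; apply: ler_sum => j _.
  have -> : sv g j w = sy g j w - sx g j w by rewrite sy_sv addrC addKr.
  by rewrite addrC; exact: sqmB.
Qed.

Lemma rho_gmeas g : @measurable_fun _ _ (g_sigma_algebraType (F (ss g))) R setT (rho g).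
Proof. by apply: measurable_sum => k; apply: cmeas_sqm; exact: sx_gmeas. Qed.

Lemma rho'_meas g : measurable_fun setT (rho' g).
Proof.
apply: measurable_sum => k; apply: cmeas_sqm.
have /funext -> : sy g k =1 (fun w => sx g k w + sv g k w) by move=> w; exact: sy_sv.
by apply: cmeasD; [exact: l2_meas (sx_l2 g k)|exact: l2_meas (L2O_l2 (lsv k) g)].
Qed.

Lemma res_bdd : bdd (fun g w => (res g w)%:C).
Proof.
split.
  move=> g; apply: cmeasC; apply: measurable_inv_ge0 => [|w]; last exact: sqr_ge0.
  by apply: measurable_funX; apply: measurable_funD => //; exact: rho_gmeas.
exists 1; split => // g w; have h := a_rho g w.
have q0 : 0 < (a + rho g w) ^+ 2 by apply: exprn_gt0; lra.
by rewrite nmC ger0_norm ?invr_ge0 ?(ltW q0)// invf_le1// exprn_ege1.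
Qed.

(** The column is not yet known to be bounded; the factor [res] makes it an admissible weight,
    because [|x_j| <= a + rho <= (a + rho)^2]. *)
Lemma res_sx_bdd j : bdd (fun g w => (res g w)%:C * (sx g j w)^*).
Proof.
split.
  move=> g; apply: cmeasM; [by have [m _] := res_bdd; exact: m|apply: cmeasJ; exact: sx_gmeas].
exists 1; split => // g w; have h := a_rho g w.
rewrite nmM nmC ger0_norm ?invr_ge0 ?sqr_ge0// nmJ ler_pdivrMl ?exprn_gt0//; last by lra.
rewrite mulr1; have q1 : a + rho g w <= (a + rho g w) ^+ 2 by rewrite expr2 ler_peMr//; lra.
apply: le_trans q1.
have : sqm (sx g j w) <= rho g w.
  by rewrite /rho (bigD1 j)//= lerDl; apply: sumr_ge0 => ? _; exact: sqm_ge0.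
rewrite -nm_sqr; move: (nm _) (rho g w) h a1 => x y h h1 h2; have := sqr_ge0 (x - 1); nra.
Qed.

(** Conservation of [|x|^2] at order [t - s]: the linear terms contribute [- (t - s) |x_j|^2] for
    each [j], and the quadratic ones [(t - s) / N * |x|^2] for each of the [N] values of [j]. *)
Lemma res_del_bigO : bigO 3 (fun g => CE (fun w => (res g w * del g w)%:C)).
Proof.
have o1 j := CE_sv_linear N0 hH hF C0 (res_sx_bdd j) j.
have o2 j := CE_sv_quadraticJ N0 hH hF C0 L0 res_bdd j j.
apply: bigO_ext (bigO_sum (index_enum (ordinal N)) (fun j => bigOD (bigOD (o1 j) (bigOJ (o1 j))) (o2 j))) => g.
have lf j : l2 (fun w => (res g w)%:C * (sx g j w)^*).
  exact: L2O_l2 (L2O_bdd hF (res_sx_bdd j)) g.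
have lr : l2 (fun w => (res g w)%:C) := L2O_l2 (L2O_bdd hF res_bdd) g.
have lrx j : l2 (fun w => (res g w)%:C * sx g j w) := L2O_l2 (L2O_bddM hF res_bdd (lsx j)) g.
have lrv j : l2 (fun w => (res g w)%:C * sv g j w) := L2O_l2 (L2O_bddM hF res_bdd (lsv j)) g.
have lv j : l2 (sv g j) := L2O_l2 (lsv j) g.
have c1 j := l2_cintM (lf j) (lv j).
have c2 j : cint (fun w => (res g w)%:C * (sv g j w * (sv g j w)^*)).
  by apply: eq_cint (l2_cintM (lrv j) (l2J (lv j))) => w; rewrite mulrA.
have c3 j := l2_cintM (lf j) (sx_l2 g j).
pose z j := CE (fun w => (res g w)%:C * (sx g j w)^* * sx g j w).
have zJ j : (z j)^* = z j.
  by rewrite /z -CEJ//; apply: eq_CE => w; rewrite !cJM conjcK cJC; ring.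
have zS : CE (fun w => (res g w)%:C * (rho g w)%:C) = \sum_j z j.
  rewrite -CE_sum//; apply: eq_CE => w; rewrite /rho raddf_sum mulr_sumr.
  by apply: eq_bigr => j _; rewrite /= sqmE; ring.
transitivity (\sum_j (CE (fun w => (res g w)%:C * (sx g j w)^* * sv g j w)
  + (CE (fun w => (res g w)%:C * (sx g j w)^* * sv g j w))^*
  + CE (fun w => (res g w)%:C * (sv g j w * (sv g j w)^*)))).
  rewrite zS; apply/eqP; rewrite -subr_eq0 -sumrB; apply/eqP.
  transitivity (\sum_j ((st g - ss g)%:C * z j - ((st g - ss g) / N%:R)%:C * \sum_k z k)).
    apply: eq_bigr => j _; rewrite -!/(z j) cJD cJM cJC zJ eqxx mulr1.
    rewrite (_ : (st g - ss g)%:C = ((st g - ss g) / 2)%:C + ((st g - ss g) / 2)%:C); first by ring.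
    by rewrite -raddfD /=; congr (_%:C); field.
  rewrite sumrB -mulr_sumr sumr_const card_ord -[X in _ - X]mulr_natl [X in _ - X]mulrA.
  rewrite (_ : N%:R * _ = (st g - ss g)%:C) ?subrr//.
  rewrite -(rmorph_nat (real_complex R)) -rmorphM /=; congr (_%:C); field.
  by rewrite pnatr_eq0 -lt0n.
rewrite -[RHS]/(CE (fun w => (res g w * del g w)%:C)).
transitivity (CE (fun w => \sum_j ((res g w)%:C * (sx g j w)^* * sv g j w
  + ((res g w)%:C * (sx g j w)^* * sv g j w)^*
  + (res g w)%:C * (sv g j w * (sv g j w)^*)))).
  rewrite CE_sum; last by move=> j; exact: (cintD (cintD (c1 j) (cintJ (c1 j))) (c2 j)).
  apply: eq_bigr => j _.
  by rewrite (CED (cintD (c1 j) (cintJ (c1 j))) (c2 j)) (CED (c1 j) (cintJ (c1 j))) (CEJ (c1 j)).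
apply: eq_CE => w; rewrite del_sv rmorphM /= rmorph_sum mulr_sumr; apply: eq_bigr => j _.
rewrite -sqmE -!mulrA cJM cJC -mulrDr -mulrDr; congr (_ * _).
rewrite [RHS]rmorphD /=; congr (_ + _).
by apply: ReIm_eq; [rewrite cReD cReJ cReC|rewrite cImD cImJ cImC]; ring.
Qed.

Lemma res_bigO : bigO 3 (fun g => (RE (fun w => (a + rho' g w)^-1) - RE (fun w => (a + rho g w)^-1))%:C).
Proof.
have inv_rint (f : T -> R) : measurable_fun setT f -> (forall w, 1 <= f w) -> rint (fun w => (f w)^-1).
  move=> mf f1; apply: (@rint_bnd _ _ _ _ _ 1).
    by apply: measurable_inv_ge0 => // w; apply: le_trans (f1 w).
  move=> w; have p0 : 0 < f w by apply: lt_le_trans (f1 w).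
  by rewrite ger0_norm ?invr_ge0 ?(ltW p0)// invf_le1.
have mr g : measurable_fun setT (rho g).
  by apply: measurable_sum => k; apply: cmeas_sqm; exact: l2_meas (sx_l2 g k).
have i1 g : rint (fun w => (a + rho g w)^-1).
  by apply: inv_rint; [apply: measurable_funD|exact: a_rho].
have i2 g : rint (fun w => (a + rho' g w)^-1).
  by apply: inv_rint; [apply: measurable_funD => //; exact: rho'_meas|exact: a_rho'].
have md g : measurable_fun setT (del g) by apply: measurable_funB => //; exact: rho'_meas.
have mres g : measurable_fun setT (res g).
  apply: measurable_inv_ge0 => [|w]; last exact: sqr_ge0.
  by apply: measurable_funX; apply: measurable_funD.
have iq g : rint (fun w => res g w * (del g w ^+ 2 / (a + rho' g w))).
  apply: (rint_le _ (res_quad g)); last by apply: rintZ; exact: cubic_bound_rint.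
  apply: measurable_funM => //; apply: measurable_funM; first exact: measurable_funX.
  apply: measurable_inv_ge0 => [|w]; last by apply: le_trans (a_rho' g w).
  by apply: measurable_funD => //; exact: rho'_meas.
have id_ g : rint (fun w => res g w * del g w).
  apply: eq_rint (rintB (iq g) (rintB (i2 g) (i1 g))) => w.
  by rewrite res_expand; ring.
apply: bigO_ext (bigOB (bigO_RE_le iq cubic_bound_rint _ res_quad cubic_bound_bigO) res_del_bigO).
  move=> g; rewrite CEC -raddfB /= -(REB (iq g) (id_ g)) -(REB (i2 g) (i1 g)); congr (_%:C).
  by apply: eq_RE => w; rewrite res_expand; ring.
by rewrite !addr_ge0// mulr_ge0// exprn_ge0.
Qed.

End resolvent.
End third_order.

(** * Conservation of the norm *)

(** Cut [[0, t]] into [m ^ 2] steps of length [(r / m) ^ 2], with [r = sqrt t]: the errors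
    [K (r / m) ^ 3] add up to [K r^3 / m], which is arbitrarily small. *)
Lemma constant_of_small_increments (R : realType) (phi : R -> R) (Tm K : R) : 0 <= K ->
  (forall s t e, 0 <= s -> t <= Tm -> 0 < e -> e ^+ 2 = t - s -> `|phi t - phi s| <= K * e ^+ 3) ->
  forall t, 0 <= t -> t <= Tm -> phi t = phi 0.
Proof.
move=> K0 hphi t t0 tT; case: (ltgtP 0 t) t0 => // [{}t0 _|<-//].
apply/eqP; rewrite -subr_eq0 -normr_le0; apply/ler_addgt0Pr => eps eps0; rewrite add0r.
pose r := Num.sqrt t; have r0 : 0 < r by rewrite sqrtr_gt0.
have rr : r ^+ 2 = t by rewrite sqr_sqrtr// ltW.
pose m := (Num.bound (K * r ^+ 3 / eps)).+1.
have m0 : (0 : R) < m%:R by rewrite ltr0n.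
pose e := r / m%:R; have e0 : 0 < e by rewrite divr_gt0.
have tele (n : nat) : n%:R * e ^+ 2 <= Tm -> `|phi (n%:R * e ^+ 2) - phi 0| <= n%:R * (K * e ^+ 3).
  elim: n => [|n IH] hn; first by rewrite !mul0r subrr normr0.
  have hn' : n%:R * e ^+ 2 <= n.+1%:R * e ^+ 2 by rewrite ler_wpM2r ?sqr_ge0// ler_nat.
  have := IH (le_trans hn' hn).
  have := hphi (n%:R * e ^+ 2) (n.+1%:R * e ^+ 2) e; rewrite mulr_ge0 ?sqr_ge0//.
  move=> /(_ isT hn e0) h1 h2.
  have {}h1 := h1 (ltac:(by rewrite -natr1; ring)).
  rewrite -(subrKA (phi (n%:R * e ^+ 2))); apply: le_trans (ler_normD _ _) _.
  by rewrite -[in leRHS]natr1 mulrDl mul1r [leRHS]addrC; apply: lerD.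
have et : (m ^ 2)%:R * e ^+ 2 = t.
  by rewrite natrX /e exprMn exprVn mulrCA divff ?mulr1// expf_neq0// gt_eqF.
have := tele (m ^ 2)%N; rewrite et => /(_ tT) h; apply: (le_trans h).
rewrite natrX /e (_ : _ * _ = (K * r ^+ 3) / m%:R); last by field; rewrite gt_eqF.
rewrite ler_pdivrMr// [leRHS]mulrC -ler_pdivrMr//.
have Q0 : 0 <= K * r ^+ 3 / eps by rewrite divr_ge0 ?mulr_ge0 ?exprn_ge0// ltW.
apply: ltW; apply: lt_trans (archi_boundP Q0) _.
by rewrite ltr_nat.
Qed.

Section unit_column.
Context (R : realType) d (T : measurableType d) (P : probability T R) (N : nat).
Variables (N0 : (0 < N)%N) (F : R -> set (set T)) (H U : R -> T -> 'M[R[i]]_N) (V : 'M[R[i]]_N).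
Hypotheses (hH : hermitian_brownian_motion P H) (hF : brownian_filtration P F H).
Hypothesis hU : unitary_brownian_motion P F H V U.
Hypothesis hV : V \is unitarymx.
Local Notation rint := (rint P).
Local Notation RE := (RE P).
Local Notation CE := (CE P).
Local Notation cint := (cint P).
Local Notation l2 := (l2 P).
Variables (c : 'I_N).
Let u (r : R) k w := U r w k c.

(** The states range over [setT]: no bound on the column is available before its norm is known. *)
Lemma column_sde_step Tm : 0 <= Tm -> exists C : R, 0 <= C /\
  forall s t e, 0 <= s -> t <= Tm -> 0 < e -> e ^+ 2 = t - s ->
  exists g : sde_step P F H setT C (Num.sqrt Tm),
    [/\ ss g = s, st g = t, se g = e, sx g = u s & sy g = u t].
Proof.
move=> Tm0; have [C [C0 hC]] := one_step_uniform N0 hH hF hU c Tm0.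
exists C; split => // s t e s0 tT e0 ee.
have st : s <= t by rewrite -subr_ge0 -ee sqr_ge0.
have [hu [p [q [hp hq po ue]]]] := hC s t s0 st tT.
have eL : e <= Num.sqrt Tm.
  have -> : e = Num.sqrt (e ^+ 2) by rewrite sqrtr_sqr gtr0_norm.
  by rewrite ler_wsqrtr// ee; lra.
have hp4 k : RE (fun w => sqm (p k w)) <= C * e ^+ 4.
  by have [_] := hp k; rewrite -ee -exprM.
have hq6 k : RE (fun w => sqm (q k w)) <= C * e ^+ 6.
  by have [_] := hq k; rewrite -ee -exprM.
unshelve eexists (@SdeStep _ _ _ _ _ F H setT C (Num.sqrt Tm) s t e (u s) (u t) p q s0 st e0 ee eL
  _ _ _ _ _ _ hp4 _ hq6 po _) => //.
- by move=> k; exact: (u_gmeas hU).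
- by move=> k; case: (hu k).
- by move=> k; case: (hu k).
- by move=> k; case: (hp k).
- by move=> k; case: (hq k).
Qed.

Let nu (r : R) w := \sum_k sqm (u r k w).

Lemma nu0 w : nu 0 w = 1.
Proof.
rewrite /nu /u (ubm_0 hU).
(* Unitarity is stated for the rows; the norm of a column needs the product in the other order. *)
have /mulmx1C := unitarymxP hV.
move=> /matrixP /(_ c c); rewrite !mxE eqxx => e.
have {}e : \sum_k (sqm (V k c))%:C = 1%:C :> R[i].
  rewrite -[RHS]e; apply: eq_bigr => k _.
  by rewrite !mxE sqm_normr normCK mulrC.
by rewrite -raddf_sum in e; have := congr1 (@complex.Re R) e.
Qed.

Lemma nu_meas r : 0 <= r -> measurable_fun setT (nu r).
Proof.
move=> r0; apply: measurable_sum => k; apply: cmeas_sqm; apply: (F_meas hF r0).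
exact: (u_gmeas hU).
Qed.

Lemma nu_ge0 r w : 0 <= nu r w. Proof. by apply: sumr_ge0 => k _; exact: sqm_ge0. Qed.

Lemma RE_resolvent a t : 1 <= a -> 0 <= t -> RE (fun w => (a + nu t w)^-1) = (a + 1)^-1.
Proof.
move=> a1 t0; have [C [C0 hC]] := column_sde_step t0.
have [K [K0 hK]] := res_bigO N0 hH hF setT C0 (sqrtr_ge0 t) a1.
rewrite (constant_of_small_increments (phi := fun t => RE (fun w => (a + nu t w)^-1)) K0 _ t0 (lexx t)).
  by under eq_RE do rewrite nu0; rewrite RE_cst.
move=> s r e s0 rt e0 ee; have [g [gs gr ge gx gy]] := hC s r e s0 rt e0 ee.
have := hK g; rewrite nmC ge; congr (_ <= _); congr (`| _ |); congr (_ - _).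
  by apply: eq_RE => w; rewrite /rho' gy.
by apply: eq_RE => w; rewrite /rho gx.
Qed.

Lemma column_norm_ae t : 0 <= t -> {ae P, forall w, nu t w = 1}.
Proof.
move=> t0; have m := nu_meas t0.
have i a : 1 <= a -> rint (fun w => (a + nu t w)^-1).
  move=> a1; apply: (@rint_bnd _ _ _ _ _ 1) => [|w]; have h w' := nu_ge0 t w'.
    by apply: measurable_inv_ge0 => [|w]; [exact: measurable_funD|have := h w; lra].
  have p0 : 0 < a + nu t w by have := h w; lra.
  by rewrite ger0_norm ?invr_ge0 ?(ltW p0)// invf_le1//; have := h w; lra.
pose f w := (nu t w - 1) ^+ 2 * ((1 + nu t w)^-1 * (2 + nu t w)^-1).
(* Partial fractions. As the two resolvents have means 1/2 and 1/3, the mean of [f] is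
   [1 + 4/2 - 9/3 = 0]. *)
have fE w : f w = 1 + 4 * (1 + nu t w)^-1 - 9 * (2 + nu t w)^-1.
  by rewrite /f; have := nu_ge0 t w; move: (nu t w) => x x0; field; rewrite !gt_eqF//; lra.
have i1 := rintZ 4 (i 1 (lexx 1)); have i2 := rintZ 9 (i 2 (ltac:(lra))).
have f0 w : 0 <= f w.
  have h := nu_ge0 t w; apply: mulr_ge0; first exact: sqr_ge0.
  by rewrite mulr_ge0// invr_ge0; lra.
have fi : rint f by apply: eq_rint (rintB (rintD (rint_cst P 1) i1) i2) => w; rewrite fE.
have REf : RE f = 0.
  transitivity (RE (fun w => 1 + 4 * (1 + nu t w)^-1 - 9 * (2 + nu t w)^-1)); first exact: eq_RE.
  rewrite (REB (rintD (rint_cst P 1) i1) i2) (RED (rint_cst P 1) i1) (REZ 4 (i 1 (lexx 1))).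
  rewrite (REZ 9 (i 2 (ltac:(lra)))) RE_cst !RE_resolvent//; [by field|lra].
have mf : measurable_fun setT (EFin \o f) by exact: (measurable_int _ fi).
have /(ae_eq_integral_abs P measurableT mf).1 : (\int[P]_w `|(EFin \o f) w| = 0)%E.
  by under eq_integral do rewrite /= ger0_norm//; rewrite (RE_EFin fi) REf.
apply: filterS => w /(_ I) /= [e]; apply/eqP.
have h := nu_ge0 t w; have q : 0 < (1 + nu t w)^-1 * (2 + nu t w)^-1.
  by apply: mulr_gt0; rewrite invr_gt0; lra.
by move/eqP: e; rewrite /f mulf_eq0 (gt_eqF q) orbF sqrf_eq0 subr_eq0.
Qed.

End unit_column.

(** * Taylor estimates for the complex exponential *)

Section taylor.
Context (R : realType).
Implicit Types (f df : R -> R) (x M K : R).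

(** Mean value theorem. The factor [1 / (n + 1)] is given up, so that the constant [K] is unchanged
    when the bound is iterated. *)
Lemma integrate_power_bound f df (n : nat) M K : 0 <= K -> (forall x, is_derive x 1 f (df x)) ->
  f 0 = 0 -> (forall x, `|x| <= M -> `|df x| <= K * `|x| ^+ n) ->
  forall x, `|x| <= M -> `|f x| <= K * `|x| ^+ n.+1.
Proof.
move=> K0 hf f0 hdf x xM.
have cf a b : {within `[a, b], continuous f}.
  by apply: derivable_within_continuous => y _; exact: ex_derive.
case: (ltgtP x 0) => [x0|x0|->].
- have [c /[!in_itv]/= /andP[c1 c2] e] := MVT x0 (fun y _ => hf y) (cf x 0).
  have cx : `|c| <= `|x| by rewrite !ltr0_norm// lerN2 ltW.
  have -> : f x = df c * x by move: e; rewrite f0; lra.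
  rewrite normrM exprSr mulrA ler_wpM2r//; apply: le_trans (hdf c (le_trans cx xM)) _.
  by rewrite ler_wpM2l// lerXn2r ?nnegrE.
- have [c /[!in_itv]/= /andP[c1 c2] e] := MVT x0 (fun y _ => hf y) (cf 0 x).
  have cx : `|c| <= `|x| by rewrite !gtr0_norm// ltW.
  have -> : f x = df c * x by move: e; rewrite f0; lra.
  rewrite normrM exprSr mulrA ler_wpM2r//; apply: le_trans (hdf c (le_trans cx xM)) _.
  by rewrite ler_wpM2l// lerXn2r ?nnegrE.
- by rewrite f0 normr0 expr0n mulr0.
Qed.

Lemma is_derive_exp1 x : is_derive x 1 (fun y => expR y - 1) (expR x).
Proof. by apply: is_derive_eq; rewrite subr0. Qed.

Lemma is_derive_exp2 x : is_derive x 1 (fun y => expR y - 1 - y) (expR x - 1).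
Proof. by apply: is_derive_eq; rewrite subr0. Qed.

Lemma is_derive_exp3 x : is_derive x 1 (fun y => expR y - 1 - y - y ^+ 2 / 2) (expR x - 1 - x).
Proof. by apply: is_derive_eq; rewrite scaler0 scaler0 /GRing.scale /=; field. Qed.

Lemma is_derive_sin1 x : is_derive x 1 (fun y => sin y - y) (cos x - 1).
Proof. by apply: is_derive_eq. Qed.

Lemma is_derive_cos1 x : is_derive x 1 (fun y => cos y - 1) (- sin x).
Proof. by apply: is_derive_eq; rewrite subr0. Qed.

Lemma is_derive_cos2 x : is_derive x 1 (fun y => cos y - 1 + y ^+ 2 / 2) (x - sin x).
Proof. by apply: is_derive_eq; rewrite scaler0 scaler0 /GRing.scale /=; field. Qed.

Lemma exp_taylor M x : `|x| <= M ->
  [/\ `|expR x - 1| <= expR M * `|x| ^+ 1, `|expR x - 1 - x| <= expR M * `|x| ^+ 2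
    & `|expR x - 1 - x - x ^+ 2 / 2| <= expR M * `|x| ^+ 3].
Proof.
have E0 := expR_ge0 M.
have h1 y : `|y| <= M -> `|expR y - 1| <= expR M * `|y| ^+ 1.
  apply: (integrate_power_bound E0 is_derive_exp1); first by rewrite expR0 subrr.
  move=> z zM; rewrite expr0 mulr1 ger0_norm ?expR_ge0// ler_expR.
  exact: le_trans (ler_norm _) zM.
have h2 y : `|y| <= M -> `|expR y - 1 - y| <= expR M * `|y| ^+ 2.
  by apply: (integrate_power_bound E0 is_derive_exp2) => //; rewrite expR0 !subrr.
move=> xM; split; [exact: h1|exact: h2|].
apply: (integrate_power_bound E0 is_derive_exp3 _ h2 xM).
by rewrite expR0 expr0n mul0r !subrr.
Qed.

Lemma trig_taylor M x : `|x| <= M ->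
  `|sin x - x| <= `|x| ^+ 3 /\ `|cos x - 1 + x ^+ 2 / 2| <= M * `|x| ^+ 3.
Proof.
have s1 y : `|y| <= M -> `|sin y| <= 1 * `|y| ^+ 1.
  apply: (@integrate_power_bound sin cos 0 M 1 ler01 (@is_derive_sin R)) => [|z _]; first exact: sin0.
  by rewrite expr0 mulr1 ler_norml cos_geN1 cos_le1.
have c2 y : `|y| <= M -> `|cos y - 1| <= 1 * `|y| ^+ 2.
  apply: (integrate_power_bound ler01 is_derive_cos1) => [|z zM]; first by rewrite cos0 subrr.
  by rewrite normrN; exact: s1.
have s3 y : `|y| <= M -> `|sin y - y| <= 1 * `|y| ^+ 3.
  by apply: (integrate_power_bound ler01 is_derive_sin1) => //; rewrite sin0 subrr.
move=> xM; split; first by rewrite -[leRHS]mul1r s3.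
(* The remainder of the cosine has order 4; one power of [|x|] is traded for [M]. *)
apply: le_trans (_ : 1 * `|x| ^+ 4 <= _).
  apply: (integrate_power_bound ler01 is_derive_cos2) xM => [|y yM].
    by rewrite cos0 expr0n mul0r subrr addr0.
  by rewrite distrC; exact: s3.
by rewrite mul1r exprS ler_wpM2r ?exprn_ge0.
Qed.

Lemma cexpD (z w : R[i]) : cexp (z + w) = cexp z * cexp w.
Proof.
case: z w => [a b] [a' b']; rewrite /cexp /=.
by apply: ReIm_eq => /=; rewrite expRD ?cosD ?sinD; ring.
Qed.

Lemma nm_cexp (z : R[i]) : nm (cexp z) = expR (Re z).
Proof.
rewrite nmE /cexp /sqm /= !exprMn -mulrDr cos2Dsin2 mulr1 sqrtr_sqr.
by rewrite ger0_norm ?expR_ge0.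
Qed.

Lemma Re_cexp (z : R[i]) : Re (cexp z) = expR (Re z) * cos (Im z). Proof. by []. Qed.
Lemma Im_cexp (z : R[i]) : Im (cexp z) = expR (Re z) * sin (Im z). Proof. by []. Qed.

(** The real and imaginary parts are regrouped, in [rE] and [iE], into products of one-variable
    remainders whose orders add up to at least 3. *)
Lemma cexp_taylor3 M : 0 <= M -> exists K, 0 <= K /\ forall z : R[i], nm z <= M ->
  nm (cexp z - 1 - z - z ^+ 2 / 2) <= K * nm z ^+ 3.
Proof.
move=> M0; exists ((expR M * M + expR M + expR M) + (expR M + expR M)); split.
  by rewrite !addr_ge0 ?mulr_ge0 ?expR_ge0.
move=> z zM; have aM := le_trans (nm_Re z) zM; have bM := le_trans (nm_Im z) zM.
have [e1 e2 e3] := exp_taylor aM; have [s c] := trig_taylor bM.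
set n := nm z; have n0 : 0 <= n by exact: nm_ge0.
have an : `|Re z| <= n := nm_Re z; have bn : `|Im z| <= n := nm_Im z.
have EM := expR_ge0 M.
have Ea : expR (Re z) <= expR M by rewrite ler_expR; apply: le_trans (ler_norm _) aM.
have Ea0 := expR_ge0 (Re z).
have b3 : `|Im z| ^+ 3 <= n ^+ 3 by rewrite lerXn2r ?nnegrE.
have a3 : `|Re z| ^+ 3 <= n ^+ 3 by rewrite lerXn2r ?nnegrE.
have t1 : `|expR (Re z) * (cos (Im z) - 1 + Im z ^+ 2 / 2)| <= expR M * M * n ^+ 3.
  rewrite normrM (ger0_norm Ea0) -mulrA; apply: ler_pM => //.
  by apply: (le_trans c); rewrite ler_wpM2l.
have t2 : `|expR (Re z) - 1 - Re z - Re z ^+ 2 / 2| <= expR M * n ^+ 3.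
  by apply: (le_trans e3); rewrite ler_wpM2l.
have t3 : `|(expR (Re z) - 1) * (Im z ^+ 2 / 2)| <= expR M * n ^+ 3.
  rewrite normrM [n ^+ 3]exprS mulrA ler_pM//.
    by apply: (le_trans e1); rewrite expr1 ler_wpM2l.
  rewrite [`|Im z ^+ 2 / 2|]normrM normrX; apply: (@le_trans _ _ (`|Im z| ^+ 2 * 1)).
    by rewrite ler_wpM2l ?sqr_ge0// ger0_norm; lra.
  by rewrite mulr1 lerXn2r ?nnegrE.
have t4 : `|expR (Re z) * (sin (Im z) - Im z)| <= expR M * n ^+ 3.
  by rewrite normrM (ger0_norm Ea0); apply: ler_pM => //; exact: le_trans s b3.
have t5 : `|(expR (Re z) - 1 - Re z) * Im z| <= expR M * n ^+ 3.
  rewrite normrM exprSr mulrA ler_pM//; apply: (le_trans e2).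
  by rewrite ler_wpM2l// lerXn2r ?nnegrE.
have Re1 : Re (1 : R[i]) = 1 by []; have Im1 : Im (1 : R[i]) = 0 by [].
have rE : Re (cexp z - 1 - z - z ^+ 2 / 2) = expR (Re z) * (cos (Im z) - 1 + Im z ^+ 2 / 2)
  + (expR (Re z) - 1 - Re z - Re z ^+ 2 / 2) - (expR (Re z) - 1) * (Im z ^+ 2 / 2).
  have -> : (2^-1 : R[i]) = (2^-1)%:C by rewrite fmorphV rmorph_nat.
  move: (cexp z) (Re_cexp z) => E rc.
  rewrite expr2 !(cReD, cImD, cReN, cImN, cReM, cImM, cReC, cImC) rc ?Re1; ring.
have iE : Im (cexp z - 1 - z - z ^+ 2 / 2) = expR (Re z) * (sin (Im z) - Im z)
  + (expR (Re z) - 1 - Re z) * Im z.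
  have -> : (2^-1 : R[i]) = (2^-1)%:C by rewrite fmorphV rmorph_nat.
  move: (cexp z) (Im_cexp z) => E ic.
  rewrite expr2 !(cReD, cImD, cReN, cImN, cReM, cImM, cReC, cImC) ic ?Im1; by field.
apply: le_trans (nm_ReIm _) _; rewrite rE iE [leRHS]mulrDl lerD//.
  apply: (le_trans (ler_normB _ _)); rewrite [leRHS]mulrDl lerD//.
  by apply: (le_trans (ler_normD _ _)); rewrite [leRHS]mulrDl lerD.
by apply: (le_trans (ler_normD _ _)); rewrite [leRHS]mulrDl lerD.
Qed.

Lemma cexp_taylor2 M : 0 <= M -> exists K, 0 <= K /\ forall z : R[i], nm z <= M ->
  nm (cexp z - 1 - z) <= K * nm z ^+ 2.
Proof.
move=> M0; have [K [K0 hK]] := cexp_taylor3 M0.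
exists (K * M + 1); split; first by rewrite addr_ge0 ?mulr_ge0.
move=> z zM; have -> : cexp z - 1 - z = (cexp z - 1 - z - z ^+ 2 / 2) + z ^+ 2 / 2 by ring.
apply: (le_trans (nmD _ _)); rewrite mulrDl lerD//.
  apply: (le_trans (hK z zM)); rewrite exprS -mulrA ler_wpM2l// ler_wpM2r ?exprn_ge0//.
  exact: nm_ge0.
have -> : z ^+ 2 / 2 = (2^-1)%:C * z ^+ 2 by rewrite mulrC fmorphV rmorph_nat.
by rewrite nmM nmC nmX ger0_norm ?invr_ge0// ler_wpM2r ?exprn_ge0 ?nm_ge0//; lra.
Qed.

Lemma cexp_taylor1 M : 0 <= M -> exists K, 0 <= K /\ forall z : R[i], nm z <= M ->
  nm (cexp z - 1) <= K * nm z.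
Proof.
move=> M0; have [K [K0 hK]] := cexp_taylor2 M0.
exists (K * M + 1); split; first by rewrite addr_ge0 ?mulr_ge0.
move=> z zM; have -> : cexp z - 1 = (cexp z - 1 - z) + z by ring.
apply: (le_trans (nmD _ _)); rewrite mulrDl mul1r lerD//.
by apply: (le_trans (hK z zM)); rewrite expr2 -mulrA ler_wpM2l// ler_wpM2r ?nm_ge0.
Qed.

End taylor.

(** * The generator *)

Section nice.
Context (R : realType) (N : nat).
Implicit Types (x y : 'I_N -> R[i]) (Phi Psi : ('I_N -> R[i]) -> R[i]).

Definition ball1 : set ('I_N -> R[i]) := [set x | \sum_k sqm (x k) <= 1].

(** Observables of the column. Measurability ranges over all measurable types because it serves both
    for the ambient sigma-algebra and for that of the past. The bounds concern the unit ball, where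
    the normalised column takes its values. *)
Record nice Phi : Prop := {
  nice_meas : forall d (T : measurableType d) (x : 'I_N -> T -> R[i]),
    (forall k, cmeas (x k)) -> cmeas (fun w => Phi (x ^~ w));
  nice_bnd : exists K : R, 0 <= K /\ forall x, ball1 x -> nm (Phi x) <= K;
  nice_lip : exists K : R, 0 <= K /\ forall x y, ball1 x -> ball1 y ->
    nm (Phi y - Phi x) <= K * \sum_k nm (y k - x k) }.

Lemma ball1_sqm x k : ball1 x -> sqm (x k) <= 1.
Proof.
apply: le_trans; rewrite (bigD1 k)//= lerDl.
by apply: sumr_ge0 => ? _; exact: sqm_ge0.
Qed.

Lemma ball1_nm x k : ball1 x -> nm (x k) <= 1.
Proof.
move=> /(@ball1_sqm _ k); rewrite -nm_sqr => h.
by rewrite -(@ler_pXn2r _ 2) ?nnegrE ?nm_ge0// expr1n.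
Qed.

Lemma nice_ext Phi Psi : (forall x, Phi x = Psi x) -> nice Phi -> nice Psi.
Proof. by move=> /funext ->. Qed.

Lemma nice_cst (c : R[i]) : nice (fun=> c).
Proof.
split; first by move=> *; exact: cmeas_cst.
  by exists (nm c); rewrite nm_ge0.
by exists 0; split => // x y _ _; rewrite subrr nm0 mul0r.
Qed.

Lemma niceD Phi Psi : nice Phi -> nice Psi -> nice (fun x => Phi x + Psi x).
Proof.
move=> [m1 [K1 [K10 b1]] [L1 [L10 l1]]] [m2 [K2 [K20 b2]] [L2 [L20 l2]]]; split.
- by move=> d T x mx; apply: cmeasD; [exact: m1|exact: m2].
- exists (K1 + K2); split; first exact: addr_ge0.
  by move=> x bx; apply: (le_trans (nmD _ _)); exact: lerD (b1 x bx) (b2 x bx).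
- exists (L1 + L2); split; first exact: addr_ge0.
  move=> x y bx by_; rewrite opprD addrACA mulrDl; apply: (le_trans (nmD _ _)).
  exact: lerD (l1 _ _ bx by_) (l2 _ _ bx by_).
Qed.

Lemma niceM Phi Psi : nice Phi -> nice Psi -> nice (fun x => Phi x * Psi x).
Proof.
move=> [m1 [K1 [K10 b1]] [L1 [L10 l1]]] [m2 [K2 [K20 b2]] [L2 [L20 l2]]]; split.
- by move=> d T x mx; apply: cmeasM; [exact: m1|exact: m2].
- exists (K1 * K2); split; first exact: mulr_ge0.
  by move=> x bx; rewrite nmM ler_pM ?nm_ge0 ?b1 ?b2.
- exists (L1 * K2 + K1 * L2); split; first by rewrite addr_ge0 ?mulr_ge0.
  move=> x y bx by_; rewrite (_ : _ - _ = (Phi y - Phi x) * Psi y + Phi x * (Psi y - Psi x)); last by ring.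
  apply: (le_trans (nmD _ _)); rewrite [leRHS]mulrDl !nmM lerD//.
    by rewrite mulrAC ler_pM ?nm_ge0 ?l1 ?b2.
  by rewrite -mulrA ler_pM ?nm_ge0 ?l2 ?b1.
Qed.

Lemma nice_sum (I : Type) (r : seq I) (Phi : I -> ('I_N -> R[i]) -> R[i]) :
  (forall i, nice (Phi i)) -> nice (fun x => \sum_(i <- r) Phi i x).
Proof.
move=> h; elim: r => [|i r IH].
  by apply: nice_ext (nice_cst 0) => x; rewrite big_nil.
by apply: nice_ext (niceD (h i) IH) => x; rewrite big_cons.
Qed.

Definition mod2 (j : 'I_N) x : R[i] := (sqm (x j))%:C.

Lemma nice_mod2 j : nice (mod2 j).
Proof.
split.
- by move=> d T x mx; apply: cmeasC; exact: cmeas_sqm.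
- by exists 1; split => // x bx; rewrite nmC ger0_norm ?sqm_ge0// ball1_sqm.
- exists 2; split => // x y bx by_; rewrite /mod2 !sqmE.
  rewrite (_ : _ - _ = (y j - x j) * (y j)^* + x j * (y j - x j)^*); last by rewrite cJB; ring.
  apply: (le_trans (nmD _ _)); rewrite !nmM !nmJ.
  apply: (@le_trans _ _ (2 * nm (y j - x j))).
    have h1 : nm (y j - x j) * nm (y j) <= nm (y j - x j) * 1.
      by rewrite ler_wpM2l ?nm_ge0// ball1_nm.
    have h2 : nm (x j) * nm (y j - x j) <= 1 * nm (y j - x j).
      by rewrite ler_wpM2r ?nm_ge0// ball1_nm.
    by move: h1 h2; rewrite mulr1 mul1r; lra.
  rewrite ler_wpM2l// (bigD1 j)//= lerDl.
  by apply: sumr_ge0 => k _; exact: nm_ge0.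
Qed.

Lemma nice_cexp Phi : nice Phi -> nice (fun x => cexp (Phi x)).
Proof.
move=> [m [K [K0 b]] [L [L0 l]]]; split.
- by move=> d T x mx; apply: cmeas_exp; exact: m.
- exists (expR K); split; first exact: expR_ge0.
  move=> x bx; rewrite nm_cexp ler_expR; apply: le_trans (b x bx).
  by apply: le_trans (nm_Re _); exact: ler_norm.
- have [K' [K'0 h]] := cexp_taylor1 (addr_ge0 K0 K0).
  exists (expR K * (K' * L)); split; first by rewrite !mulr_ge0 ?expR_ge0.
  move=> x y bx by_.
  have -> : cexp (Phi y) - cexp (Phi x) = cexp (Phi x) * (cexp (Phi y - Phi x) - 1).
    by rewrite mulrBr mulr1 -cexpD [Phi x + _]addrC subrK.
  rewrite nmM -!mulrA; apply: ler_pM; rewrite ?nm_ge0//.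
    rewrite nm_cexp ler_expR; apply: le_trans (b x bx).
    by apply: le_trans (nm_Re _); exact: ler_norm.
  have hb : nm (Phi y - Phi x) <= K + K by apply: (le_trans (nmB _ _)); rewrite lerD ?b.
  by apply: (le_trans (h _ hb)); rewrite ler_wpM2l// l.
Qed.

End nice.

Section generator.
Context (R : realType) d (T : measurableType d) (P : probability T R) (N : nat).
Variables (N0 : (0 < N)%N) (F : R -> set (set T)) (H : R -> T -> 'M[R[i]]_N).
Hypotheses (hH : hermitian_brownian_motion P H) (hF : brownian_filtration P F H).
Variables (C L : R).
Hypotheses (C0 : 0 <= C) (L0 : 0 <= L).
Local Notation rint := (rint P).
Local Notation RE := (RE P).
Local Notation CE := (CE P).
Local Notation cint := (cint P).
Local Notation l2 := (l2 P).
Local Notation Adm := (@ball1 R N).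
Local Notation sde_step := (sde_step P F H Adm C L).
Implicit Types (j k : 'I_N) (g : sde_step) (f h : sde_step -> T -> R[i]) (n a b : nat).

Let lsv := sv_L2O N0 hH hF Adm C0 L0.

Lemma sx_cmeas g k : cmeas (sx g k). Proof. exact: l2_meas (sx_l2 g k). Qed.
Lemma sv_cmeas g k : cmeas (sv g k). Proof. exact: l2_meas (L2O_l2 (lsv k) g). Qed.
Lemma sy_cmeas g k : cmeas (sy g k).
Proof.
have /funext -> : sy g k =1 (fun w => sx g k w + sv g k w) by move=> w; exact: sy_sv.
by apply: cmeasD; [exact: sx_cmeas|exact: sv_cmeas].
Qed.

Lemma nice_bdd Phi : nice Phi -> bdd (fun g w => Phi (sx g ^~ w)).
Proof.
move=> [m [K [K0 b]] _]; split; first by move=> g; apply: m => k; exact: sx_gmeas.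
by exists K; split => // g w; apply: b; exact: sx_in.
Qed.

Lemma sx_bdd j : bdd (fun g => sx g j).
Proof.
split; first by move=> g; exact: sx_gmeas.
by exists 1; split => // g w; apply: (@ball1_nm _ _ (sx g ^~ w)); exact: sx_in.
Qed.

Lemma sv_nm g k w : nm (sv g k w) <= 2.
Proof.
have -> : sv g k w = sy g k w - sx g k w by rewrite sy_sv addrC addKr.
apply: (le_trans (nmB _ _)); have := ball1_nm k (sx_in g w); have := ball1_nm k (sy_in g w).
by move=> /=; lra.
Qed.

Definition vnorm g w : R := \sum_k nm (sv g k w).

Lemma vnorm_ge0 g w : 0 <= vnorm g w. Proof. by apply: sumr_ge0 => k _; exact: nm_ge0. Qed.

Lemma vnorm_sqr g w : vnorm g w ^+ 2 <= N%:R * \sum_k sqm (sv g k w).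
Proof.
have := sqm_sum (fun k : 'I_N => (nm (sv g k w))%:C); rewrite -raddf_sum sqmC /= -/(vnorm g w).
by under eq_bigr do rewrite sqmC nm_sqr.
Qed.

Lemma nice_cint Phi : nice Phi ->
  (forall g, cint (fun w => Phi (sx g ^~ w))) /\ (forall g, cint (fun w => Phi (sy g ^~ w))).
Proof.
move=> [m [K [K0 b]] _]; split => g; (apply: (@cint_bnd _ _ _ _ _ K) => [|w]; last apply: b).
- by apply: m => k; exact: sx_cmeas.
- exact: sx_in.
- by apply: m => k; exact: sy_cmeas.
- exact: sy_in.
Qed.

(** This is continuity in time of the mean of an observable; it is applied to the drift, when a
    difference quotient is expanded from the earlier time. *)
Lemma nice_bigO Phi : nice Phi ->
  bigO 1 (fun g => CE (fun w => Phi (sy g ^~ w)) - CE (fun w => Phi (sx g ^~ w))).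
Proof.
move=> nP; have [ix iy] := nice_cint nP; have [m [K [K0 b]] [M [M0 l]]] := nP.
have r2 g : rint (fun w => \sum_j sqm (sv g j w)) by apply: rint_sum => j; exact: l2_int (L2O_l2 (lsv j) g).
(* From [|v| <= e + |v|^2 / e], with [e] the order of the increment, the second moment controls the
   first one at the right order. *)
pose h g w := se g + (se g)^-1 * \sum_j sqm (sv g j w).
have rh g : rint (h g) by exact: (rintD (rint_cst P (se g)) (rintZ _ (r2 g))).
suff o : bigO 1 (fun g => CE (fun w => Phi (sy g ^~ w) - Phi (sx g ^~ w))).
  by apply: bigO_ext o => g; rewrite (CEB (iy g) (ix g)).
apply: (bigO_CE_le (h := h) (K := M * N%:R)) => //.
- by move=> g; apply: cmeasB; apply: m => k; [exact: sy_cmeas|exact: sx_cmeas].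
- by rewrite mulr_ge0.
- move=> g w; apply: (le_trans (l _ _ (sx_in g w) (sy_in g w))).
  rewrite -mulrA ler_wpM2l//.
  rewrite (eq_bigr (fun k => nm (sv g k w))); last by move=> k _; rewrite sy_sv addrC addKr.
  rewrite /h mulrDr; have e0 := se_gt0 g.
  rewrite (_ : N%:R * se g = \sum_(k < N) se g); last by rewrite sumr_const card_ord mulr_natl.
  apply: (@le_trans _ _ (\sum_(k < N) se g + (se g)^-1 * \sum_j sqm (sv g j w))); last first.
    rewrite lerD2l ler_peMl ?ler1n// mulr_ge0 ?invr_ge0 ?(ltW e0)//.
    by apply: sumr_ge0 => k _; exact: sqm_ge0.
  rewrite mulr_sumr -big_split /=; apply: ler_sum => k _; rewrite -nm_sqr.
  rewrite -(ler_pM2l e0) mulrDr mulrA divff ?gt_eqF// mul1r.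
  by have := sqr_ge0 (nm (sv g k w) - se g); have := nm_ge0 (sv g k w); nra.
- have [K' [K'0 hK]] := bigO_sum_sqm lsv; exists (1 + K'); split; first exact: addr_ge0.
  move=> g; have e0 := se_gt0 g.
  rewrite nmC ger0_norm; last first.
    apply: RE_ge0 => w; rewrite addr_ge0 ?(ltW e0)// mulr_ge0 ?invr_ge0 ?(ltW e0)//.
    by apply: sumr_ge0 => k _; exact: sqm_ge0.
  rewrite (RED (rint_cst P (se g)) (rintZ _ (r2 g))) RE_cst (REZ _ (r2 g)) expr1 mulrDl mul1r lerD2l.
  rewrite ler_pdivrMl//; have := hK g; rewrite nmC => hh; apply: le_trans (ler_norm _) _.
  by apply: (le_trans hh); rewrite muln1 expr2 mulrCA.
Qed.

(** Writing [S] for [vnorm], one factor [S] is kept and [S^2] is bounded by [N vv], with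
    [vv <= 2 N^2 hh + 2 rr] since [rho <= 1]. Then [S hh] is split with weight [e], and [S <= 2 N]
    takes care of [S rr]. *)
Lemma vnorm_cube g w : vnorm g w ^+ 3 <= (2 * N%:R ^+ 3 + 2 * N%:R ^+ 4 + 4 * N%:R ^+ 2) * cubic_bound g w.
Proof.
have S0 := vnorm_ge0 g w; have S2 := vnorm_sqr g w.
have S1 : vnorm g w <= 2 * N%:R.
  rewrite mulr_natr -[X in _ *+ X]card_ord -sumr_const.
  by apply: ler_sum => k _; exact: sv_nm.
have := sum_sqm_sv g w; have hh0 := incr_sq_ge0 g w; have r0 := rho_ge0 g w.
have r1 : rho g w <= 1 := sx_in g w.
have v0 : 0 <= \sum_k sqm (sv g k w) by apply: sumr_ge0 => k _; exact: sqm_ge0.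
have rr0 : 0 <= \sum_k sqm (sr g k w) by apply: sumr_ge0 => k _; exact: sqm_ge0.
have e0 := se_gt0 g; rewrite /cubic_bound.
move: (vnorm g w) (incr_sq g w) (rho g w) (\sum_k sqm (sv g k w)) (\sum_k sqm (sr g k w)) (se g)
  S0 S2 S1 hh0 r0 r1 v0 rr0 e0 => S hh r vv rr e S0 S2 S1 hh0 r0 r1 v0 rr0 e0 hv.
have n0 : 0 <= N%:R :> R by [].
move: (N%:R : R) n0 S2 S1 hv => n n0 S2 S1 hv.
have hv' : vv <= 2 * n ^+ 2 * hh + 2 * rr.
  apply: (le_trans hv); rewrite lerD2r ler_wpM2l ?mulr_ge0 ?sqr_ge0//.
  by rewrite -[leRHS]mulr1 ler_wpM2l.
have a1 : S * hh <= e^-1 * hh ^+ 2 + e * (n * vv).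
  have : e * S ^+ 2 <= e * (n * vv) by rewrite ler_pM2l.
  have : 0 <= e^-1 * (hh - e * S) ^+ 2 by rewrite mulr_ge0 ?sqr_ge0 ?invr_ge0// ltW.
  rewrite (_ : e^-1 * _ = e^-1 * hh ^+ 2 - 2 * (S * hh) + e * S ^+ 2); last first.
    by field; rewrite gt_eqF.
  have := mulr_ge0 S0 hh0; lra.
have a2 : S * rr <= 2 * n * rr by rewrite ler_wpM2r.
have a3 : S ^+ 3 <= n * (2 * n ^+ 2 * (S * hh) + 2 * (S * rr)).
  apply: (@le_trans _ _ (S * (n * (2 * n ^+ 2 * hh + 2 * rr)))); last first.
    by rewrite le_eqVlt; apply/orP; left; apply/eqP; ring.
  rewrite exprS ler_wpM2l//; apply: (le_trans S2); exact: ler_wpM2l.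
apply: (le_trans a3).
apply: (@le_trans _ _ (n * (2 * n ^+ 2 * (e^-1 * hh ^+ 2 + e * (n * vv)) + 2 * (2 * n * rr)))).
  by rewrite ler_wpM2l// lerD// ler_wpM2l// mulr_ge0// sqr_ge0.
have i1 : 0 <= e^-1 * hh ^+ 2 by rewrite mulr_ge0 ?sqr_ge0 ?invr_ge0// ltW.
have i2 : 0 <= e * vv by rewrite mulr_ge0// ltW.
have p2 : 0 <= n ^+ 2 by exact: sqr_ge0.
have p3 : 0 <= n ^+ 3 by exact: exprn_ge0.
have p4 : 0 <= n ^+ 4 by exact: exprn_ge0.
rewrite -subr_ge0 (_ : _ - _ = (2 * n ^+ 4 + 4 * n ^+ 2) * (e^-1 * hh ^+ 2) +
  (2 * n ^+ 3 + 4 * n ^+ 2) * (e * vv) + (2 * n ^+ 3 + 2 * n ^+ 4) * rr); last by ring.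
by rewrite !addr_ge0// mulr_ge0// addr_ge0// mulr_ge0.
Qed.

End generator.

(** * Expansion of the exponential functional *)

Section ito.
Context (R : realType) d (T : measurableType d) (P : probability T R) (N : nat).
Variables (N0 : (0 < N)%N) (F : R -> set (set T)) (H : R -> T -> 'M[R[i]]_N).
Hypotheses (hH : hermitian_brownian_motion P H) (hF : brownian_filtration P F H).
Variables (C L : R).
Hypotheses (C0 : 0 <= C) (L0 : 0 <= L).
Local Notation rint := (rint P).
Local Notation RE := (RE P).
Local Notation CE := (CE P).
Local Notation cint := (cint P).
Local Notation l2 := (l2 P).
Local Notation Adm := (@ball1 R N).
Local Notation sde_step := (sde_step P F H Adm C L).
Implicit Types (j k : 'I_N) (g : sde_step) (f h : sde_step -> T -> R[i]) (n a b : nat).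

Let lsx := sx_L2O P F H Adm L C0.
Let lsv := sv_L2O N0 hH hF Adm C0 L0.

(** Integrability is carried along with the order, so that expansions can be added as pointwise
    expressions and simplified by [ring] before expectations are taken. *)
Definition CEO n f := (forall g, cint (f g)) /\ bigO n (fun g => CE (f g)).

Lemma CEO_ext n f h : (forall g w, f g w = h g w) -> CEO n f -> CEO n h.
Proof. by move=> e; rewrite (_ : f = h)//; apply/funext => g; apply/funext => w. Qed.

Lemma CEOD n f h : CEO n f -> CEO n h -> CEO n (fun g w => f g w + h g w).
Proof.
move=> [cf of_] [ch oh]; split; first by move=> g; exact: cintD.
by apply: bigO_ext (bigOD of_ oh) => g; rewrite CED.
Qed.

Lemma CEOZ n (c : R[i]) f : CEO n f -> CEO n (fun g w => c * f g w).
Proof.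
move=> [cf of_]; split; first by move=> g; exact: cintZ.
by apply: bigO_ext (bigOZ c of_) => g; rewrite CEZ.
Qed.

Lemma CEOJ n f : CEO n f -> CEO n (fun g w => (f g w)^*).
Proof.
move=> [cf of_]; split; first by move=> g; exact: cintJ.
by apply: bigO_ext (bigOJ of_) => g; rewrite CEJ.
Qed.

Lemma CEO_sum n (I : Type) (r : seq I) (f : I -> sde_step -> T -> R[i]) :
  (forall i, CEO n (f i)) -> CEO n (fun g w => \sum_(i <- r) f i g w).
Proof.
move=> h; elim: r => [|i r IH].
  apply: (@CEO_ext _ (fun _ _ => 0)); first by move=> g w; rewrite big_nil.
  by split=> [g|]; [exact: cint_cst|apply: bigO_ext (bigO0 P F H Adm C L n) => g; rewrite CE_cst].
by apply: CEO_ext (CEOD (h i) IH) => g w; rewrite big_cons.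
Qed.

Let dt g : R[i] := (st g - ss g)%:C.
Let dtN g : R[i] := ((st g - ss g) / N%:R)%:C.

Section bounded_factor.
Variable f : sde_step -> T -> R[i].
Hypothesis bf : bdd f.

Lemma CEO1 j : CEO 3 (fun g w => f g w * sv g j w + dt g / 2 * (f g w * sx g j w)).
Proof.
have lf : L2O 0 f := L2O_bdd hF bf.
have c1 g := l2_cintM (L2O_l2 lf g) (L2O_l2 (lsv j) g).
have c2 g := l2_cintM (L2O_l2 lf g) (sx_l2 g j).
split; first by move=> g; exact: (cintD (c1 g) (cintZ _ (c2 g))).
apply: bigO_ext (CE_sv_linear N0 hH hF C0 bf j) => g; rewrite (CED (c1 g) (cintZ _ (c2 g))) (CEZ _ (c2 g)).
by congr (_ + _ * _); rewrite /dt rmorphM /= fmorphV rmorph_nat.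
Qed.

Lemma CEO2 j k : CEO 3 (fun g w => f g w * (sv g j w * sv g k w) + dtN g * (f g w * (sx g j w * sx g k w))).
Proof.
have c1 g : cint (fun w => f g w * (sv g j w * sv g k w)).
  apply: eq_cint (l2_cintM (L2O_l2 (L2O_bddM hF bf (lsv j)) g) (L2O_l2 (lsv k) g)) => w.
  by rewrite mulrA.
have c2 g : cint (fun w => f g w * (sx g j w * sx g k w)).
  apply: eq_cint (l2_cintM (L2O_l2 (L2O_bddM hF bf (lsx j)) g) (L2O_l2 (lsx k) g)) => w.
  by rewrite mulrA.
split; first by move=> g; exact: (cintD (c1 g) (cintZ _ (c2 g))).
by apply: bigO_ext (CE_sv_quadratic N0 hH hF C0 L0 bf j k) => g; rewrite (CED (c1 g) (cintZ _ (c2 g))) (CEZ _ (c2 g)).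
Qed.

Lemma CEO2J j k : CEO 3 (fun g w => f g w * (sv g j w * (sv g k w)^*)
   - dtN g * (j == k)%:R * (f g w * (rho g w)%:C)).
Proof.
have c1 g : cint (fun w => f g w * (sv g j w * (sv g k w)^*)).
  apply: eq_cint (l2_cintM (L2O_l2 (L2O_bddM hF bf (lsv j)) g) (L2O_l2 (L2OJ (lsv k)) g)) => w.
  by rewrite mulrA.
have c2 g : cint (fun w => f g w * (rho g w)%:C).
  apply: (@eq_cint _ _ _ P (fun w => \sum_l (f g w * sx g l w) * (sx g l w)^*)).
    move=> w; rewrite /rho raddf_sum mulr_sumr; apply: eq_bigr => l _.
    by rewrite /= sqmE mulrA.
  apply: cint_sum => l.
  exact: (l2_cintM (L2O_l2 (L2O_bddM hF bf (lsx l)) g) (L2O_l2 (L2OJ (lsx l)) g)).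
split; first by move=> g; exact: (cintB (c1 g) (cintZ _ (c2 g))).
apply: bigO_ext (CE_sv_quadraticJ N0 hH hF C0 L0 bf j k) => g.
rewrite (CEB (c1 g) (cintZ _ (c2 g))) (CEZ _ (c2 g)); congr (_ - _ * _).
by rewrite rmorphM rmorph_nat.
Qed.

End bounded_factor.

Section exponential.
Variable lam : 'rV[R[i]]_N.
Let G (x : 'I_N -> R[i]) : R[i] := cexp (\sum_j lam 0 j * mod2 j x).

(** This is [L f / f] for the exponential [f]. The sum of the [mod2 k x] is kept where it arises,
    since along the column it equals 1 only almost surely; it is replaced by 1 at the very end. *)
Definition drift (x : 'I_N -> R[i]) : R[i] :=
  \sum_j lam 0 j * (N%:R^-1 * (\sum_k mod2 k x) - mod2 j x)
  + N%:R^-1 * (\sum_j lam 0 j ^+ 2 * mod2 j x * (\sum_k mod2 k x)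
               - (\sum_j lam 0 j * mod2 j x) ^+ 2).

Lemma nice_expo : nice G.
Proof.
exact: nice_cexp (nice_sum _ (fun j => niceM (nice_cst N (lam 0 j)) (nice_mod2 R j))).
Qed.

Let bG := nice_bdd P F H C L nice_expo.

(** [m] and [q] are the linear and the quadratic part, in [sv], of the increment of [|x_j|^2] over
    the step. *)
Let m g j w : R[i] := (sx g j w)^* * sv g j w + sx g j w * (sv g j w)^*.
Let q g j w : R[i] := sv g j w * (sv g j w)^*.
Let X g j w : R[i] := sx g j w * (sx g j w)^*.
Let rX g w : R[i] := (rho g w)%:C.
Let Gx g w := G (sx g ^~ w).
Let Gy g w := G (sy g ^~ w).
Let M g w : R[i] := \sum_j lam 0 j * m g j w.
Let Q g w : R[i] := \sum_j lam 0 j * q g j w.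

Let bGx : bdd Gx := bG.
Let bJ j := bddJ (sx_bdd P F H C L j).
Let bX j := sx_bdd P F H C L j.

Lemma first_order j : CEO 3 (fun g w => Gx g w * (m g j w + q g j w)
  + dt g * (Gx g w * X g j w) - dtN g * (Gx g w * rX g w)).
Proof.
have o1 := CEO1 (bddM bGx (bJ j)) j.
(* The second half of [m] is reached by conjugating the expansion for the conjugate weight. *)
have o2 := CEOJ (CEO1 (bddM (bddJ bGx) (bJ j)) j).
have o3 := CEO2J bGx j j.
apply: CEO_ext (CEOD (CEOD o1 o2) o3) => g w; rewrite eqxx mulr1.
have h2 : (2^-1 : R[i])^* = 2^-1 by rewrite -[2^-1](_ : (2^-1)%:C = _) ?cJC// fmorphV rmorph_nat.
rewrite /m /q /X /rX /dt; move: (sv g j w) (sx g j w) (Gx g w) => v x y.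
by rewrite !(cJD, cJM, conjcK) cJC h2; field; rewrite pnatr_eq0 -lt0n.
Qed.

(** The product [m j * m k] has four terms: two, conjugate to each other, without mixed conjugation,
    each of which produces [X j * X k], and two mixed ones, which count at this order only when
    [j = k]. *)
Lemma second_order j k : CEO 3 (fun g w => Gx g w * (m g j w * m g k w)
  + 2 * dtN g * (Gx g w * (X g j w * X g k w))
  - 2 * dtN g * (j == k)%:R * (Gx g w * (X g j w * rX g w))).
Proof.
have o1 := CEO2 (bddM (bddM bGx (bJ j)) (bJ k)) j k.
have o2 := CEOJ (CEO2 (bddM (bddM (bddJ bGx) (bJ j)) (bJ k)) j k).
have o3 := CEO2J (bddM (bddM bGx (bJ j)) (bX k)) j k.
have o4 := CEO2J (bddM (bddM bGx (bJ k)) (bX j)) k j.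
apply: CEO_ext (CEOD (CEOD (CEOD o1 o2) o3) o4) => g w.
rewrite /m /X /rX /dtN [k == j]eq_sym.
have e : (j == k)%:R * (sx g j w * (sx g k w)^*) = (j == k)%:R * (sx g j w * (sx g j w)^*).
  by case: eqVneq => [->|_] //; rewrite !mul0r.
have e' : (j == k)%:R * (sx g k w * (sx g j w)^*) = (j == k)%:R * (sx g j w * (sx g j w)^*).
  by case: eqVneq => [->|_] //; rewrite !mul0r.
move: (_ == _)%:R (sv g j w) (sx g j w) (sv g k w) (sx g k w) (Gx g w) e e' => b v x v' x' y e e'.
rewrite !(cJD, cJM, conjcK) cJC.
ring: e e'.
Qed.

Lemma mod2_sx g j w : mod2 j (sx g ^~ w) = X g j w. Proof. exact: sqmE. Qed.

Lemma sum_mod2_sx g w : \sum_k mod2 k (sx g ^~ w) = rX g w.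
Proof. by rewrite /rX /rho raddf_sum. Qed.

Lemma expo_sy g w : Gy g w = Gx g w * cexp (M g w + Q g w).
Proof.
rewrite /Gy /Gx /G -cexpD; congr cexp; rewrite /M /Q -!big_split /=; apply: eq_bigr => j _.
rewrite -mulrDr -mulrDr; congr (_ * _); rewrite /mod2 !sqmE sy_sv /m /q cJD; ring.
Qed.

Let Lam : R := \sum_j nm (lam 0 j).
Let Lam0 : 0 <= Lam. Proof. by apply: sumr_ge0 => j _; exact: nm_ge0. Qed.
Let lamL j : nm (lam 0 j) <= Lam.
Proof. by rewrite /Lam (bigD1 j)//= lerDl; apply: sumr_ge0 => ? _; exact: nm_ge0. Qed.
Let B : R := Lam * (2 + 2 * N%:R).

Lemma nm_M g w : nm (M g w) <= 2 * Lam * vnorm g w.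
Proof.
apply: (le_trans (nm_sum _ _ _)); rewrite /vnorm mulr_sumr; apply: ler_sum => j _.
rewrite nmM [2 * _]mulrC -mulrA ler_pM ?nm_ge0//.
apply: (le_trans (nmD _ _)); rewrite !nmM !nmJ.
have h : nm (sx g j w) * nm (sv g j w) <= 1 * nm (sv g j w).
  by rewrite ler_wpM2r ?nm_ge0//; exact: (ball1_nm j (sx_in g w)).
by move: h; rewrite mul1r; lra.
Qed.

Lemma nm_Q g w : nm (Q g w) <= Lam * vnorm g w ^+ 2.
Proof.
apply: (le_trans (nm_sum _ _ _)); rewrite expr2 [in leRHS]/vnorm mulr_sumr mulr_sumr.
apply: ler_sum => j _; rewrite nmM ler_pM ?nm_ge0// nmM nmJ ler_wpM2r ?nm_ge0//.
by rewrite /vnorm (bigD1 j)//= lerDl; apply: sumr_ge0 => ? _; exact: nm_ge0.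
Qed.

Lemma vnorm_le g w : vnorm g w <= 2 * N%:R.
Proof.
rewrite mulr_natr -[X in _ *+ X]card_ord -sumr_const.
by apply: ler_sum => k _; exact: sv_nm.
Qed.

Lemma nm_MQ g w : nm (M g w + Q g w) <= B * vnorm g w.
Proof.
apply: (le_trans (nmD _ _)); have := nm_M g w; have := nm_Q g w; have := vnorm_le g w.
have := vnorm_ge0 g w; rewrite /B; move: (nm _) (nm _) (vnorm g w) => x y S S0 S1 hx hy.
have : Lam * (S * S) <= Lam * (2 * N%:R * S) by rewrite ler_wpM2l// ler_wpM2r.
by move: hx; rewrite expr2; lra.
Qed.

Let rem g w : R[i] := Gy g w - Gx g w - Gx g w * (M g w + Q g w) - 2^-1 * (Gx g w * M g w ^+ 2).

Let B0 : 0 <= B. Proof. by rewrite mulr_ge0// addr_ge0// mulr_ge0. Qed.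

(** As [M] has order 1 and [Q] order 2, only [M ^ 2 / 2] is retained from [(M + Q) ^ 2 / 2]; the
    terms [M Q] and [Q ^ 2 / 2] join the Taylor remainder, and all are cubic in [vnorm]. *)
Lemma rem_le : exists K : R, 0 <= K /\ forall g w, nm (rem g w) <= K * cubic_bound g w.
Proof.
have [_ [KG [KG0 hG]]] := bGx.
have BB0 : 0 <= B * (2 * N%:R) by rewrite mulr_ge0// mulr_ge0.
have [K3 [K30 h3]] := cexp_taylor3 BB0.
(* [KG] bounds the exponential, [K3 * B ^ 3] the Taylor remainder, [2 * Lam ^ 2] the term [M Q] and
   [Lam ^ 2 * N] the term [Q ^ 2 / 2]; the last factor is that of [vnorm_cube]. *)
exists (KG * (K3 * B ^+ 3 + 2 * Lam ^+ 2 + Lam ^+ 2 * N%:R) *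
  (2 * N%:R ^+ 3 + 2 * N%:R ^+ 4 + 4 * N%:R ^+ 2)); split.
  by rewrite !(mulr_ge0, addr_ge0)// exprn_ge0.
move=> g w; rewrite -mulrA.
apply: (@le_trans _ _ (KG * (K3 * B ^+ 3 + 2 * Lam ^+ 2 + Lam ^+ 2 * N%:R) * vnorm g w ^+ 3)); last first.
  apply: ler_wpM2l; last exact: vnorm_cube.
  by rewrite !(mulr_ge0, addr_ge0)// exprn_ge0.
have nM := nm_M g w; have nQ := nm_Q g w; have S0 := vnorm_ge0 g w; have SN := vnorm_le g w.
have nMQ := nm_MQ g w.
have nMQ' : nm (M g w + Q g w) <= B * (2 * N%:R) by apply: (le_trans nMQ); rewrite ler_wpM2l.
have h := h3 _ nMQ'.
rewrite /rem expo_sy; move: (hG g w) nM nQ S0 SN nMQ nMQ' h.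
move: (M g w) (Q g w) (Gx g w) (vnorm g w) => m0 q0 G0 S hG0 nM nQ S0 SN nMQ nMQ' h.
rewrite (_ : _ - _ = G0 * ((cexp (m0 + q0) - 1 - (m0 + q0) - (m0 + q0) ^+ 2 / 2)
   + (m0 * q0 + (2^-1)%:C * q0 ^+ 2))); last first.
  by rewrite fmorphV rmorph_nat; field.
rewrite nmM -mulrA; apply: ler_pM; rewrite ?nm_ge0//.
apply: (le_trans (nmD _ _)); rewrite -[in leRHS]addrA [leRHS]mulrDl; apply: lerD.
  apply: (le_trans h); rewrite -mulrA -exprMn ler_wpM2l//.
  by rewrite lerXn2r ?nnegrE ?nm_ge0// mulr_ge0.
apply: (le_trans (nmD _ _)); rewrite [leRHS]mulrDl; apply: lerD.
  rewrite nmM; apply: (@le_trans _ _ ((2 * Lam * S) * (Lam * S ^+ 2))).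
    by apply: ler_pM; rewrite ?nm_ge0.
  by rewrite le_eqVlt; apply/orP; left; apply/eqP; ring.
rewrite nmM nmC nmX ger0_norm ?invr_ge0//.
have q2 : nm q0 ^+ 2 <= (Lam * S ^+ 2) * (Lam * S ^+ 2).
  by rewrite expr2; apply: ler_pM; rewrite ?nm_ge0.
have q3 : Lam ^+ 2 * S ^+ 3 * S <= Lam ^+ 2 * S ^+ 3 * (2 * N%:R).
  by rewrite ler_wpM2l// mulr_ge0 ?exprn_ge0.
have -> : Lam ^+ 2 * N%:R * S ^+ 3 = 2^-1 * (Lam ^+ 2 * S ^+ 3 * (2 * N%:R)) by field.
rewrite ler_wpM2l ?invr_ge0//; apply: (le_trans q2); apply: le_trans q3.
by rewrite le_eqVlt; apply/orP; left; apply/eqP; ring.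
Qed.

Lemma M_cmeas g : cmeas (M g).
Proof.
apply: cmeas_sum => j; apply: cmeasM; first exact: cmeas_cst.
have mx := sx_cmeas g j; have mv := sv_cmeas N0 hH hF C0 L0 g j.
by apply: cmeasD; apply: cmeasM => //; exact: cmeasJ.
Qed.

Lemma Q_cmeas g : cmeas (Q g).
Proof.
apply: cmeas_sum => j; apply: cmeasM; first exact: cmeas_cst.
have mv := sv_cmeas N0 hH hF C0 L0 g j.
by apply: cmeasM => //; exact: cmeasJ.
Qed.

Lemma rem_CEO : CEO 3 rem.
Proof.
have [K [K0 hK]] := rem_le.
have mG g : cmeas (Gx g) := bdd_meas hF g bGx.
have mr g : cmeas (rem g).
  have [mE _ _] := nice_expo.
  apply: cmeasB; last by apply: cmeasM; [exact: cmeas_cst|apply: cmeasM => //; apply: cmeasM; exact: M_cmeas].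
  apply: cmeasB; last by apply: cmeasM => //; apply: cmeasD; [exact: M_cmeas|exact: Q_cmeas].
  by apply: cmeasB => //; apply: mE => k; exact: (sy_cmeas N0 hH hF C0 L0).
have rt g := cubic_bound_rint N0 hH hF C0 L0 g.
split; first by move=> g; exact: (cint_le (mr g) (hK g) (rintZ K (rt g))).
exact: (bigO_CE_le mr rt K0 hK (cubic_bound_bigO N0 hH hF Adm C0 L0)).
Qed.

Lemma nice_drift : nice drift.
Proof.
have hs := nice_sum (index_enum 'I_N) (@nice_mod2 R N).
have hl := nice_sum (index_enum 'I_N) (fun j => niceM (nice_cst N (lam 0 j)) (nice_mod2 R j)).
have nB Phi Psi : @nice R N Phi -> nice Psi -> nice (fun x => Phi x - Psi x).
  by move=> h h'; apply: nice_ext (niceD h (niceM (nice_cst N (-1)) h')) => x; rewrite mulN1r.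
apply: niceD.
  apply: nice_sum => j; apply: (niceM (nice_cst N (lam 0 j))); apply: nB; last exact: nice_mod2.
  exact: (niceM (nice_cst N (N%:R^-1)) hs).
apply: (niceM (nice_cst N (N%:R^-1))); apply: nB; last exact: (niceM hl hl).
apply: nice_sum => j; apply: niceM hs.
exact: (niceM (nice_cst N (lam 0 j ^+ 2)) (nice_mod2 R j)).
Qed.

Lemma generator : bigO 3 (fun g => CE (Gy g) - CE (Gx g)
  - (st g - ss g)%:C * CE (fun w => Gx g w * drift (sx g ^~ w))).
Proof.
have [ix iy] := nice_cint N0 hH hF C0 L0 nice_expo.
have [id_ _] := nice_cint N0 hH hF C0 L0 (niceM nice_expo nice_drift).
(* The increment of the exponential is assembled from [M + Q], by the first order expansions, from
   half of [M ^ 2], by the second order ones, and from [rem]. *)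
have o1 := CEO_sum (index_enum 'I_N) (fun j => CEOZ (lam 0 j) (first_order j)).
have o2 := CEOZ 2^-1 (CEO_sum (index_enum 'I_N) (fun j => CEO_sum (index_enum 'I_N)
  (fun k => CEOZ (lam 0 j * lam 0 k) (second_order j k)))).
have [_ o] := CEOD (CEOD o1 o2) rem_CEO.
apply: bigO_ext o => g.
rewrite -(CEB (iy g) (ix g)) -(CEZ (st g - ss g)%:C (id_ g)) -(CEB (cintB (iy g) (ix g)) (cintZ _ (id_ g))).
apply: eq_CE => w.
set S1 := \sum_j _; set S2 := \sum_j _.
have E1 : S1 = Gx g w * (M g w + Q g w)
    + dt g * Gx g w * (\sum_j lam 0 j * X g j w) - dtN g * Gx g w * rX g w * \sum_j lam 0 j.
  rewrite /S1 /M /Q -big_split /= mulr_sumr mulr_sumr mulr_sumr -big_split -sumrB /=.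
  by apply: eq_bigr => j _; ring.
have E2 : S2 = Gx g w * M g w ^+ 2 + 2 * dtN g * Gx g w * (\sum_j lam 0 j * X g j w) ^+ 2
   - 2 * dtN g * Gx g w * rX g w * \sum_j lam 0 j ^+ 2 * X g j w.
  transitivity (\sum_j \sum_k (Gx g w * (lam 0 j * m g j w * (lam 0 k * m g k w)))
     + 2 * dtN g * Gx g w * (\sum_j \sum_k (lam 0 j * X g j w) * (lam 0 k * X g k w))
     - 2 * dtN g * Gx g w * rX g w * \sum_j \sum_k (j == k)%:R * (lam 0 j * lam 0 k * X g j w)); last first.
    congr (_ + _ * _ - _ * _).
    - rewrite expr2 /M mulr_suml mulr_sumr; apply: eq_bigr => j _.
      by rewrite !mulr_sumr.
    - by rewrite expr2 mulr_suml; apply: eq_bigr => j _; rewrite mulr_sumr.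
    - apply: eq_bigr => j _; rewrite (bigD1 j)//= eqxx mul1r big1 ?addr0// => k kj.
      by rewrite eq_sym (negPf kj) mul0r.
  rewrite mulr_sumr mulr_sumr -big_split -sumrB /=; apply: eq_bigr => j _.
  rewrite mulr_sumr mulr_sumr -big_split -sumrB /=; apply: eq_bigr => k _; ring.
rewrite E1 E2 /rem /drift sum_mod2_sx.
have e0 : \sum_j lam 0 j * (N%:R^-1 * rX g w - mod2 j (sx g ^~ w)) =
    N%:R^-1 * rX g w * (\sum_j lam 0 j) - \sum_j lam 0 j * X g j w.
  by rewrite mulr_sumr -sumrB; apply: eq_bigr => j _; rewrite mod2_sx; ring.
have e1 : \sum_j lam 0 j ^+ 2 * mod2 j (sx g ^~ w) * rX g w = rX g w * \sum_j lam 0 j ^+ 2 * X g j w.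
  by rewrite mulr_sumr; apply: eq_bigr => j _; rewrite mod2_sx; ring.
have e2 : \sum_j lam 0 j * mod2 j (sx g ^~ w) = \sum_j lam 0 j * X g j w.
  by apply: eq_bigr => j _; rewrite mod2_sx.
rewrite e0 e1 e2 -/(Gx g w) -/(Gy g w).
have -> : dtN g = dt g * N%:R^-1 by rewrite /dtN rmorphM /= fmorphV rmorph_nat.
rewrite -/(dt g).
move: (Gx g w) (Gy g w) (M g w) (Q g w) (\sum_j lam 0 j) (\sum_j lam 0 j * X g j w)
  (\sum_j lam 0 j ^+ 2 * X g j w) (rX g w) (dt g) => *; field.
by rewrite pnatr_eq0 -lt0n.
Qed.

End exponential.
End ito.

(** * The Laplace transform *)

Lemma cvg_lipschitz_at0 (K : numFieldType) (V : normedModType K) (f : K -> V) (l : V) (M : K) :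
  0 <= M -> (forall h, h != 0 -> `|h| <= 1 -> `|l - f h| <= M * `|h|) -> f @ 0^' --> l.
Proof.
move=> M0 hf; apply/cvgrPdist_le => e e0.
have M1 : 0 < M + 1 by apply: ltr_wpDl.
(* A field such as [R[i]] is only partially ordered, so the two radii have to be shown
   comparable. *)
have d0 : 0 < Num.min 1 (e / (M + 1)) by rewrite comparable_lt_min ?ltr01 ?divr_gt0// real_comparable ?ger0_real ?divr_ge0 ?ltW.
near=> h.
have h0 : h != 0 by near: h; exact: nbhs_dnbhs_neq.
have h1 : `|h| <= 1.
  near: h; apply: dnbhs0_le; exact: ltr01.
have h2 : `|h| <= e / (M + 1).
  by near: h; apply: dnbhs0_le; rewrite divr_gt0.
apply: (le_trans (hf h h0 h1)).
apply: (@le_trans _ _ ((M + 1) * `|h|)); first by rewrite ler_wpM2r// lerDl.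
by rewrite mulrC -ler_pdivlMr.
Unshelve. all: by end_near.
Qed.

Lemma is_derive_of_quotient (K : numFieldType) (V W : normedModType K) (f : V -> W) (a v : V)
    (l : W) (M : K) : 0 <= M ->
  (forall h : K, h != 0 -> `|h| <= 1 -> `|l - h^-1 *: (f (h *: v + a) - f a)| <= M * `|h|) ->
  is_derive a v f l.
Proof.
move=> M0 hf; have c := cvg_lipschitz_at0 M0 hf.
by split; [apply/cvg_ex; exists l|exact: cvg_lim c].
Qed.

Section laplace_derivative.
Context (R : realType) d (T : measurableType d) (P : probability T R) (N : nat).
Local Notation CE := (CE P).
Local Notation cint := (cint P).
Variable X : 'I_N -> T -> R.
Hypothesis mX : forall j, measurable_fun setT (X j).
Hypothesis X0 : forall j w, 0 <= X j w.
Hypothesis X1 : forall j w, X j w <= 1.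
Implicit Types (f : T -> R[i]) (lam : 'rV[R[i]]_N) (j k : 'I_N).

Definition expo lam w : R[i] := cexp (\sum_j lam 0 j * (X j w)%:C).
(** The weight [f] makes the family stable under differentiation: a partial derivative multiplies
    the weight by [X j], so one lemma covers both the gradient and the Hessian. *)
Definition wlap f lam : R[i]^o := CE (fun w => f w * expo lam w).
Definition cbdd f := cmeas f /\ exists K : R, 0 <= K /\ forall w, nm (f w) <= K.

Lemma cbddM f g : cbdd f -> cbdd g -> cbdd (fun w => f w * g w).
Proof.
move=> [mf [K [K0 hf]]] [mg [K' [K'0 hg]]]; split; first exact: cmeasM.
by exists (K * K'); split => [|w]; rewrite ?mulr_ge0// nmM ler_pM ?nm_ge0.
Qed.

Lemma cbddX j : cbdd (fun w => (X j w)%:C).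
Proof.
split; first exact: cmeasC.
by exists 1; split => // w; rewrite nmC ger0_norm.
Qed.

Lemma cbdd_cint f : cbdd f -> cint f.
Proof. by move=> [mf [K [K0 hf]]]; exact: (cint_bnd P mf hf). Qed.

Lemma cbdd_expo lam : cbdd (expo lam).
Proof.
split.
  by apply: cmeas_exp; apply: cmeas_sum => j; apply: cmeasM; [exact: cmeas_cst|exact: cmeasC].
exists (expR (\sum_j nm (lam 0 j))); split => [|w]; first exact: expR_ge0.
rewrite nm_cexp ler_expR; apply: le_trans (ler_norm _) _; apply: le_trans (nm_Re _) _.
apply: le_trans (nm_sum _ _ _) _; apply: ler_sum => j _.
by rewrite nmM nmC ger0_norm// -[leRHS]mulr1 ler_wpM2l ?nm_ge0.
Qed.

Lemma expo_shift lam j (h : R[i]) w :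
  expo (h *: 'e_j + lam) w = expo lam w * cexp (h * (X j w)%:C).
Proof.
rewrite /expo -cexpD; congr cexp; rewrite addrC.
transitivity (\sum_k (lam 0 k * (X k w)%:C + h * ((j == k)%:R * (X k w)%:C))).
  by apply: eq_bigr => k _; rewrite !mxE eqxx /= eq_sym mulrDl mulrA.
rewrite big_split /= -mulr_sumr; congr (_ + _ * _).
rewrite (bigD1 j)//= eqxx mul1r big1 ?addr0// => k kj.
by rewrite eq_sym (negPf kj) mul0r.
Qed.

(** Differentiation under the expectation by a direct bound: as [X j] takes values in [0, 1], the
    difference quotient is within [O(|h|)] of its limit, uniformly over the sample space. The
    increment [h] is complex. *)
Lemma wlap_is_derive f lam j : cbdd f ->
  is_derive lam 'e_j (wlap f) (wlap (fun w => f w * (X j w)%:C) lam).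
Proof.
move=> bf; have [K2 [K20 hK2]] := cexp_taylor2 (ler01 : (0 : R) <= 1).
have [mfe [K [K0 hK]]] := cbddM bf (cbdd_expo lam).
apply: (@is_derive_of_quotient _ _ _ _ _ _ _ (2 * (K * K2))%:C).
  by rewrite lecR mulr_ge0// mulr_ge0.
move=> h h0; rewrite !normr_nm -[1]/(1%:C) lecR => h1.
rewrite -rmorphM lecR /=.
have i0 := cbdd_cint (cbddM bf (cbdd_expo lam)).
have i1 := cbdd_cint (cbddM bf (cbdd_expo (h *: 'e_j + lam))).
have i2 := cbdd_cint (cbddM (cbddM bf (cbddX j)) (cbdd_expo lam)).
rewrite /wlap.
rewrite -[_ *: _]/(h^-1 * _) -(CEB i1 i0) -(CEZ _ (cintB i1 i0)) -(CEB i2 (cintZ _ (cintB i1 i0))).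
pose rest w := - h^-1 * (f w * expo lam w * (cexp (h * (X j w)%:C) - 1 - h * (X j w)%:C)).
have e w : f w * (X j w)%:C * expo lam w - h^-1 * (f w * expo (h *: 'e_j + lam) w - f w * expo lam w) = rest w.
  by rewrite /rest expo_shift; field.
rewrite (eq_CE _ e).
have r w : nm (rest w) <= K * K2 * nm h.
  rewrite /rest !nmM nmN.
  have hX : nm (h * (X j w)%:C) <= nm h.
    by rewrite nmM nmC ger0_norm// -[leRHS]mulr1 ler_wpM2l ?nm_ge0.
  have t := hK2 _ (le_trans hX h1).
  have nh : nm h^-1 * nm h = 1 by rewrite -nmM mulVf// nm1.
  apply: (@le_trans _ _ (nm h^-1 * (K * (K2 * nm h ^+ 2)))).
    apply: ler_wpM2l; first exact: nm_ge0.
    rewrite -nmM; apply: ler_pM; rewrite ?nm_ge0//.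
    by apply: (le_trans t); rewrite ler_wpM2l// lerXn2r ?nnegrE ?nm_ge0.
  rewrite le_eqVlt; apply/orP; left; apply/eqP.
  transitivity (nm h^-1 * nm h * (K * K2 * nm h)); last by rewrite nh mul1r.
  by move: (nm h) (nm _) => x y; ring.
have mr : cmeas rest.
  apply: cmeasM; first exact: cmeas_cst.
  apply: cmeasM => //; have [mx _] := cbddX j.
  have mh : cmeas (fun w => h * (X j w)%:C) by apply: cmeasM => //; exact: cmeas_cst.
  by apply: cmeasB => //; apply: cmeasB; [exact: cmeas_exp|exact: cmeas_cst].
rewrite -mulrA; apply: le_trans (CE_le (cint_bnd P mr r) (rint_cst P _) r) _.
by rewrite RE_cst mulrA.
Qed.

Lemma wlap_partial f j : cbdd f -> partial j (wlap f) = wlap (fun w => f w * (X j w)%:C).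
Proof.
move=> bf; apply/funext => lam; have D := wlap_is_derive lam j bf.
exact: derive_val.
Qed.

End laplace_derivative.

(** * A bounded version of the column *)

Section normalized_column.
Context (R : realType) d (T : measurableType d) (P : probability T R) (N : nat).
Variables (N0 : (0 < N)%N) (F : R -> set (set T)) (H U : R -> T -> 'M[R[i]]_N) (V : 'M[R[i]]_N).
Hypotheses (hH : hermitian_brownian_motion P H) (hF : brownian_filtration P F H).
Hypothesis hU : unitary_brownian_motion P F H V U.
Hypothesis hV : V \is unitarymx.
Local Notation rint := (rint P).
Local Notation RE := (RE P).
Local Notation CE := (CE P).
Local Notation cint := (cint P).
Local Notation l2 := (l2 P).
Variables (c : 'I_N).

Definition colnorm (r : R) w : R := \sum_k sqm (U r w k c).

(* A version of the column which is bounded everywhere and not only almost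
   everywhere. *)
Definition ncol (r : R) k w : R[i] := ((Num.max 1 (colnorm r w))^-1)%:C * U r w k c.

Lemma colnorm_ge0 r w : 0 <= colnorm r w.
Proof. by apply: sumr_ge0 => k _; exact: sqm_ge0. Qed.

(** Dividing by [max 1 n], with [n] the squared norm, leaves the squared norm
    [n / (max 1 n)^2 <= 1]; this avoids a square root and does not change unit columns. *)
Lemma ncol_ball1 r w : ball1 (ncol r ^~ w).
Proof.
have n0 := colnorm_ge0 r w.
have m1 : 1 <= Num.max 1 (colnorm r w) by rewrite le_max lexx.
have nM : colnorm r w <= Num.max 1 (colnorm r w) by rewrite le_max lexx orbT.
rewrite /ball1 /= /ncol; under eq_bigr do rewrite sqmM sqmC.
rewrite -mulr_sumr -/(colnorm r w).
have p0 : 0 < Num.max 1 (colnorm r w) by lra.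
rewrite exprVn ler_pdivrMl ?exprn_gt0// mulr1; apply: (le_trans nM).
by rewrite expr2 ler_peMr// ltW.
Qed.

Lemma ncol_gmeas r k : 0 <= r -> gmeas (F r) (ncol r k).
Proof.
move=> r0; apply: cmeasM; last exact: (u_gmeas hU).
apply: cmeasC; apply: measurable_inv_ge0 => [|w].
  apply: measurable_maxr => //; apply: measurable_sum => l; apply: cmeas_sqm.
  exact: (u_gmeas hU).
by apply: le_trans ler01 _; rewrite le_max lexx.
Qed.

Lemma ncol_ae r : 0 <= r -> {ae P, forall w, forall k, ncol r k w = U r w k c}.
Proof.
move=> r0; apply: filterS (column_norm_ae N0 hH hF hU hV c r0) => w e k.
by rewrite /ncol /colnorm e maxxx invr1 mul1r.
Qed.

(** The expansion holds for the normalised column at every sample point once [q] is redefined as the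
    missing term [q']. The two agree almost surely, so the second moment is kept. *)
Lemma ncol_sde_step Tm : 0 <= Tm -> exists C : R, 0 <= C /\
  forall s t e, 0 <= s -> t <= Tm -> 0 < e -> e ^+ 2 = t - s ->
  exists g : sde_step P F H (@ball1 R N) C (Num.sqrt Tm),
    [/\ ss g = s, st g = t, se g = e, sx g = ncol s & sy g = ncol t].
Proof.
move=> Tm0; have [C [C0 hC]] := one_step_uniform N0 hH hF hU c Tm0.
(* The added 1 covers the second moment of the normalised column. *)
exists (C + 1); split; first exact: addr_ge0.
move=> s t e s0 tT e0 ee.
have st : s <= t by rewrite -subr_ge0 -ee sqr_ge0.
have t0 : 0 <= t := le_trans s0 st.
have [_ [p [q [hp hq po ue]]]] := hC s t s0 st tT.
have eL : e <= Num.sqrt Tm.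
  have -> : e = Num.sqrt (e ^+ 2) by rewrite sqrtr_sqr gtr0_norm.
  by rewrite ler_wsqrtr// ee; lra.
have mc r k : 0 <= r -> cmeas (ncol r k) by move=> r0; exact: (F_meas hF r0 (ncol_gmeas k r0)).
have nm1 r k w : nm (ncol r k w) <= 1 by exact: (ball1_nm k (ncol_ball1 r w)).
pose q' j w := ncol t j w - (ncol s j w + (noise H s t (ncol s) j w + 'i * p j w
    - ((t - s) / 2)%:C * ncol s j w)).
have mq' j : cmeas (q' j).
  apply: cmeasB; first exact: mc.
  apply: cmeasD; first exact: mc.
  apply: cmeasB; last by apply: cmeasM; [exact: cmeas_cst|exact: mc].
  apply: cmeasD; last by apply: cmeasM; [exact: cmeas_cst|exact: l2_meas (hp j).1].
  apply: cmeasM; first exact: cmeas_cst.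
  by apply: cmeas_sum => k; apply: cmeasM; [exact: (incr_meas N0 hH s0 st)|exact: mc].
have aeq j : {ae P, forall w, q j w = q' j w}.
  apply: filterS2 (ncol_ae s0) (ncol_ae t0) => w es et.
  have -> : q' j w = U t w j c - (U s w j c + ('i * \sum_k incr H s t j k w * U s w k c + 'i * p j w
      - ((t - s) / 2)%:C * U s w j c)).
    rewrite /q' et es /noise; congr (_ - (_ + (_ * _ + _ - _))).
    by apply: eq_bigr => k _; rewrite es.
  by rewrite ue; ring.
have aes j : {ae P, forall w, sqm (q j w) = sqm (q' j w)} by apply: filterS (aeq j) => w ->.
have ms j := cmeas_sqm (mq' j).
have hb a : 0 <= a -> C * a <= (C + 1) * a by move=> a0; rewrite ler_wpM2r// lerDl.
have hp4 k : RE (fun w => sqm (p k w)) <= (C + 1) * e ^+ 4.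
  apply: le_trans (hb _ (exprn_ge0 4 (ltW e0))).
  by have [_] := hp k; rewrite -ee -exprM.
have hq6 k : RE (fun w => sqm (q' k w)) <= (C + 1) * e ^+ 6.
  apply: le_trans (hb _ (exprn_ge0 6 (ltW e0))).
  rewrite -(RE_ae (cmeas_sqm (l2_meas (hq k).1)) (ms k) (aes k)).
  by have [_] := hq k; rewrite -ee -exprM.
have lq k : l2 (q' k) by split => //; apply: rint_ae (ms k) (aes k) (l2_int (hq k).1).
have lx k : l2 (ncol s k) by exact: (l2_bnd P (mc s k s0) (nm1 s k)).
have bx k : RE (fun w => sqm (ncol s k w)) <= C + 1.
  apply: (@le_trans _ _ 1); last by rewrite lerDr.
  rewrite -[leRHS](RE_cst P); apply: RE_le; [exact: l2_int|exact: rint_cst|].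
  by move=> w; rewrite -nm_sqr expr_le1 ?nm_ge0.
have lp k : l2 (p k) by case: (hp k).
have ye j w : ncol t j w = ncol s j w + (noise H s t (ncol s) j w + 'i * p j w
    - ((t - s) / 2)%:C * ncol s j w + q' j w) by rewrite /q'; ring.
by exists (SdeStep s0 st e0 ee eL (ncol_ball1 s) (ncol_ball1 t) (fun k => ncol_gmeas k s0) lx bx lp hp4 lq hq6 po ye).
Qed.

End normalized_column.

(** For [h > 0] the expansion starts at [t] and suffices; for [h < 0] it starts at [t + h] and
    produces [psi (t + h)], which the second bound compares with [psi t]. With [e = sqrt |h|], all
    errors are [O(e)] after division by [h]. *)
Lemma time_derivative_of_expansion (R : realType) (phi : R -> R[i]^o) (psi : R -> R[i]) (t K : R) :
  0 <= t -> 0 <= K ->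
  (forall s r e, 0 <= s -> r <= t + 1 -> 0 < e -> e ^+ 2 = r - s ->
    nm ((phi r : R[i]) - phi s - (r - s)%:C * psi s) <= K * e ^+ 3 /\
    nm (psi r - psi s) <= K * e) ->
  is_time_derivative phi t (psi t).
Proof.
move=> t0 K0 hexp; apply/cvgrPdist_le => eps eps0.
(* The norm of [R[i]^o] takes values in [R[i]], where a positive [eps] is necessarily real. *)
pose a := Re eps.
have epsE : eps = a%:C by apply: ReIm_eq => //; move: eps0; rewrite ltcE => /andP[/eqP].
have a0 : 0 < a by move: eps0; rewrite epsE ltcR.
have K1 : 0 < 2 * K + 1 by lra.
rewrite near_withinE; near=> h => th.
have h0 : h != 0 by near: h; exact: nbhs_dnbhs_neq.
have h1 : `|h| <= 1 by near: h; apply: dnbhs0_le; exact: ltr01.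
have h2 : `|h| <= (a / (2 * K + 1)) ^+ 2.
  by near: h; apply: dnbhs0_le; rewrite exprn_gt0// divr_gt0.
pose e := Num.sqrt `|h|.
have e0 : 0 < e by rewrite sqrtr_gt0 normr_gt0.
have ee : e ^+ 2 = `|h| by rewrite sqr_sqrtr.
have ea : 2 * K * e <= a.
  have : e <= a / (2 * K + 1).
    rewrite -(@ler_pXn2r _ 2) ?nnegrE ?ee// ?(ltW e0)//.
    by rewrite divr_ge0// ltW.
  rewrite ler_pdivlMr//; move: e0; set b := e; move=> b0; nra.
have -> : `|psi t - (h^-1)%:C *: (phi (t + h) - phi t)| =
    (nm (psi t - (h^-1)%:C * ((phi (t + h) : R[i]) - phi t)))%:C by [].
rewrite epsE lecR; apply: le_trans ea.
have hinv : (h^-1)%:C * h%:C = 1 :> R[i] by rewrite -rmorphM /= mulVf.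
case: (ltgtP h 0) h0 => // hh _.
- have hN : `|h| = - h by rewrite ltr0_norm.
  have [||D1 D2] := hexp (t + h) t e th _ e0; first by lra.
    by rewrite ee hN; ring.
  set D := (phi t : R[i]) - _ - _ in D1.
  have -> : psi t - (h^-1)%:C * ((phi (t + h) : R[i]) - phi t) = (psi t - psi (t + h)) + (h^-1)%:C * D.
    have -> : (phi t : R[i]) = D + phi (t + h) - h%:C * psi (t + h).
      by rewrite /D (_ : t - (t + h) = - h) ?rmorphN /=; ring.
    rewrite (_ : _ - _ = psi t + (h^-1)%:C * D - ((h^-1)%:C * h%:C) * psi (t + h)); last by ring.
    by rewrite hinv; ring.
  apply: (le_trans (nmD _ _)); rewrite (_ : 2 * K * e = K * e + K * e); last by ring.
  apply: lerD => //; rewrite nmM nmC normfV -ee.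
  by rewrite ler_pdivrMl ?exprn_gt0// mulrCA -exprSr.
- have hN : `|h| = h by rewrite gtr0_norm.
  have [||D1 D2] := hexp t (t + h) e t0 _ e0; first by move: h1; rewrite hN; lra.
    by rewrite ee hN; ring.
  set D := (phi (t + h) : R[i]) - _ - _ in D1.
  have -> : psi t - (h^-1)%:C * ((phi (t + h) : R[i]) - phi t) = - (h^-1)%:C * D.
    rewrite /D (_ : t + h - t = h); last by ring.
    rewrite (_ : - _ * _ = - (h^-1)%:C * ((phi (t + h) : R[i]) - phi t) + (h^-1)%:C * h%:C * psi t); last by ring.
    by rewrite hinv; ring.
  apply: (@le_trans _ _ (K * e)); last by rewrite -mulrA ler_peMl ?mulr_ge0 ?(ltW e0)//; lra.
  rewrite nmM nmN nmC normfV -ee.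
  by rewrite ler_pdivrMl ?exprn_gt0// mulrCA -exprSr.
Unshelve. all: by end_near.
Qed.

Section laplace_column.
Context (R : realType) d (T : measurableType d) (P : probability T R) (N : nat).
Variables (N0 : (0 < N)%N) (F : R -> set (set T)) (H U : R -> T -> 'M[R[i]]_N) (V : 'M[R[i]]_N).
Hypotheses (hH : hermitian_brownian_motion P H) (hF : brownian_filtration P F H).
Hypothesis hU : unitary_brownian_motion P F H V U.
Hypothesis hV : V \is unitarymx.
Local Notation CE := (CE P).
Local Notation cint := (cint P).
Variables (c : 'I_N).
Implicit Types (lam : 'rV[R[i]]_N) (j k : 'I_N).

Let X r j w : R := sqm (ncol U c r j w).

Let X0 r j w : 0 <= X r j w. Proof. exact: sqm_ge0. Qed.
Let X1 r j w : X r j w <= 1.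
Proof. exact: (ball1_sqm j (ncol_ball1 U c r w)). Qed.
Let mX r j : 0 <= r -> measurable_fun setT (X r j).
Proof. by move=> r0; apply: cmeas_sqm; exact: (F_meas hF r0 (ncol_gmeas hU c j r0)). Qed.

Let cbdd1 : cbdd (fun _ : T => (1 : R[i])).
Proof. by split; [exact: cmeas_cst|exists 1; split => // w; rewrite nm1]. Qed.

Lemma exp_column_ae r lam : 0 <= r ->
  {ae P, forall w, expo (X r) lam w = exp_column U c r lam w}.
Proof.
move=> r0; apply: filterS (ncol_ae N0 hH hF hU hV c r0) => w e.
rewrite /expo /exp_column; congr cexp; apply: eq_bigr => j _.
by rewrite /X e sqm_normr.
Qed.

Lemma exp_column_cmeas r lam : 0 <= r -> cmeas (exp_column U c r lam).
Proof.
move=> r0; apply: (@cmeas_exp _ _ _ (fun w => \sum_j lam 0 j * `|U r w j c| ^+ 2)).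
apply: cmeas_sum => j; apply: cmeasM; first exact: cmeas_cst.
under eq_fun do rewrite -sqm_normr.
by apply: cmeasC; apply: cmeas_sqm; exact: (F_meas hF r0 (u_gmeas hU _ _ r0)).
Qed.

Lemma exp_column_cint r lam : 0 <= r -> cint (exp_column U c r lam).
Proof.
move=> r0; apply: cint_ae (exp_column_cmeas lam r0) (exp_column_ae lam r0) _.
exact: cbdd_cint (cbdd_expo (fun j => mX j r0) (@X0 r) (@X1 r) lam).
Qed.

Lemma laplace_wlap r : 0 <= r -> laplace P U c r = wlap P (X r) (fun=> 1).
Proof.
move=> r0; apply/funext => lam; rewrite /laplace /wlap.
have [me _] := cbdd_expo (fun j => mX j r0) (@X0 r) (@X1 r) lam.
transitivity (CE (expo (X r) lam)); last by apply: eq_CE => w; rewrite mul1r.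
by symmetry; apply: CE_ae me (exp_column_cmeas lam r0) (exp_column_ae lam r0).
Qed.

Let psi lam r := CE (fun w => expo (X r) lam w * drift lam (ncol U c r ^~ w)).

Lemma laplace_time lam t : 0 <= t ->
  is_time_derivative (laplace P U c ^~ lam) t (psi lam t).
Proof.
(* The horizon [t + 1] leaves room for difference quotients with [|h| <= 1]. *)
move=> t0; have T0 : 0 <= t + 1 by lra.
have [C [C0 hC]] := ncol_sde_step N0 hH hF hU hV c T0.
have L0 := sqrtr_ge0 (t + 1).
have [K1 [K10 h1]] := generator N0 hH hF C0 L0 lam.
have [K2 [K20 h2]] := nice_bigO N0 hH hF C0 L0 (niceM (nice_expo lam) (nice_drift lam)).
apply: (@time_derivative_of_expansion _ _ (psi lam) t (K1 + K2)) => //; first exact: addr_ge0.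
move=> s r e s0 rT e0 ee; have [g [gs gt ge gx gy]] := hC s r e s0 rT e0 ee.
have r0 : 0 <= r by have := sqr_ge0 e; rewrite ee; lra.
have l q : wlap P (X q) (fun=> 1) lam = CE (expo (X q) lam) by apply: eq_CE => w; rewrite mul1r.
rewrite !laplace_wlap// !l; split.
  apply: (@le_trans _ _ (K1 * e ^+ 3)); last by rewrite ler_wpM2r ?exprn_ge0 ?(ltW e0)// lerDl.
  by have := h1 g; rewrite gs gt ge gx gy.
apply: (@le_trans _ _ (K2 * e ^+ 1)); last by rewrite expr1 ler_wpM2r ?(ltW e0)// lerDr.
by have := h2 g; rewrite ge gx gy.
Qed.

Lemma laplace_partial r k : 0 <= r ->
  partial k (laplace P U c r) = wlap P (X r) (fun w => 1 * (X r k w)%:C).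
Proof.
by move=> r0; rewrite laplace_wlap// (wlap_partial P (fun j => mX j r0) (@X0 r) (@X1 r) k cbdd1).
Qed.

Lemma laplace_partial2 r j k : 0 <= r ->
  partial j (partial k (laplace P U c r)) =
  wlap P (X r) (fun w => 1 * (X r k w)%:C * (X r j w)%:C).
Proof.
move=> r0; rewrite laplace_partial// (wlap_partial P (fun j => mX j r0) (@X0 r) (@X1 r))//.
by apply: cbddM => //; exact: (cbddX (fun j => mX j r0)).
Qed.

End laplace_column.

Theorem theorem4p1 (R : realType) (d : measure_display) (T : measurableType d)
    (P : probability T R) (N : nat) (hN : (0 < N)%N)
    (F : R -> set (set T)) (H U : R -> T -> 'M[R[i]]_N) (V : 'M[R[i]]_N)
    (hV : V \is unitarymx)
    (hH : hermitian_brownian_motion P H)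
    (hF : brownian_filtration P F H)
    (hU : unitary_brownian_motion P F H V U) :
  let phi := laplace P U (Ordinal hN) in
  forall (lambda : 'rV[R[i]]_N) (t : R), 0 <= t ->
  [/\ cintegrable P setT (exp_column U (Ordinal hN) t lambda),
      forall j, partial_ex j (phi t) lambda,
      forall j k, partial_ex j (partial k (phi t)) lambda
    & is_time_derivative (phi ^~ lambda) t
        ((\sum_j lambda 0 j) / N%:R * phi t lambda
         + bilin (N%:R^-1 *: sqv lambda - lambda) (grad (phi t) lambda)
         - N%:R^-1 * bilin lambda (lambda *m (hess (phi t) lambda)^T))].
Proof.
move=> phi lam t t0; set c := Ordinal hN.
pose X j w := sqm (ncol U c t j w).
have mX j : measurable_fun setT (X j).
  by apply: cmeas_sqm; exact: (F_meas hF t0 (ncol_gmeas hU c j t0)).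
have X0 j w : 0 <= X j w by exact: sqm_ge0.
have X1 j w : X j w <= 1 by exact: (ball1_sqm j (ncol_ball1 U c t w)).
have b1 : cbdd (fun _ : T => (1 : R[i])) by split; [exact: cmeas_cst|exists 1; split => // w; rewrite nm1].
have bX k : cbdd (fun w => 1 * (X k w)%:C : R[i]) by apply: cbddM => //; exact: cbddX.
have bXX j k : cbdd (fun w => 1 * (X k w)%:C * (X j w)%:C : R[i]) by apply: cbddM => //; exact: cbddX.
split.
- exact: (exp_column_cint hN hH hF hU hV).
- move=> j; rewrite /partial_ex /phi (laplace_wlap hN hH hF hU hV c t0).
  by have D := wlap_is_derive P mX X0 X1 lam j b1; exact: ex_derive.
- move=> j k; rewrite /partial_ex /phi (laplace_partial hN hH hF hU hV c k t0).
  by have D := wlap_is_derive P mX X0 X1 lam j (bX k); exact: ex_derive.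
have := @laplace_time _ _ _ _ _ hN _ _ _ _ hH hF hU hV c lam t t0; congr (is_time_derivative _ _ _).
have be := cbdd_expo mX X0 X1 lam.
have ce f : cbdd f -> cint P (fun w => f w * expo X lam w).
  by move=> bf; exact: cbdd_cint (cbddM bf be).
pose Y j w : R[i] := 1 * (X j w)%:C.
pose YY j k w : R[i] := 1 * (X k w)%:C * (X j w)%:C.
have -> : phi t lam = CE P (fun w => 1 * expo X lam w).
  by rewrite /phi (laplace_wlap hN hH hF hU hV c t0).
have gE j : grad (phi t) lam 0 j = CE P (fun w => Y j w * expo X lam w).
  by rewrite mxE /phi (laplace_partial hN hH hF hU hV c j t0).
have hE j k : hess (phi t) lam j k = CE P (fun w => YY j k w * expo X lam w).
  by rewrite mxE /phi (laplace_partial2 hN hH hF hU hV c j k t0).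
(* The right-hand side of the equation as one expectation, to be compared with the integrand
   produced by the generator. *)
pose D w : R[i] := (\sum_j lam 0 j) / N%:R * (1 * expo X lam w)
  + \sum_j (N%:R^-1 * lam 0 j ^+ 2 - lam 0 j) * (Y j w * expo X lam w)
  - N%:R^-1 * \sum_j \sum_k lam 0 j * lam 0 k * (YY j k w * expo X lam w).
have i1 : cint P (fun w => (\sum_j lam 0 j) / N%:R * (1 * expo X lam w)) by apply: cintZ; exact: (ce _ b1).
have i2 j : cint P (fun w => (N%:R^-1 * lam 0 j ^+ 2 - lam 0 j) * (Y j w * expo X lam w)).
  by apply: cintZ; exact: (ce _ (bX j)).
have i3 j k : cint P (fun w => lam 0 j * lam 0 k * (YY j k w * expo X lam w)).
  by apply: cintZ; exact: (ce _ (bXX j k)).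
have i3' : cint P (fun w => \sum_j \sum_k lam 0 j * lam 0 k * (YY j k w * expo X lam w)).
  by apply: cint_sum => j; exact: cint_sum.
have i2' := cint_sum (index_enum 'I_N) i2.
transitivity (CE P D); last first.
  rewrite /D (CEB (cintD i1 i2') (cintZ _ i3')) (CED i1 i2') (CEZ _ (ce _ b1)) (CEZ _ i3').
  congr (_ + _ - _ * _).
    rewrite /bilin CE_sum//; apply: eq_bigr => j _.
    by rewrite (CEZ _ (ce _ (bX j))) gE !mxE.
  rewrite /bilin CE_sum; last by move=> j; exact: cint_sum.
  apply: eq_bigr => j _; rewrite CE_sum// mxE mulr_sumr; apply: eq_bigr => k _.
  by rewrite (CEZ _ (ce _ (bXX j k))) mxE hE mulrA.
apply: CE_ae.
- have [mD _ _] := niceM (nice_expo lam) (nice_drift lam).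
  by apply: mD => k; exact: (F_meas hF t0 (ncol_gmeas hU c k t0)).
- exact: cint_meas (cintB (cintD i1 i2') (cintZ _ i3')).
(* The two integrands agree where the column has norm 1: there the sum of the [mod2 k] in [drift]
   becomes 1. *)
apply: filterS2 (column_norm_ae hN hH hF hU hV c t0) (ncol_ae hN hH hF hU hV c t0) => w e1 e2.
have S1 : \sum_k mod2 k (ncol U c t ^~ w) = 1.
  rewrite -raddf_sum /=; congr (_%:C); rewrite -[RHS]e1.
  by apply: eq_bigr => k _; rewrite e2.
rewrite /D /drift S1 -/(expo X lam w).
have -> : \sum_j lam 0 j * (N%:R^-1 * 1 - mod2 j (ncol U c t ^~ w)) =
    N%:R^-1 * (\sum_j lam 0 j) - \sum_j lam 0 j * (X j w)%:C.
  by rewrite mulr_sumr -sumrB; apply: eq_bigr => j _; rewrite /mod2 /X; ring.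
have -> : \sum_j lam 0 j ^+ 2 * mod2 j (ncol U c t ^~ w) * 1 = \sum_j lam 0 j ^+ 2 * (X j w)%:C.
  by apply: eq_bigr => j _; rewrite mulr1.
have -> : \sum_j (N%:R^-1 * lam 0 j ^+ 2 - lam 0 j) * (Y j w * expo X lam w) =
    expo X lam w * (N%:R^-1 * (\sum_j lam 0 j ^+ 2 * (X j w)%:C) - \sum_j lam 0 j * (X j w)%:C).
  rewrite (mulr_sumr _ _ _ N%:R^-1) -sumrB mulr_sumr; apply: eq_bigr => j _; rewrite /Y; ring.
have -> : \sum_j \sum_k lam 0 j * lam 0 k * (YY j k w * expo X lam w) =
    expo X lam w * (\sum_j lam 0 j * (X j w)%:C) ^+ 2.
  rewrite expr2 mulr_suml mulr_sumr; apply: eq_bigr => j _.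
  by rewrite mulr_sumr mulr_sumr; apply: eq_bigr => k _; rewrite /YY; ring.
have -> : \sum_j lam 0 j * mod2 j (ncol U c t ^~ w) = \sum_j lam 0 j * (X j w)%:C by [].
rewrite -/(expo X lam w).
move: (expo X lam w) (\sum_j lam 0 j) (\sum_j lam 0 j * (X j w)%:C)
  (\sum_j lam 0 j ^+ 2 * (X j w)%:C) => *; field.
by rewrite pnatr_eq0 -lt0n.
Qed.
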